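(* Assume $\alpha=2-2H$ with $H\in(1/2,1)$, $\sigma>0$, $\mathbb E|x_0|^2<\infty$, and $b(x)=Bx$ for a constant $d\times d$ matrix $B$. For a positive integer $N$ with $k=T/N<1$ set $t_n=nk$ and define \[ x_n=x_0+\frac{k^{\alpha}}{\Gamma(1+\alpha)}\sum_{j=1}^n Bx_{j-1}\big((n-j+1)^{\alpha}-(n-j)^{\alpha}\big)+G(t_n),\qquad 0\le n\le N. \] Then there is a constant $C(T,H)$ independent of $N$ such that \[ \sup_{0\le n\le N}\|x_n-x(t_n)\|\le \begin{cases} C(T,H)\,k^{3-3H}, & H\in(3/4,1),\\ C(T,H)\,\sqrt{|\ln k|}\,k^{3/4}, & H=3/4,\\ C(T,H)\,k^{3/2-H}, & H\in(1/2,3/4). \end{cases} \]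
   Context: Fix $T>0$, $d\ge1$. On a probability space let $x_0$ be an $\mathbb R^d$-valued random variable and $B_H$ a $d$-dimensional process with independent fractional Brownian motion components of Hurst index $H$ (centered Gaussian, $B_H^i(0)=0$, covariance $\tfrac12(t^{2H}+s^{2H}-|t-s|^{2H})$). Let $G(t)=\frac{\sigma}{\Gamma(\alpha)}\int_0^t (t-s)^{\alpha-1}\,dB_H(s)$ and let $x(t)$, $t\in[0,T]$, be the unique continuous strong solution of \[ x(t)=x_0+\frac{1}{\Gamma(\alpha)}\int_0^t (t-s)^{\alpha-1} Bx(s)\,ds+G(t). \] The scheme uses the same realization of $x_0$ and $G$. $\|v\|:=\sqrt{\mathbb E|v|^2}$. *)

(* Defs.v *)
From HB Require Import structures.
From mathcomp Require Import all_boot all_order all_algebra.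
From mathcomp Require Import all_classical all_reals all_analysis.
Set Implicit Arguments. Unset Strict Implicit. Unset Printing Implicit Defensive.
Import Order.TTheory GRing.Theory Num.Theory.
Import numFieldNormedType.Exports.
Local Open Scope classical_set_scope.
Local Open Scope ring_scope.

Definition Gamma (R : realType) (a : R) : R :=
  Rintegral lebesgue_measure `[0%R, +oo[ (fun s => s `^ (a - 1) * expR (- s)).

Definition fbm_cov (R : realType) (H t s : R) : R :=
  (t `^ (2 * H) + s `^ (2 * H) - `|t - s| `^ (2 * H)) / 2.

(* Y is a centered Gaussian real random variable with variance v
   (characteristic function exp(-u^2 v/2); allows degenerate v = 0). *)
Definition centered_gaussian (dT : measure_display) (Omega : measurableType dT)
    (R : realType) (P : probability Omega R) (Y : Omega -> R) (v : R) : Prop :=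
  measurable_fun setT Y /\
  forall u : R,
    (\int[P]_w (cos (u * Y w))%:E = (expR (- (u ^+ 2 * v) / 2))%:E)%E /\
    (\int[P]_w (sin (u * Y w))%:E = 0)%E.

(* BH : 'I_d -> time -> Omega -> R is a d-dimensional fractional Brownian
   motion with Hurst index H, i.e. a centered Gaussian process indexed by
   'I_d x [0,oo) whose covariance is delta_{ij} R_H(t,s): every finite
   linear combination is centered Gaussian with the corresponding variance.
   (Jointly Gaussian + zero cross covariance = independent components.) *)
Definition is_fBm (dT : measure_display) (Omega : measurableType dT)
    (R : realType) (P : probability Omega R) (d : nat) (H : R)
    (BH : 'I_d -> R -> Omega -> R) : Prop :=
  forall (m : nat) (idx : 'I_m -> 'I_d) (tm : 'I_m -> R) (c : 'I_m -> R),
    (forall j, 0 <= tm j) ->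
    centered_gaussian P (fun w => \sum_(j < m) c j * BH (idx j) (tm j) w)
      (\sum_(j < m) \sum_(l < m)
          (if idx j == idx l then c j * c l * fbm_cov H (tm j) (tm l) else 0)).

(* Left-point Riemann-Stieltjes sum of int_0^t (t-s)^(alpha-1) dB^i(s)
   over the uniform partition s_j = j t / m. *)
Definition frac_sum (dT : measure_display) (Omega : measurableType dT)
    (R : realType) (d : nat) (BH : 'I_d -> R -> Omega -> R)
    (alpha t : R) (m : nat) (i : 'I_d) (w : Omega) : R :=
  \sum_(j < m) (t - j%:R * t / m%:R) `^ (alpha - 1) *
     (BH i (j.+1%:R * t / m%:R) w - BH i (j%:R * t / m%:R) w).

Definition msq (dT : measure_display) (Omega : measurableType dT)
    (R : realType) (P : probability Omega R) (d : nat)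
    (V : Omega -> 'cV[R]_d) : \bar R :=
  (\int[P]_w (\sum_(i < d) (V w i 0) ^+ 2)%:E)%E.

Definition frac_int (R : realType) (d : nat) (alpha t : R)
    (f : R -> 'cV[R]_d) : 'cV[R]_d :=
  \col_i Rintegral lebesgue_measure `[0%R, t]
     (fun s => (t - s) `^ (alpha - 1) * f s i 0).

Definition conv_rate (R : realType) (H k : R) : R :=
  if (3 / 4 < H) then k `^ (3 - 3 * H)
  else if H == 3 / 4 then Num.sqrt `|ln k| * k `^ (3 / 4)
  else k `^ (3 / 2 - H).

(* Main.v *)
Require Import Defs.
From HB Require Import structures.
From mathcomp Require Import all_boot all_order all_algebra.
From mathcomp Require Import all_classical all_reals all_analysis.
From mathcomp Require Import measurable_realfun ring lra zify.
Import Order.TTheory GRing.Theory Num.Theory.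
Import numFieldNormedType.Exports.
Local Open Scope classical_set_scope.
Local Open Scope ring_scope.

Set Implicit Arguments.
Unset Strict Implicit.
Unset Printing Implicit Defensive.

(** Put [a = alpha = 2 - 2 H].  Passing to the limit in the covariances of the
    Riemann-Stieltjes sums (by a Toeplitz argument), each component of [G] has
    covariance [c1 (s^a + t^a - |t - s|^a)] on every grid, that of a multiple of
    fractional Brownian motion of Hurst index [a / 2 = 1 - H < 1/2]; hence its
    increments over disjoint intervals are negatively correlated.

    The scheme of step [k] is compared with the scheme of step [h = k / M].
    Splitting the coarse cells into fine ones and applying a discrete
    fractional Gronwall inequality, the difference is controlled by a weighted
    sum of increments of the fine scheme inside the coarse cells.  The noise
    part of this sum is bounded by its diagonal, because of the negative
    correlations, giving the square root of [k^a \sum_m w_m^2] for the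
    quadrature weights [w_m = ((m+1) k)^a - (m k)^a]; the initial value
    contributes [\sum_m w_m^2], and the rest is Hoelder continuous of order
    [a + eta] with [eta = min (a / 2) ((1 - a) / 2)].  All bounds are uniform
    in [M].

    As [M] grows the fine scheme converges to the solution along almost every
    path, so Fatou's lemma carries the bound over to the solution.  The three
    regimes of the rate come from the growth of [\sum_m w_m^2]. *)

Section PowerInequalities.
Context {R : realType}.
Implicit Types a b x r s z : R.

Lemma powR_bernoulli x r : 0 <= x -> 0 <= r <= 1 -> x `^ r <= 1 + r * (x - 1).
Proof.
move=> x0 /andP[]; rewrite le_eqVlt => /orP[/eqP <- _|r0].
  by rewrite powRr0 mul0r addr0.
rewrite le_eqVlt => /orP[/eqP ->|r1]; first by rewrite powRr1 // mul1r addrC subrK.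
have r1' : 0 < 1 - r by rewrite subr_gt0.
have := @conjugate_powR R (x `^ r) 1 r^-1 (1 - r)^-1 (powR_ge0 _ _) ler01.
rewrite !invr_gt0 !invrK => /(_ r0 r1'); rewrite addrC subrK => /(_ erefl).
rewrite -powRrM divff ?gt_eqF// powRr1// powR1 mul1r !mulr1 => /le_trans; apply.
by lra.
Qed.

Lemma powR_tangent a b r : 0 < a -> 0 <= b -> 0 <= r <= 1 ->
  b `^ r <= a `^ r + r * (b - a) * a `^ (r - 1).
Proof.
move=> a0 b0 r01.
have := @powR_bernoulli (b / a) r (divr_ge0 b0 (ltW a0)) r01.
rewrite -(ler_pM2l (powR_gt0 r a0)) -powRM ?(ltW a0) ?divr_ge0 ?(ltW a0)//.
rewrite mulrCA divff ?gt_eqF// mulr1 => /le_trans; apply.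
rewrite powRB; last by apply/implyP => _; rewrite gt_eqF.
rewrite powRr1 ?(ltW a0)// le_eqVlt; apply/orP; left; apply/eqP.
by field; rewrite gt_eqF.
Qed.

Lemma powR_le_npow a b s : 0 < b -> b <= a -> s <= 0 -> a `^ s <= b `^ s.
Proof.
move=> b0 ba s0; have a0 := lt_le_trans b0 ba.
rewrite -[s]opprK !(powRN _ (- s)) lef_pV2 ?posrE ?powR_gt0//.
by apply: ge0_ler_powR => //; rewrite ?oppr_ge0// nnegrE ltW.
Qed.

Lemma powR_le_mono a b r : 0 <= r -> 0 <= a -> a <= b -> a `^ r <= b `^ r.
Proof.
move=> r0 a0 ab; apply: ge0_ler_powR => //; rewrite nnegrE //.
exact: le_trans ab.
Qed.

Lemma powR_mul1B a r : 0 < a -> a * a `^ (r - 1) = a `^ r.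
Proof.
move=> a0; rewrite powRB; last by apply/implyP => _; rewrite gt_eqF.
by rewrite powRr1 ?ltW// mulrCA divff ?gt_eqF ?mulr1.
Qed.

Lemma powRD_gt0 a r s : 0 < a -> a `^ (r + s) = a `^ r * a `^ s.
Proof. by move=> a0; rewrite powRD//; apply/implyP => _; rewrite gt_eqF. Qed.

Lemma powR_diff_le a b r : 0 <= b -> b <= a -> 0 < a -> r <= 1 ->
  a `^ r - b `^ r <= (a - b) * a `^ (r - 1).
Proof.
move=> b0 ba a0 r1; rewrite mulrBl powR_mul1B// lerD2l lerN2.
move: b0; rewrite le_eqVlt => /orP[/eqP <-|b0]; first by rewrite mul0r powR_ge0.
rewrite -(powR_mul1B _ b0) ler_pM2l//.
by apply: powR_le_npow => //; lra.
Qed.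

Lemma powR_diff_le_powR a b r : 0 <= b -> b <= a -> 0 < r <= 1 ->
  a `^ r - b `^ r <= (a - b) `^ r.
Proof.
move=> b0; rewrite le_eqVlt => /orP[/eqP ->|ba] /andP[r0 r1].
  by rewrite subrr powR_ge0.
have a0 := le_lt_trans b0 ba.
apply: (le_trans (powR_diff_le b0 (ltW ba) a0 r1)).
have ab : 0 < a - b by rewrite subr_gt0.
rewrite -[leRHS](powR_mul1B _ ab) ler_pM2l//.
by apply: powR_le_npow => //; lra.
Qed.

Lemma powR_concave4 x a b r : 0 <= x -> 0 <= a -> 0 <= b -> 0 <= r <= 1 ->
  (x + a + b) `^ r + x `^ r <= (x + a) `^ r + (x + b) `^ r.
Proof.
move=> x0 a0 b0 r01.
have [xa|xa] := leP (x + a) 0.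
  have -> : x = 0 by lra.
  have -> : a = 0 by lra.
  by rewrite !add0r addrC.
have [xb|xb] := leP (x + b) 0.
  have -> : x = 0 by lra.
  have -> : b = 0 by lra.
  by rewrite !add0r addr0.
have xab : 0 <= x + a + b by lra.
have A1 := powR_tangent xa xab r01.
have A2 := powR_tangent xa x0 r01.
have B1 := powR_tangent xb xab r01.
have B2 := powR_tangent xb x0 r01.
have [ab|ab] := leP (a + b) 0.
  have -> : a = 0 by lra.
  have -> : b = 0 by lra.
  by rewrite !addr0.
rewrite -(ler_pM2l ab).
set F := _ `^ r in A1 B1 *; set f := x `^ r in A2 B2 *.
set fa := _ `^ r in A1 A2 *; set fb := _ `^ r in B1 B2 *.
have {}A1 := ler_wpM2l a0 A1; have {}A2 := ler_wpM2l b0 A2.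
have {}B1 := ler_wpM2l b0 B1; have {}B2 := ler_wpM2l a0 B2.
apply: le_trans (le_trans (lerD (lerD A1 A2) (lerD B1 B2)) _).
  by rewrite le_eqVlt; apply/orP; left; apply/eqP; ring.
by rewrite le_eqVlt; apply/orP; left; apply/eqP; ring.
Qed.

Lemma powR_incr_le_powR x t a r : 0 <= x -> 0 <= t -> 0 < a -> 0 <= r ->
  a + r <= 1 -> x `^ r * ((x + t) `^ a - x `^ a) <= t `^ (a + r).
Proof.
move=> x0; rewrite le_eqVlt => /orP[/eqP <- *|t0 a0 r0 ar].
  by rewrite addr0 subrr mulr0 powR_ge0.
have xt : 0 < x + t by rewrite ltr_wpDl.
have xxt : x <= x + t by lra.
apply: (@le_trans _ _ ((x + t) `^ r * ((x + t - x) * (x + t) `^ (a - 1)))).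
  apply: ler_pM; rewrite ?powR_ge0// ?subr_ge0 ?powR_le_mono ?(ltW a0)//.
  by apply: powR_diff_le => //; lra.
rewrite mulrCA -powRD_gt0// (_ : r + _ = a + r - 1); last by ring.
rewrite (_ : x + t - x = t); last by ring.
rewrite -(powR_mul1B (a + r) t0) ler_pM2l//.
by apply: powR_le_npow; lra.
Qed.

Lemma sum_powR_tail z (q p : nat) : 0 < z <= 1 -> (0 < q)%N ->
  \sum_(m < p) (m + q).+1%:R `^ (- z - 1) <= q%:R `^ (- z) / z.
Proof.
move=> /andP[z0 z1] q0.
suff : \sum_(m < p) (m + q).+1%:R `^ (- z - 1) <=
    (q%:R `^ (- z) - (p + q)%:R `^ (- z)) / z.
  by move/le_trans; apply; rewrite ler_pM2r ?invr_gt0// gerBl powR_ge0.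
elim: p => [|p IH]; first by rewrite big_ord0 add0n subrr mul0r.
rewrite big_ord_recr/=; apply: (le_trans (lerD IH (lexx _))).
rewrite -lerBrDl -mulrBl ler_pdivlMr// addSn.
have n0 : 0 < (p + q)%:R :> R by rewrite ltr0n addn_gt0 q0 orbT.
set n := (p + q)%N in n0 *.
have n1 : 0 < n.+1%:R :> R by rewrite ltr0n.
have nn : n%:R <= n.+1%:R :> R by rewrite ler_nat.
have z01 : 0 <= z <= 1 by rewrite (ltW z0) z1.
have := powR_tangent n1 (ltW n0) z01.
rewrite -(ler_pM2r (powR_gt0 (- z) n1)) mulrDl -!mulrA -!powRD_gt0//.
rewrite subrr powRr0 (_ : z - 1 - z = -1); last by ring.
move=> h; have {h} : n%:R `^ z * n.+1%:R `^ (- z) + z * n.+1%:R `^ (- 1) <= 1.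
  by apply: (le_trans (lerD h (lexx _))); rewrite (natrD _ 1 n); lra.
rewrite -(ler_pM2l (powR_gt0 (- z) n0)) mulrDr mulrA -powRD_gt0// addNr powRr0.
move=> h; have {}h : n%:R `^ (- z) * (z * n.+1%:R `^ (-1)) <=
   n%:R `^ (- z) - n.+1%:R `^ (- z) by lra.
apply: le_trans (le_trans _ h) _; last first.
  by rewrite le_eqVlt; apply/orP; left; apply/eqP; ring.
rewrite mulrCA mulrC ler_pM2l// powRD_gt0// ler_wpM2r ?powR_ge0//.
by apply: powR_le_npow => //; lra.
Qed.

Lemma sum_powR_le z (n : nat) : 0 < z <= 1 ->
  \sum_(m < n) m.+1%:R `^ (z - 1) <= n%:R `^ z / z.
Proof.
move=> /andP[z0 z1]; elim: n => [|n IH].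
  by rewrite big_ord0 divr_ge0 ?powR_ge0 ?ltW.
rewrite big_ord_recr/=; apply: (le_trans (lerD IH (lexx _))).
have n1 : 0 < n.+1%:R :> R by rewrite ltr0n.
have z01 : 0 <= z <= 1 by rewrite (ltW z0) z1.
have := powR_tangent n1 (ler0n _ n) z01.
rewrite -lerBrDl -mulrBl ler_pdivlMr// (natrD _ 1 n) => h; lra.
Qed.

Lemma sum_harmonic_le (n : nat) :
  \sum_(m < n.+1) (m.+1%:R : R)^-1 <= 1 + ln (n.+1%:R).
Proof.
elim: n => [|n IH]; first by rewrite big_ord1 invr1 ln1 addr0.
rewrite big_ord_recr/=; apply: (le_trans (lerD IH (lexx _))).
rewrite -addrA lerD2l.
have n1 : 0 < n.+1%:R :> R by rewrite ltr0n.
have n2 : 0 < n.+2%:R :> R by rewrite ltr0n.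
have -> : n.+1%:R = (1 + - (n.+2%:R)^-1) * n.+2%:R :> R.
  by rewrite mulrDl mul1r mulNr mulVf ?gt_eqF// (natrD _ 1 n.+1); ring.
have i1 : (n.+2%:R)^-1 < 1 :> R by rewrite invf_lt1// ltr1n.
rewrite lnM ?posrE//; last by rewrite subr_gt0.
have : - (n.+2%:R)^-1 > -1 :> R by rewrite ltrN2.
by move/le_ln1Dx => h; rewrite addrAC gerDr -lerBrDr sub0r.
Qed.

End PowerInequalities.

Section FractionalWeights.
Context {R : realType}.
Implicit Types a c h k r T : R.

Definition fweight h a (m : nat) : R := (m.+1%:R * h) `^ a - (m%:R * h) `^ a.

Lemma fweight_ge0 h a m : 0 <= h -> 0 <= a -> 0 <= fweight h a m.
Proof.
move=> h0 a0; rewrite subr_ge0; apply: powR_le_mono => //.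
  exact: mulr_ge0.
by rewrite ler_wpM2r// ler_nat.
Qed.

Lemma sum_fweight_rect h a m n : 
  \sum_(l < n) fweight h a (m + l) = ((m + n)%:R * h) `^ a - (m%:R * h) `^ a.
Proof.
elim: n => [|n IH]; first by rewrite big_ord0 addn0 subrr.
by rewrite big_ord_recr/= IH /fweight addnS; ring.
Qed.

Lemma sum_fweight h a n : a != 0 -> \sum_(l < n) fweight h a l = (n%:R * h) `^ a.
Proof.
move=> a0; have := sum_fweight_rect h a 0 n.
by rewrite mul0r powR0// subr0 add0n => <-; apply: eq_bigr.
Qed.

Lemma sum_rev (V : nmodType) (F : nat -> V) n :
  \sum_(l < n) F (n - l.+1)%N = \sum_(l < n) F l.
Proof.
rewrite (reindex_inj rev_ord_inj); apply: eq_bigr => i _ /=.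
by rewrite -subSn// subSS subKn// ltnW.
Qed.

Lemma fweight_anti h a m q : 0 <= h -> 0 <= a <= 1 ->
  fweight h a (m + q) <= fweight h a m.
Proof.
move=> h0 a01; rewrite /fweight.
have := @powR_concave4 R (m%:R * h) h (q%:R * h) a (mulr_ge0 (ler0n _ _) h0) h0
  (mulr_ge0 (ler0n _ _) h0) a01.
have -> : m%:R * h + h + q%:R * h = (m + q).+1%:R * h.
  by rewrite -[in RHS]natr1 natrD; ring.
have -> : m%:R * h + h = m.+1%:R * h by rewrite -[in RHS]natr1; ring.
have -> : m%:R * h + q%:R * h = (m + q)%:R * h by rewrite natrD; ring.
by move=> ?; lra.
Qed.

Lemma fweight_le h a m : 0 < h -> a <= 1 ->
  fweight h a m <= h * (m.+1%:R * h) `^ (a - 1).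
Proof.
move=> h0 a1.
have mh : m%:R * h <= m.+1%:R * h by rewrite ler_pM2r// ler_nat.
have := @powR_diff_le R (m.+1%:R * h) (m%:R * h) a (mulr_ge0 (ler0n _ _) (ltW h0)) mh
  (mulr_gt0 (ltr0Sn _ _) h0) a1.
by rewrite (_ : m.+1%:R * h - m%:R * h = h)//; rewrite -natr1; ring.
Qed.

Lemma fweight_le_powR h a m : 0 < h -> 0 < a <= 1 -> fweight h a m <= h `^ a.
Proof.
move=> h0 /andP[a0 a1]; have := @fweight_anti h a 0 m (ltW h0).
rewrite (ltW a0) a1 => /(_ isT) /le_trans; apply.
by rewrite /fweight mul1r mul0r powR0 ?gt_eqF// subr0.
Qed.

Lemma fweight_scale k a m : 0 <= k ->
  fweight k a m = k `^ a * (m.+1%:R `^ a - m%:R `^ a).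
Proof. by move=> k0; rewrite /fweight !powRM// mulrBr ![k `^ a * _]mulrC. Qed.

Lemma sum_fweight_coarse h a (M q : nat) :
  \sum_(i < M) fweight h a (q * M + i) = fweight (M%:R * h) a q.
Proof. by rewrite sum_fweight_rect /fweight -mulSnr !natrM !mulrA. Qed.

Lemma sum_fweight_diff_le h a r (p q : nat) : 0 < h -> 0 < a -> 0 <= r ->
  a + r < 1 -> (0 < q)%N ->
  \sum_(m < p) (fweight h a m - fweight h a (m + q)) * (m.+1%:R * h) `^ r <=
    (1 + (1 - (a + r))^-1) * (q%:R * h) `^ (a + r).
Proof.
move=> h0 a0 r0 ar q0.
set f := fun m : nat => (m.+1%:R * h) `^ r.
have f0 m : 0 <= f m by rewrite powR_ge0.
have w0 m : 0 <= fweight h a m by rewrite fweight_ge0 ?ltW.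
have qh0 : 0 < q%:R * h by rewrite mulr_gt0// ltr0n.
have D1 : \sum_(m < q) fweight h a m * f m <= (q%:R * h) `^ (a + r).
  rewrite powRD_gt0// -(sum_fweight h q (lt0r_neq0 a0)) mulr_suml.
  apply: ler_sum => i _; apply: ler_wpM2l => //.
  by apply: powR_le_mono; rewrite ?mulr_ge0 ?ler0n ?(ltW h0)// ler_pM2r// ler_nat.
have D2 : \sum_(m < p) fweight h a (m + q) * (f (m + q)%N - f m) <=
    (1 - (a + r))^-1 * (q%:R * h) `^ (a + r).
  have z01 : 0 < 1 - (a + r) <= 1 by lra.
  apply: (@le_trans _ _ (\sum_(m < p) q%:R * h `^ (a + r) *
     (m + q).+1%:R `^ (- (1 - (a + r)) - 1))).
    apply: ler_sum => m _.
    have X0 : 0 < (m + q).+1%:R * h by rewrite mulr_gt0// ltr0Sn.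
    apply: (@le_trans _ _ (h * ((m + q).+1%:R * h) `^ (a - 1) *
       (q%:R * h * ((m + q).+1%:R * h) `^ (r - 1)))).
      apply: ler_pM => //.
      - rewrite subr_ge0; apply: powR_le_mono => //.
          by rewrite mulr_ge0 ?ler0n ?ltW.
        by rewrite ler_pM2r// ler_nat ltnS leq_addr.
      - by apply: fweight_le => //; lra.
      - have -> : q%:R * h = (m + q).+1%:R * h - m.+1%:R * h.
          by rewrite -!natr1 natrD; ring.
        apply: powR_diff_le => //; rewrite ?mulr_ge0 ?ler0n ?(ltW h0)//.
          by rewrite ler_pM2r// ler_nat ltnS leq_addr.
        lra.
    rewrite [leLHS](_ : _ = q%:R * (h * h * (((m + q).+1%:R * h) `^ (a - 1) *
       ((m + q).+1%:R * h) `^ (r - 1)))); last by ring.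
    rewrite -powRD_gt0// powRM ?ler0n ?(ltW h0)//.
    rewrite (_ : - (1 - (a + r)) - 1 = a - 1 + (r - 1)); last by ring.
    rewrite [leRHS](_ : _ = q%:R * (h `^ (a + r) * (m + q).+1%:R `^ (a - 1 + (r - 1)))); last by ring.
    rewrite -(powR_mul1B (a + r) h0) -(powR_mul1B (a + r - 1) h0).
    rewrite (_ : a + r - 1 - 1 = a - 1 + (r - 1)); last by ring.
    by rewrite le_eqVlt; apply/orP; left; apply/eqP; ring.
  rewrite -mulr_sumr.
  apply: (le_trans (ler_wpM2l _ (sum_powR_tail p z01 q0))).
    by rewrite mulr_ge0 ?ler0n ?powR_ge0.
  rewrite powRM ?ler0n ?(ltW h0)//.
  have qr0 : 0 < q%:R :> R by rewrite ltr0n.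
  rewrite -(powR_mul1B (a + r) qr0) (_ : a + r - 1 = - (1 - (a + r))); last by ring.
  by rewrite le_eqVlt; apply/orP; left; apply/eqP; ring.
apply: le_trans (le_trans (lerD D1 D2) _); last by rewrite mulrDl mul1r.
rewrite -lerBlDr -sumrB.
apply: (@le_trans _ _ (\sum_(m < p) fweight h a m * f m -
     \sum_(m < p) fweight h a (m + q) * f (m + q)%N)).
  rewrite -sumrB; apply: ler_sum => m _.
  by rewrite le_eqVlt; apply/orP; left; apply/eqP; rewrite /f; ring.
rewrite lerBlDr.
have -> : \sum_(m < q) fweight h a m * f m + \sum_(m < p) fweight h a (m + q) * f (m + q)%N
   = \sum_(m < q + p) fweight h a m * f m.
  rewrite big_split_ord/=; congr (_ + _).
  by apply: eq_bigr => i _; rewrite addnC.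
rewrite addnC big_split_ord/= lerDl; apply: sumr_ge0 => i _.
exact: mulr_ge0.
Qed.

(* Weighting by [expR (lambda * t)] with [lambda] large makes the fractional
   convolution a contraction, uniformly in the step. *)
Lemma fractional_gronwall a c T : 0 < a <= 1 -> 0 <= c -> 0 <= T ->
  exists2 K : R, 0 < K & forall h (L : nat) (u : nat -> R) (A : R),
    0 < h -> L%:R * h <= T -> 0 <= A ->
    (forall n, (n <= L)%N ->
       u n <= A + c * \sum_(l < n) fweight h a (n - l.+1) * u l) ->
    forall n, (n <= L)%N -> u n <= K * A.
Proof.
move=> /andP[a0 a1] c0 T0.
pose b := (4 * (c + 1))^-1.
have c1 : 0 < 4 * (c + 1) by lra.
have b0 : 0 < b by rewrite invr_gt0.
pose dl := b `^ a^-1.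
have dl0 : 0 < dl by rewrite powR_gt0.
have dla : dl `^ a = b by rewrite -powRrM mulVf ?gt_eqF// powRr1// ltW.
pose lam := 4 * (c + 1) * T `^ a / dl.
have lam0 : 0 <= lam by rewrite divr_ge0 ?(ltW dl0)// mulr_ge0 ?powR_ge0// ltW.
have ldl : expR (- (lam * dl)) * T `^ a <= b.
  have ldE : lam * dl = 4 * (c + 1) * T `^ a.
    by rewrite /lam mulfVK// gt_eqF.
  have h1 := expR_ge1Dx (lam * dl).
  rewrite expRN mulrC ler_pdivrMr ?expR_gt0//.
  apply: (@le_trans _ _ (b * (1 + lam * dl))); last by rewrite ler_pM2l.
  rewrite ldE mulrDr mulr1 mulrA mulVf ?gt_eqF// mul1r.
  by rewrite lerDr ltW.
exists (2 * expR (lam * T)); first by rewrite mulr_gt0 ?expR_gt0.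
move=> h L u A h0 LhT A0 Hu.
have claim n : (n <= L)%N ->
    \sum_(l < n) fweight h a (n - l.+1) * expR (lam * (l%:R * h)) <=
      (2 * (c + 1))^-1 * expR (lam * (n%:R * h)).
  move=> nL.
  pose F (m : nat) := fweight h a m * expR (- (lam * (m.+1%:R * h))).
  apply: (@le_trans _ _ ((\sum_(l < n) F l) * expR (lam * (n%:R * h)))).
    rewrite -sum_rev mulr_suml le_eqVlt; apply/orP; left; apply/eqP.
    apply: eq_bigr => l _; rewrite /F -mulrA -expRD; congr (_ * expR _).
    rewrite -subSn// subSS natrB; last exact: ltnW.
    by ring.
  apply: ler_wpM2r; first exact: expR_ge0.
  pose g (m : nat) := (Num.min (m%:R * h) dl) `^ a.
  apply: (@le_trans _ _ (\sum_(l < n) ((g l.+1 - g l) +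
       expR (- (lam * dl)) * fweight h a l))).
    apply: ler_sum => m _; rewrite /F /g.
    have w0 : 0 <= fweight h a m by rewrite fweight_ge0 ?ltW.
    have mh : m%:R * h <= m.+1%:R * h by rewrite ler_pM2r// ler_nat.
    have m0 : 0 <= m%:R * h by rewrite mulr_ge0 ?ler0n ?ltW.
    have [le|lt] := leP (m.+1%:R * h) dl.
      rewrite !min_l//; last exact: le_trans le.
      have e1 : expR (- (lam * (m.+1%:R * h))) <= 1.
        rewrite -[leRHS]expR0 ler_expR oppr_le0 mulr_ge0//.
        exact: le_trans m0 mh.
      apply: (@le_trans _ _ (fweight h a m)); first by rewrite ler_piMr.
      by rewrite /fweight lerDl mulr_ge0 ?expR_ge0.
    rewrite ler_wpDl//.
      rewrite subr_ge0; apply: powR_le_mono; rewrite ?(ltW a0)//.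
        by rewrite le_min m0 ltW.
      by rewrite ge_min lexx orbT.
    by rewrite mulrC ler_wpM2r// ler_expR lerN2 ler_wpM2l// ltW.
  rewrite big_split/= -mulr_sumr sum_fweight ?gt_eqF//.
  rewrite -(big_mkord xpredT (fun l => g l.+1 - g l)) telescope_sumr//.
  rewrite /g mul0r (min_l (ltW dl0)) powR0 ?gt_eqF// subr0.
  have -> : (2 * (c + 1))^-1 = b + b by rewrite /b; field; lra.
  apply: lerD.
    rewrite -dla; apply: powR_le_mono; rewrite ?(ltW a0)//.
      by rewrite le_min (ltW dl0) mulr_ge0 ?ler0n ?ltW.
    by rewrite ge_min lexx orbT.
  apply: le_trans ldl; apply: ler_wpM2l; first exact: expR_ge0.
  apply: powR_le_mono; rewrite ?(ltW a0) ?mulr_ge0 ?ler0n ?(ltW h0)//.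
  by apply: le_trans LhT; rewrite ler_pM2r// ler_nat.
have main n : (n <= L)%N -> u n <= 2 * expR (lam * (n%:R * h)) * A.
  elim/ltn_ind: n => n IH nL.
  apply: (le_trans (Hu n nL)).
  have S1 : \sum_(l < n) fweight h a (n - l.+1) * u l <=
     2 * A * ((2 * (c + 1))^-1 * expR (lam * (n%:R * h))).
    apply: le_trans (ler_wpM2l _ (claim n nL)); last by rewrite mulr_ge0.
    rewrite mulr_sumr; apply: ler_sum => l _.
    rewrite mulrCA; apply: ler_wpM2l; first by rewrite fweight_ge0 ?ltW.
    apply: (le_trans (IH l (ltn_ord l) (ltnW (leq_trans (ltn_ord l) nL)))).
    by rewrite le_eqVlt; apply/orP; left; apply/eqP; ring.
  have E1 : 1 <= expR (lam * (n%:R * h)).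
    by rewrite -[leLHS]expR0 ler_expR; apply: mulr_ge0 => //; rewrite mulr_ge0 ?ler0n ?(ltW h0).
  apply: (le_trans (lerD (lexx _) (ler_wpM2l c0 S1))).
  set E := expR _ in E1 *.
  apply: (@le_trans _ _ (A * E + A * E)); last by lra.
  apply: lerD; first by rewrite ler_peMr.
  rewrite (_ : c * _ = A * E * (c / (c + 1))); last by field; lra.
  rewrite ler_piMr ?mulr_ge0 ?(le_trans ler01 E1)//.
  by rewrite ler_pdivrMr; lra.
move=> n nL; apply: (le_trans (main n nL)).
apply: ler_wpM2r => //; apply: ler_wpM2l => //.
rewrite ler_expR ler_wpM2l//; apply: le_trans LhT.
by rewrite ler_pM2r// ler_nat.
Qed.

Lemma sum_fweight2_le k a n : 0 < k -> a <= 1 ->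
  0 <= a -> \sum_(m < n) fweight k a m ^+ 2 <=
  k `^ (2 * a) * \sum_(m < n) m.+1%:R `^ (2 * a - 2).
Proof.
move=> k0 a1 a0; rewrite mulr_sumr; apply: ler_sum => m _.
have m1 : 0 < m.+1%:R :> R by rewrite ltr0n.
have -> : k `^ (2 * a) * m.+1%:R `^ (2 * a - 2) = (k * (m.+1%:R * k) `^ (a - 1)) ^+ 2.
  rewrite powRM ?ler0n ?(ltW k0)// mulrCA powR_mul1B// exprMn -!powR_mulrn ?powR_ge0//.
  by rewrite -!powRrM mulrC; congr (_ `^ _ * _ `^ _); ring.
by rewrite ler_sqr ?nnegrE ?fweight_ge0 ?(ltW k0) ?fweight_le// mulr_ge0 ?powR_ge0 ?ltW.
Qed.

End FractionalWeights.

Section Rate.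
Context {R : realType}.
Implicit Types H T : R.

Lemma step_le_max T : 0 < T -> exists2 k0 : R, k0 < 1 &
  forall N : nat, (0 < N)%N -> T / N%:R < 1 -> T / N%:R <= k0.
Proof.
move=> T0; exists (T / (Num.truncn T).+1%:R).
  by rewrite ltr_pdivrMr ?ltr0n// mul1r; case/andP: (truncn_itv (ltW T0)).
move=> N N0; rewrite ltr_pdivrMr ?ltr0n// mul1r => TN.
rewrite ler_pM2l// lef_pV2 ?posrE ?ltr0n// ler_nat.
rewrite -(ltr_nat R); apply: le_lt_trans TN.
by case/andP: (truncn_itv (ltW T0)).
Qed.

Lemma rate_bound H T : 1 / 2 < H < 1 -> 0 < T ->
  let a := 2 - 2 * H in
  exists2 C : R, 0 < C & forall N : nat, (0 < N)%N -> T / N%:R < 1 ->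
    let k := T / N%:R in
    k `^ (a + Num.min (a / 2) ((1 - a) / 2)) <= C * conv_rate H k /\
    forall n, (n <= N)%N ->
      Num.sqrt (k `^ a * \sum_(m < n) fweight k a m ^+ 2) <= C * conv_rate H k.
Proof.
move=> /andP[H0 H1] T0 a.
have a0 : 0 < a by rewrite /a; lra.
have a1 : a < 1 by rewrite /a; lra.
have kgt0 (N : nat) : (0 < N)%N -> 0 < T / N%:R by move=> N0; rewrite divr_gt0// ltr0n.
have sqrtP (x y : R) : 0 <= y -> x <= y ^+ 2 -> Num.sqrt x <= y.
  by move=> y0 xy; rewrite -(ger0_norm y0) -sqrtr_sqr ler_wsqrtr.
have C1 (D : R) : 0 <= D -> D <= (1 + D) ^+ 2 by move=> D0; nra.
have [H34|H34] := ltP (3 / 4) H.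
- set z := 1 - 2 * a.
  have z01 : 0 < z <= 1 by rewrite /z /a; lra.
  have zi : 0 <= z^-1 by rewrite invr_ge0; lra.
  exists (1 + (1 + z^-1)); first by lra.
  move=> N N0 kl k; have k0 : 0 < k by exact: kgt0.
  rewrite /conv_rate H34 min_l; last by rewrite /a; lra.
  split.
    rewrite (_ : a + a / 2 = 3 - 3 * H); last by rewrite /a; field.
    by rewrite ler_peMl ?powR_ge0//; lra.
  move=> n nN; apply: sqrtP; first by rewrite mulr_ge0 ?powR_ge0//; lra.
  have S : \sum_(m < n) m.+1%:R `^ (2 * a - 2) <= 1 + z^-1.
    case: n nN => [|n] nN; first by rewrite big_ord0; lra.
    rewrite big_ord_recl/= powR1 lerD2l.
    have := sum_powR_tail n z01 (isT : (0 < 1)%N).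
    rewrite powR1 mul1r => /(le_trans _); apply.
    by apply: ler_sum => i _; rewrite /bump/= addn1 add1n (_ : 2 * a - 2 = - z - 1)// /z; ring.
  rewrite exprMn; apply: (@le_trans _ _ (k `^ a * (k `^ (2 * a) * (1 + z^-1)))).
    apply: ler_wpM2l; first exact: powR_ge0.
    apply: (le_trans (sum_fweight2_le n k0 (ltW a1) (ltW a0))).
    by apply: ler_wpM2l => //; rewrite powR_ge0.
  rewrite mulrA -powRD_gt0// -[(k `^ _) ^+ 2]powR_mulrn ?powR_ge0// -powRrM mulrC.
  rewrite (_ : a + 2 * a = (3 - 3 * H) * 2); last by rewrite /a; ring.
  by apply: ler_wpM2r; rewrite ?powR_ge0// C1//; lra.
have [k1 k1l Hk1] := step_le_max T0.
move: H34; rewrite le_eqVlt => /orP[/eqP H34|H34].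
- have aE : a = 1 / 2 by rewrite /a H34; field.
  have k10 : 0 < k1.
    apply: lt_le_trans (Hk1 (Num.truncn T).+1 _ _) => //.
      exact: kgt0.
    by rewrite ltr_pdivrMr ?ltr0n// mul1r; case/andP: (truncn_itv (ltW T0)).
  pose c1 := - ln k1.
  have c10 : 0 < c1 by rewrite oppr_gt0 ln_lt0// k10.
  pose D := (1 + `|ln T|) / c1 + 1.
  have D0 : 0 <= D by rewrite addr_ge0// divr_ge0 ?(ltW c10)// addr_ge0.
  have c1i : 0 < (Num.sqrt c1)^-1 by rewrite invr_gt0 sqrtr_gt0.
  exists (1 + D + (Num.sqrt c1)^-1); first by lra.
  move=> N N0 kl k; have k0 : 0 < k by exact: kgt0.
  have lk : c1 <= `|ln k|.
    rewrite ltr0_norm; last by rewrite ln_lt0// k0.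
    by rewrite lerN2 ler_ln ?posrE//; exact: Hk1.
  rewrite /conv_rate H34 ltxx eqxx min_l; last by rewrite aE; lra.
  split.
    rewrite aE (_ : 1 / 2 + 1 / 2 / 2 = 3 / 4); last by field.
    rewrite mulrA ler_peMl ?powR_ge0//.
    apply: (@le_trans _ _ ((Num.sqrt c1)^-1 * Num.sqrt c1)).
      by rewrite mulVf// gt_eqF// sqrtr_gt0.
    apply: ler_pM; rewrite ?sqrtr_ge0 ?ler_wsqrtr// ?(ltW c1i)//; lra.
  move=> n nN; apply: sqrtP; first by rewrite !mulr_ge0 ?sqrtr_ge0 ?powR_ge0//; lra.
  have S : \sum_(m < n) m.+1%:R `^ (2 * a - 2) <= D * `|ln k|.
    apply: (@le_trans _ _ (1 + ln N%:R)).
      case: n nN => [|n] nN.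
        by rewrite big_ord0 addr_ge0// ln_ge0// ler1n.
      apply: le_trans (le_trans (sum_harmonic_le n) _).
        apply: ler_sum => i _; rewrite (_ : 2 * a - 2 = - 1); last by rewrite aE; field.
        by rewrite powR_inv1 ?ler0n.
      by rewrite lerD2l ler_ln ?posrE ?ltr0n// ler_nat.
    have -> : ln N%:R = ln T - ln k.
      rewrite /k ln_div ?posrE ?ltr0n//; ring.
    have -> : - ln k = `|ln k| by rewrite ltr0_norm// ln_lt0// k0.
    rewrite addrA /D mulrDl mul1r lerD2r.
    apply: (@le_trans _ _ (1 + `|ln T|)); first by rewrite lerD2l ler_norm.
    by rewrite mulrAC ler_pdivlMr// ler_wpM2l// addr_ge0.
  apply: (@le_trans _ _ (k `^ a * (k `^ (2 * a) * (D * `|ln k|)))).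
    apply: ler_wpM2l; first exact: powR_ge0.
    apply: (le_trans (sum_fweight2_le n k0 (ltW a1) (ltW a0))).
    by apply: ler_wpM2l => //; rewrite powR_ge0.
  rewrite mulrA -powRD_gt0// !exprMn sqr_sqrtr// -[(k `^ _) ^+ 2]powR_mulrn ?powR_ge0// -powRrM.
  rewrite (_ : a + 2 * a = 3 / 4 * 2); last by rewrite aE; field.
  rewrite [leLHS](_ : _ = D * (`|ln k| * k `^ (3 / 4 * 2))); last by ring.
  apply: ler_wpM2r; first by rewrite mulr_ge0 ?powR_ge0.
  apply: (le_trans (C1 _ D0)).
  rewrite ler_sqr ?nnegrE; lra.
set z := 2 * a - 1.
have z01 : 0 < z <= 1 by rewrite /z /a; lra.
pose D := T `^ z / z.
have D0 : 0 <= D by rewrite divr_ge0 ?powR_ge0//; lra.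
exists (1 + D); first by lra.
move=> N N0 kl k; have k0 : 0 < k by exact: kgt0.
rewrite /conv_rate ltNge (ltW H34)/= lt_eqF// min_r; last by rewrite /a; lra.
split.
  rewrite (_ : a + (1 - a) / 2 = 3 / 2 - H); last by rewrite /a; field.
  by rewrite ler_peMl ?powR_ge0//; lra.
move=> n nN; apply: sqrtP; first by rewrite mulr_ge0 ?powR_ge0//; lra.
have S : \sum_(m < n) m.+1%:R `^ (2 * a - 2) <= D * k `^ (- z).
  rewrite (_ : 2 * a - 2 = z - 1); last by rewrite /z; ring.
  apply: (le_trans (sum_powR_le n z01)).
  apply: (@le_trans _ _ (N%:R `^ z / z)).
    rewrite ler_pM2r ?invr_gt0; last by lra.
    by apply: powR_le_mono; rewrite ?ler0n ?ler_nat//; lra.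
  have -> : N%:R = T / k.
    by rewrite /k; field; rewrite !gt_eqF// ltr0n.
  rewrite powRM ?invr_ge0 ?(ltW k0) ?(ltW T0)// -(powR_inv1 (ltW k0)) -powRrM mulN1r.
  by rewrite /D mulrAC.
rewrite exprMn; apply: (@le_trans _ _ (k `^ a * (k `^ (2 * a) * (D * k `^ (- z))))).
  apply: ler_wpM2l; first exact: powR_ge0.
  apply: (le_trans (sum_fweight2_le n k0 (ltW a1) (ltW a0))).
  by apply: ler_wpM2l => //; rewrite powR_ge0.
rewrite -[(k `^ _) ^+ 2]powR_mulrn ?powR_ge0// -powRrM.
rewrite [leLHS](_ : _ = D * (k `^ a * k `^ (2 * a) * k `^ (- z))); last by ring.
rewrite -!powRD_gt0//.
rewrite (_ : a + 2 * a - z = (3 / 2 - H) * 2); last by rewrite /z /a; field.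
by apply: ler_wpM2r; rewrite ?powR_ge0// C1.
Qed.

End Rate.

Section SequenceLimits.
Context {R : realType}.
Implicit Types (a e r th : R) (u c d : nat -> R).

Lemma cvgn_distP u (l : R) : u @ \oo --> l <->
  forall e, 0 < e -> exists N, forall n, (N <= n)%N -> `|u n - l| <= e.
Proof.
split=> [/cvgrPdist_le h e e0|h].
  by have [N _ hN] := h e e0; exists N => n Nn; rewrite distrC; exact: hN.
apply/cvgrPdist_le => e e0; have [N hN] := h e e0.
by exists N => // n Nn; rewrite /= distrC; exact: hN.
Qed.

Lemma cvgn_bounded u (l : R) : u @ \oo --> l -> exists2 M : R, 0 < M & forall n, `|u n| <= M.
Proof.
move=> ul; have /cvg_seq_bounded/pinfty_ex_gt0[M M0 hM] : cvgn u by apply: cvgP ul.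
by exists M => // n; exact: hM.
Qed.

Lemma cvgn_shiftS u (l : R) : (fun n => u n.+1) @ \oo --> l -> u @ \oo --> l.
Proof. by rewrite -(cvg_shiftS u). Qed.

Lemma powRN_natr_cvg0 a : 0 < a -> (fun n : nat => n%:R `^ (- a) : R) @ \oo --> (0 : R).
Proof.
move=> a0; apply/cvgn_distP => e e0.
pose x : R := (e^-1) `^ a^-1.
have x0 : 0 < x by rewrite powR_gt0 ?invr_gt0.
exists (Num.truncn x).+1 => n xn.
have xn' : x <= n%:R.
  case/andP: (truncn_itv (ltW x0)) => _ /ltW/le_trans; apply.
  by rewrite ler_nat.
rewrite subr0 ger0_norm ?powR_ge0//.
have xa : x `^ (- a) = e.
  by rewrite -powRrM mulrN mulVf ?gt_eqF// powRN powRr1 ?invrK// invr_ge0 ltW.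
rewrite -[leRHS]xa; apply: powR_le_npow => //.
by rewrite oppr_le0 ltW.
Qed.

(* Coefficients of the power series of [(1 - x) ^ (- th)]. *)
Definition binom_coef th (v : nat) : R := \prod_(i < v) ((i%:R + th) / i.+1%:R).

Lemma binom_coefS th v : binom_coef th v.+1 = binom_coef th v * ((v%:R + th) / v.+1%:R).
Proof. by rewrite /binom_coef big_ord_recr. Qed.

Lemma binom_coef_gt0 th v : 0 < th -> 0 < binom_coef th v.
Proof.
move=> th0; rewrite prodr_gt0// => i _.
by rewrite divr_gt0 ?ltr0n// ltr_wpDl.
Qed.

(* [(1 - x) ^ (- a) * (1 - x) ^ (a - 1) = (1 - x) ^ (-1)] *)
Lemma binom_coef_conv a w :
  \sum_(v < w.+1) binom_coef a v * binom_coef (1 - a) (w - v) = 1.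
Proof.
elim: w => [|w IH].
  by rewrite big_ord1 /binom_coef !big_ord0 mulr1.
have rec th v : v.+1%:R * binom_coef th v.+1 = (v%:R + th) * binom_coef th v.
  by rewrite binom_coefS mulrC mulrA mulfVK ?pnatr_eq0// mulrC.
have w1 : w.+1%:R != 0 :> R by rewrite pnatr_eq0.
apply: (mulfI w1); rewrite mulr1.
set c := binom_coef a in rec IH *; set d := binom_coef (1 - a) in IH *.
have E1 : \sum_(v < w.+2) v%:R * c v * d (w.+1 - v)%N =
    \sum_(v < w.+1) (v%:R + a) * c v * d (w - v)%N.
  rewrite big_ord_recl/= !mul0r add0r; apply: eq_bigr => v _.
  by rewrite /bump/= add1n subSS rec.
have E2 : \sum_(v < w.+2) (w.+1 - v)%:R * c v * d (w.+1 - v)%N =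
    \sum_(v < w.+1) ((w - v)%:R + (1 - a)) * c v * d (w - v)%N.
  rewrite big_ord_recr/= subnn !mul0r addr0; apply: eq_bigr => v _.
  rewrite subSn; last by rewrite -ltnS ltn_ord.
  by rewrite mulrAC rec -!mulrA (mulrC (d _)).
rewrite [RHS](_ : _ = \sum_(v < w.+1) w.+1%:R * (c v * d (w - v)%N)); last first.
  by rewrite -mulr_sumr IH mulr1.
rewrite mulr_sumr (eq_bigr (fun v : 'I_w.+2 => v%:R * c v * d (w.+1 - v)%N +
   (w.+1 - v)%:R * c v * d (w.+1 - v)%N)); last first.
  by move=> v _; rewrite -!mulrDl -natrD subnKC ?mulrA// leq_ord.
rewrite big_split/= E1 E2 -big_split/=; apply: eq_bigr => v _.
rewrite -!mulrDl mulrA; congr (_ * _ * _).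
rewrite natrB; last by rewrite -ltnS ltn_ord.
by rewrite -natr1; ring.
Qed.

Lemma binom_coef_cvg th : 0 < th < 1 -> exists2 l : R, 0 < l &
  (fun v : nat => binom_coef th v * v%:R `^ (1 - th)) @ \oo --> l.
Proof.
move=> /andP[th0 th1].
pose s v := binom_coef th v * v%:R `^ (1 - th).
pose z v := binom_coef th v * (v%:R + th) `^ (1 - th).
have r01 : 0 <= 1 - th <= 1 by lra.
have c0 v := binom_coef_gt0 v th0.
have zS v : z v.+1 <= z v.
  rewrite /z binom_coefS -mulrA ler_pM2l//.
  have v0 : 0 < v%:R + th by rewrite ltr_wpDl.
  have v1 : 0 < v.+1%:R :> R by rewrite ltr0n.
  have v2 : 0 <= v.+1%:R + th by rewrite addr_ge0 ?ler0n ?ltW.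
  have := powR_tangent v0 v2 r01.
  rewrite (_ : v.+1%:R + th - (v%:R + th) = 1); last by rewrite -natr1; ring.
  rewrite mulr1 => h; apply: (le_trans (ler_wpM2l (ltW (divr_gt0 v0 v1)) h)).
  rewrite le_eqVlt; apply/orP; left; apply/eqP.
  rewrite -[in RHS](powR_mul1B (1 - th) v0) -{1}(powR_mul1B (1 - th) v0).
  by rewrite -natr1; field; rewrite natr1 gt_eqF.
have z1 v : z v <= 1.
  elim: v => [|v IH]; last exact: le_trans (zS v) IH.
  rewrite /z /binom_coef big_ord0 mul1r add0r.
  by have := @powR_le_mono R th 1 (1 - th); rewrite powR1; apply; lra.
have s1 v : s v <= 1.
  apply: le_trans (z1 v); rewrite /s /z ler_pM2l//.
  by apply: powR_le_mono; rewrite ?ler0n//; lra.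
have sS v : s v.+1 <= s v.+2.
  rewrite /s (binom_coefS th v.+1) -mulrA ler_pM2l//.
  have v0 : 0 < v.+1%:R + th by rewrite ltr_wpDl.
  have v1 : 0 < v.+2%:R :> R by rewrite ltr0n.
  have := powR_tangent v1 (ler0n R v.+1) r01.
  rewrite (_ : v.+1%:R - v.+2%:R = -1); last by rewrite -[v.+2%:R]natr1; ring.
  move=> /le_trans; apply.
  rewrite le_eqVlt; apply/orP; left; apply/eqP.
  rewrite -[in RHS](powR_mul1B (1 - th) v1) -{1}(powR_mul1B (1 - th) v1).
  have -> : v.+1%:R = v.+2%:R - 1 :> R by rewrite -[v.+2%:R]natr1 addrK.
  by move: v.+2%:R v1 => x x0; field; rewrite gt_eqF.
have nd : nondecreasing_seq (fun v => s v.+1).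
  by apply/nondecreasing_seqP.
have cv : cvgn (fun v => s v.+1).
  by apply: nondecreasing_is_cvgn nd _; exists 1 => _ [v _ <-].
exists (limn (fun v => s v.+1)).
  apply: lt_le_trans (nondecreasing_cvgn_le nd cv 0%N).
  by rewrite /s powR1 mulr1.
by rewrite -(cvg_shiftS (fun v => _)).
Qed.

Lemma toeplitz_cvg0 c d (x : nat -> R) : (forall v, 0 <= c v) -> (forall v, 0 <= d v) ->
  (forall w, \sum_(v < w.+1) c v * d (w - v)%N = 1) ->
  d @ \oo --> (0 : R) -> x @ \oo --> (0 : R) ->
  (fun w => \sum_(v < w.+1) c v * d (w - v)%N * `|x v|) @ \oo --> (0 : R).
Proof.
move=> c0 d0 cd1 /cvgn_distP dc /cvgn_distP xc; apply/cvgn_distP => e e0.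
have e2 : 0 < e / 2 by rewrite divr_gt0.
have [n0 hn0] := xc _ e2.
pose K := \sum_(v < n0) c v * `|x v|.
have K0 : 0 <= K by apply: sumr_ge0 => i _; rewrite mulr_ge0.
have eK : 0 < e / 2 / (1 + K) by rewrite divr_gt0// ltr_wpDr.
have [n1 hn1] := dc _ eK.
exists (n0 + n1)%N => w hw; rewrite subr0 ger0_norm; last first.
  by apply: sumr_ge0 => i _; rewrite !mulr_ge0.
have n0w : (n0 <= w.+1)%N by apply: leqW; apply: leq_trans hw; exact: leq_addr.
rewrite -(big_mkord xpredT (fun v => c v * d (w - v)%N * `|x v|)).
rewrite (big_cat_nat (leq0n n0) n0w)/= [leRHS]splitr; apply: lerD.
  rewrite big_mkord; apply: (@le_trans _ _ (e / 2 / (1 + K) * K)).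
    rewrite /K mulr_sumr; apply: ler_sum => v _.
    rewrite mulrAC mulrC ler_wpM2r ?mulr_ge0//.
    have := hn1 (w - v)%N; rewrite subr0 ger0_norm//; apply.
    by have := ltn_ord v; lia.
  by rewrite mulrAC ler_pdivrMr ?ltr_wpDr// ler_pM2l//; lra.
apply: (@le_trans _ _ (\sum_(n0 <= v < w.+1) c v * d (w - v)%N * (e / 2))).
  rewrite big_nat_cond [leRHS]big_nat_cond; apply: ler_sum => v /andP[/andP[nv _] _].
  by rewrite ler_wpM2l ?mulr_ge0//; have := hn0 v nv; rewrite subr0.
rewrite -mulr_suml ler_piMl ?(ltW e2)//.
rewrite -(cd1 w) -(big_mkord xpredT (fun v => c v * d (w - v)%N)).
rewrite [leRHS](big_cat_nat (leq0n n0) n0w)/= lerDr.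
by apply: sumr_ge0 => i _; rewrite mulr_ge0.
Qed.

Lemma toeplitz_cvg c d (x y : nat -> R) (X Y : R) :
  (forall v, 0 <= c v) -> (forall v, 0 <= d v) ->
  (forall w, \sum_(v < w.+1) c v * d (w - v)%N = 1) ->
  c @ \oo --> (0 : R) -> d @ \oo --> (0 : R) -> x @ \oo --> X -> y @ \oo --> Y ->
  (fun w => \sum_(v < w.+1) (c v * x v) * (d (w - v)%N * y (w - v)%N)) @ \oo --> X * Y.
Proof.
move=> c0 d0 cd1 cc dc xX yY.
have [M M0 hM] := cvgn_bounded yY.
have xX0 : (fun v => x v - X) @ \oo --> (0 : R).
  by rewrite -(subrr X); apply: cvgB => //; exact: cvg_cst.
have yY0 : (fun v => y v - Y) @ \oo --> (0 : R).
  by rewrite -(subrr Y); apply: cvgB => //; exact: cvg_cst.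
have dc1 w : \sum_(v < w.+1) d v * c (w - v)%N = 1.
  rewrite -(cd1 w) -(sum_rev (fun v => d v * c (w - v)%N)).
  apply: eq_bigr => v _; rewrite subSS mulrC subKn//.
  by rewrite -ltnS ltn_ord.
have T1 := toeplitz_cvg0 c0 d0 cd1 dc xX0.
have T2 := toeplitz_cvg0 d0 c0 dc1 cc yY0.
have T : (fun w => M * (\sum_(v < w.+1) c v * d (w - v)%N * `|x v - X|) +
   `|X| * (\sum_(v < w.+1) d v * c (w - v)%N * `|y v - Y|)) @ \oo --> (M * 0 + `|X| * 0 : R).
  by apply: cvgD; (apply: cvgM; first exact: cvg_cst).
rewrite !mulr0 addr0 in T.
apply/cvgn_distP => e e0.
move/cvgn_distP: T => /(_ e e0)[N hN]; exists N => w Nw.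
apply: le_trans (hN w Nw); rewrite subr0.
apply: le_trans (ler_norm _).
rewrite -[X in _ - X]mulr1 -(cd1 w) mulr_sumr -sumrB.
apply: (le_trans (ler_norm_sum _ _ _)).
rewrite -(sum_rev (fun v => d v * c (w - v)%N * `|y v - Y|)) !mulr_sumr -big_split/=.
apply: ler_sum => v _; rewrite subSS subKn; last by rewrite -ltnS ltn_ord.
have -> : c v * x v * (d (w - v)%N * y (w - v)%N) - X * Y * (c v * d (w - v)%N) =
  c v * d (w - v)%N * ((x v - X) * y (w - v)%N + X * (y (w - v)%N - Y)) by ring.
rewrite normrM (ger0_norm (mulr_ge0 _ _))//.
apply: (@le_trans _ _ (c v * d (w - v)%N * (`|x v - X| * M + `|X| * `|y (w - v)%N - Y|))).
  apply: ler_wpM2l; first exact: mulr_ge0.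
  apply: (le_trans (ler_normD _ _)); rewrite !normrM lerD2r.
  by rewrite ler_wpM2l.
by rewrite le_eqVlt; apply/orP; left; apply/eqP; ring.
Qed.

End SequenceLimits.

Section FractionalNoiseCovariance.
Context {R : realType} (a : R).
Hypothesis a01 : 0 < a < 1.
Let p := 2 - a.

(* Covariance of unit increments of fractional Brownian motion at lag [m]. *)
Definition fgn_cov (m : nat) : R :=
  (m.+1%:R `^ p + `|m%:R - 1| `^ p - 2 * m%:R `^ p) / 2.

Lemma fgn_cov_bounds m : (1 < m)%N ->
  p * (1 - a) * m.+1%:R `^ (- a) <= 2 * fgn_cov m <= p * (1 - a) * m.-1%:R `^ (- a).
Proof.
move: a01 => /andP[a0 a1] m1.
have p0 : 0 < p by rewrite /p; lra.
have m0 : (1 : R) < m%:R by rewrite ltr1n.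
have mp : m.-1%:R = m%:R - 1 :> R by rewrite -{2}(prednK (ltnW m1)) -natr1 addrK.
pose g (y : R) := (y + 1) `^ p - y `^ p.
pose dg (y : R) := p * (y + 1) `^ (p - 1) - p * y `^ (p - 1).
have dgP (y : R) : 0 < y -> is_derive y 1 g (dg y).
  move=> y0; apply: is_deriveB; last exact: is_derive1_powR.
  have y1 : 0 < y + 1 by lra.
  have h1 : is_derive y (1 : R) (fun y : R => y + 1) (1 + 0) by apply: is_deriveD.
  have := @is_derive1_comp R (fun y => y `^ p) (fun y => y + 1) y _ _
    (is_derive1_powR p y1) h1.
  by rewrite addr0 mulr1.
have [|||c] := @MVT R g dg (m%:R - 1) m%:R.
- by lra.
- by move=> x; rewrite in_itv/= => /andP[xm _]; apply: dgP; lra.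
- apply: derivable_within_continuous => x; rewrite in_itv/= => /andP[xm _].
  by apply: ex_derive; apply: dgP; lra.
rewrite in_itv/= => /andP[c1 c2] gE.
have c0 : 0 < c by lra.
have c10 : 0 < c + 1 by lra.
have -> : 2 * fgn_cov m = p * ((c + 1) `^ (1 - a) - c `^ (1 - a)).
  have -> : 2 * fgn_cov m = g m%:R - g (m%:R - 1).
    rewrite /fgn_cov /g ger0_norm; last by lra.
    by rewrite subrK natr1; field.
  rewrite gE /dg (_ : m%:R - (m%:R - 1) = 1); last by ring.
  by rewrite /p (_ : 2 - a - 1 = 1 - a); [ring | ring].
have r01 : 0 <= 1 - a <= 1 by lra.
have B1 := powR_tangent c10 (ltW c0) r01.
have B2 := powR_tangent c0 (ltW c10) r01.
have rE : 1 - a - 1 = - a by ring.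
rewrite rE in B1 B2.
rewrite -!mulrA !ler_pM2l//; apply/andP; split.
  apply: (@le_trans _ _ ((1 - a) * (c + 1) `^ (- a))); last by lra.
  by rewrite ler_wpM2l//; [lra | apply: powR_le_npow; rewrite -?natr1; lra].
apply: (@le_trans _ _ ((1 - a) * c `^ (- a))); first by lra.
rewrite ler_wpM2l//; first by lra.
by apply: powR_le_npow; rewrite ?mp; lra.
Qed.

Lemma fgn_cov_cvg : (fun m : nat => fgn_cov m * m%:R `^ a) @ \oo --> p * (1 - a) / 2.
Proof.
move: (a01) => /andP[a0 a1].
have p0 : 0 < p by rewrite /p; lra.
set L := p * (1 - a) / 2.
have L0 : 0 < L by rewrite divr_gt0// mulr_gt0//; lra.
rewrite -(cvg_shiftn 2 (fun m : nat => fgn_cov m * m%:R `^ a)).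
have hL : (fun n : nat => L * n.+1%:R^-1) @ \oo --> (0 : R).
  by rewrite -(mulr0 L); apply: cvgM; [exact: cvg_cst | exact: cvg_harmonic].
apply: (@squeeze_cvgr _ _ _ _ (fun n : nat => L - L * n.+1%:R^-1)
   (fun n : nat => L + L * n.+1%:R^-1)); last 2 first.
- by rewrite -[X in _ --> X](subr0 L); apply: cvgB => //; exact: cvg_cst.
- by rewrite -[X in _ --> X](addr0 L); apply: cvgD => //; exact: cvg_cst.
apply: nearW => n.
have m1 : (1 < n + 2)%N by lia.
have /andP[B1 B2] := fgn_cov_bounds m1.
set m := (n + 2)%N in m1 B1 B2 *.
have mE : m.-1 = n.+1 by rewrite /m; lia.
have n1 : 0 < n.+1%:R :> R by rewrite ltr0n.
have mr0 : 0 < m%:R :> R by rewrite ltr0n ltnW.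
have mr1 : 0 < m.+1%:R :> R by rewrite ltr0n.
have mn : m%:R = n.+1%:R + 1 :> R by rewrite natr1 /m addn2.
rewrite mE in B2.
apply/andP; split.
  have q1 : m.+1%:R `^ (- a) * m%:R `^ a >= 1 - n.+1%:R^-1.
    apply: (@le_trans _ _ (m%:R / m.+1%:R)).
      rewrite ler_pdivlMr// -[m.+1%:R]natr1 mn mulrBl mul1r.
      rewrite (_ : n.+1%:R^-1 * _ = 1 + 2 * n.+1%:R^-1); last by field; rewrite gt_eqF.
      have : 0 < n.+1%:R^-1 :> R by rewrite invr_gt0.
      move=> i0; rewrite opprD !addrA addrK lerBlDr lerDl.
      by rewrite mulr_ge0// ltW.
    rewrite [leRHS](_ : _ = (m%:R / m.+1%:R) `^ a); last first.
      by rewrite powRM ?ler0n ?invr_ge0 ?ler0n// -(powR_inv1 (ler0n R m.+1)) -powRrM mulN1r mulrC.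
    apply: ger1_powR; last exact: ltW.
    by rewrite divr_gt0//= ler_pdivrMr// mul1r ler_nat.
  have := ler_wpM2l (ltW L0) q1; rewrite mulrBr mulr1 => /le_trans; apply.
  rewrite mulrA ler_wpM2r ?powR_ge0//.
  by rewrite /L; lra.
have q2 : n.+1%:R `^ (- a) * m%:R `^ a <= 1 + n.+1%:R^-1.
  have := powR_tangent n1 (ltW mr0) (_ : 0 <= a <= 1).
  rewrite (_ : m%:R - n.+1%:R = 1); last by rewrite mn; ring.
  rewrite mulr1 => /(_ ltac:(lra)).
  rewrite -(ler_pM2l (powR_gt0 (- a) n1)) mulrDr -powRD_gt0// addNr powRr0.
  rewrite mulrCA -powRD_gt0// (_ : - a + (a - 1) = -1); last by ring.
  rewrite powR_inv1 ?ler0n// => /le_trans; apply; rewrite lerD2l ler_piMl//.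
  exact: ltW.
have := ler_wpM2l (ltW L0) q2; rewrite mulrDr mulr1; apply: le_trans.
rewrite mulrA ler_wpM2r ?powR_ge0//.
by rewrite /L; lra.
Qed.

Definition fgn_conv (w : nat) : R := \sum_(l < w) (w - l)%:R `^ (a - 1) * fgn_cov l.

Lemma fgn_conv_cvg : exists beta : R, fgn_conv @ \oo --> beta.
Proof.
move: (a01) => /andP[a0 a1].
have a1' : 0 < 1 - a by lra.
have oa01 : 0 < 1 - a < 1 by lra.
have [lc lc0 cc] := binom_coef_cvg a01.
have [ld ld0 dc] := binom_coef_cvg oa01.
rewrite (_ : 1 - (1 - a) = a) in dc; last by ring.
set c := binom_coef a in cc; set d := binom_coef (1 - a) in dc.
have c0 v : 0 < c v by exact: binom_coef_gt0.
have d0 v : 0 < d v by exact: binom_coef_gt0.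
have vanish (u : nat -> R) (r l : R) : 0 < r ->
    (fun v : nat => u v * v%:R `^ r) @ \oo --> l -> u @ \oo --> (0 : R).
  move=> r0 ul; apply: cvgn_shiftS.
  have -> : (fun n => u n.+1) = (fun n => (u n.+1 * n.+1%:R `^ r) * n.+1%:R `^ (- r)).
    apply/funext => n /=; rewrite -mulrA -powRD_gt0 ?ltr0n// subrr powRr0 mulr1//.
  rewrite -(mulr0 l); apply: cvgM.
    by rewrite (cvg_shiftS (fun v : nat => u v * v%:R `^ r)).
  by rewrite (cvg_shiftS (fun v : nat => v%:R `^ (- r) : R)); exact: powRN_natr_cvg0.
have c_0 := vanish _ _ _ a1' cc.
have d_0 := vanish _ _ _ a0 dc.
have xX : (fun v : nat => v%:R `^ (a - 1) / c v) @ \oo --> lc^-1.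
  apply: cvgn_shiftS.
  have -> : (fun n : nat => n.+1%:R `^ (a - 1) / c n.+1) =
      (fun n : nat => (c n.+1 * n.+1%:R `^ (1 - a))^-1).
    apply/funext => n /=; rewrite (_ : a - 1 = - (1 - a)); last by ring.
    by rewrite powRN invfM mulrC.
  apply: cvgV; first by rewrite gt_eqF.
  by rewrite (cvg_shiftS (fun v : nat => c v * v%:R `^ (1 - a))).
have yY : (fun m : nat => fgn_cov m / d m) @ \oo --> p * (1 - a) / 2 / ld.
  apply: cvgn_shiftS.
  have -> : (fun n : nat => fgn_cov n.+1 / d n.+1) =
      (fun n : nat => (fgn_cov n.+1 * n.+1%:R `^ a) * (d n.+1 * n.+1%:R `^ a)^-1).
    apply/funext => n /=; have n0 : n.+1%:R `^ a != 0 :> R by rewrite gt_eqF// powR_gt0 ?ltr0n.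
    by field; rewrite n0 gt_eqF.
  apply: cvgM.
    by rewrite (cvg_shiftS (fun m : nat => fgn_cov m * m%:R `^ a)); exact: fgn_cov_cvg.
  apply: cvgV; first by rewrite gt_eqF.
  by rewrite (cvg_shiftS (fun v : nat => d v * v%:R `^ a)).
exists (lc^-1 * (p * (1 - a) / 2 / ld)).
have -> : fgn_conv = (fun w => \sum_(v < w.+1) (c v * (v%:R `^ (a - 1) / c v)) *
    (d (w - v)%N * (fgn_cov (w - v) / d (w - v)%N))); last first.
  exact: (toeplitz_cvg (fun v => ltW (c0 v)) (fun v => ltW (d0 v))
    (binom_coef_conv a) c_0 d_0 xX yY).
apply/funext => w; apply/esym.
rewrite big_ord_recl/= powR0; last by rewrite lt_eqF; lra.
rewrite !(mul0r, mulr0) add0r /fgn_conv.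
rewrite -(sum_rev (fun l => (w - l)%:R `^ (a - 1) * fgn_cov l)).
apply: eq_bigr => v _; rewrite /bump/= add1n.
rewrite subKn//; congr (_ * _).
  by rewrite mulrC mulfVK// gt_eqF.
by rewrite mulrC mulfVK// gt_eqF.
Qed.

(* Covariance of the two Riemann-Stieltjes sums of [P] and [Q] cells over a
   common unit mesh. *)
Definition fsum_cov (P Q : nat) : R :=
  \sum_(j < P) \sum_(l < Q) (P - j)%:R `^ (a - 1) * (Q - l)%:R `^ (a - 1) *
    fgn_cov ((j - l) + (l - j)).

(* The kernel is invariant along the diagonal, so only the boundary terms remain. *)
Lemma fsum_covS P Q : fsum_cov P.+1 Q.+1 = fsum_cov P Q +
  P.+1%:R `^ (a - 1) * fgn_conv Q.+1 +
  Q.+1%:R `^ (a - 1) * (fgn_conv P.+1 - P.+1%:R `^ (a - 1)).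
Proof.
case/andP: a01 => a0 a1; have rho0 : fgn_cov 0 = 1.
  rewrite /fgn_cov sub0r normrN normr1 !powR1 powR0; first by field.
  by rewrite /p gt_eqF//; lra.
rewrite {1}/fsum_cov big_ord_recl/=.
have -> : \sum_(l < Q.+1) (P.+1 - 0)%:R `^ (a - 1) * (Q.+1 - l)%:R `^ (a - 1) *
    fgn_cov (0 - l + (l - 0)) = P.+1%:R `^ (a - 1) * fgn_conv Q.+1.
  rewrite /fgn_conv mulr_sumr; apply: eq_bigr => l _.
  by rewrite subn0 sub0n add0n subn0 mulrA.
rewrite [X in _ + X = _](_ : _ = fsum_cov P Q +
   Q.+1%:R `^ (a - 1) * (fgn_conv P.+1 - P.+1%:R `^ (a - 1))); first by ring.
have -> : fgn_conv P.+1 - P.+1%:R `^ (a - 1) =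
    \sum_(j < P) (P - j)%:R `^ (a - 1) * fgn_cov j.+1.
  rewrite /fgn_conv big_ord_recl/= subn0 rho0 mulr1 addrAC subrr add0r.
  by apply: eq_bigr => j _; rewrite /bump/= add1n subSS.
rewrite mulr_sumr /fsum_cov -big_split/=; apply: eq_bigr => j _.
rewrite big_ord_recl/= /bump/= add1n subSS subn0 sub0n addn0 [RHS]addrC; congr (_ + _).
  by rewrite subn0; ring.
Qed.

Lemma fsum_covE Q t : fsum_cov (Q + t) Q =
  \sum_(w < Q) ((w + t).+1%:R `^ (a - 1) * fgn_conv w.+1 +
    w.+1%:R `^ (a - 1) * (fgn_conv (w + t).+1 - (w + t).+1%:R `^ (a - 1))).
Proof.
elim: Q => [|Q IH].
  by rewrite big_ord0 /fsum_cov big1// => j _; rewrite big_ord0.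
by rewrite addSn fsum_covS big_ord_recr/= IH addrA.
Qed.

Lemma sum_powR_shift_bounds Q t :
  ((Q + t)%:R `^ a - t%:R `^ a - 1) / a <= \sum_(w < Q) (w + t).+1%:R `^ (a - 1)
    <= ((Q + t)%:R `^ a - t%:R `^ a) / a.
Proof.
move: (a01) => /andP[a0 a1].
have a01' : 0 <= a <= 1 by lra.
have pow1 (x : R) : 0 <= x -> (x + 1) `^ a <= x `^ a + 1.
  move=> x0; have := @powR_diff_le_powR R (x + 1) x a x0.
  by rewrite (_ : x + 1 - x = 1) ?powR1; [lra | ring].
apply/andP; split.
  rewrite ler_pdivrMr// mulr_suml.
  apply: (@le_trans _ _ (\sum_(w < Q) fweight 1 a (t.+1 + w))).
    rewrite sum_fweight_rect !mulr1.
    have h1 := pow1 t%:R (ler0n _ _); rewrite natr1 in h1.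
    have h2 : (Q + t)%:R `^ a <= (t.+1 + Q)%:R `^ a :> R.
      by apply: powR_le_mono; rewrite ?ler0n ?ler_nat ?(ltW a0)//; lia.
    by lra.
  apply: ler_sum => w _; rewrite /fweight !mulr1.
  have w0 : 0 < (t.+1 + w)%:R :> R by rewrite ltr0n.
  have := powR_tangent w0 (ler0n R (t.+1 + w).+1) a01'.
  rewrite (_ : (t.+1 + w).+1%:R - (t.+1 + w)%:R = 1 :> R); last by rewrite -natr1; ring.
  by rewrite addSn (addnC t) mulr1 => h; lra.
rewrite ler_pdivlMr// mulr_suml.
apply: (@le_trans _ _ (\sum_(w < Q) fweight 1 a (t + w))); last first.
  by rewrite sum_fweight_rect !mulr1 addnC.
apply: ler_sum => w _; rewrite /fweight !mulr1.
have w0 : 0 < (t + w).+1%:R :> R by rewrite ltr0n.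
have := powR_tangent w0 (ler0n R (t + w)) a01'.
rewrite (_ : (t + w)%:R - (t + w).+1%:R = -1 :> R); last by rewrite -natr1; ring.
by rewrite (addnC t) => h; lra.
Qed.

Lemma fsum_cov_asymp (beta e : R) : fgn_conv @ \oo --> beta -> 0 < e ->
  exists K : R, forall Q t, `|fsum_cov (Q + t) Q -
    beta / a * ((Q + t)%:R `^ a - t%:R `^ a + Q%:R `^ a)| <= e * Q%:R `^ a + K.
Proof.
move: (a01) => /andP[a0 a1] cb e0.
pose del w : R := `|fgn_conv w.+1 - beta|.
have cb0 : del @ \oo --> (0 : R).
  rewrite -(normr0 R); apply: cvg_norm; rewrite -(subrr beta).
  apply: cvgB; last exact: cvg_cst.
  by rewrite cvg_shiftS.
have pw0 : (fun w : nat => w.+1%:R `^ (a - 1) : R) @ \oo --> (0 : R).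
  rewrite (cvg_shiftS (fun w : nat => w%:R `^ (a - 1) : R)).
  have -> : a - 1 = - (1 - a) by ring.
  by apply: powRN_natr_cvg0; lra.
have [D D0 hD] := cvgn_bounded cb0.
have e3 : 0 < e * a / 3 by rewrite divr_gt0// mulr_gt0.
have [N1 hN1] := (cvgn_distP _ _).1 cb0 _ e3.
have [N2 hN2] := (cvgn_distP _ _).1 pw0 _ e3.
pose N := maxn N1 N2.
have pw1 (w : nat) : 0 <= w.+1%:R `^ (a - 1) <= (1 : R).
  rewrite powR_ge0/=; have := @powR_le_npow R w.+1%:R 1 (a - 1) ltr01.
  by rewrite powR1 ler1n; apply => //; lra.
exists ((D + D + 1) * N%:R + `|beta| * (a^-1 + a^-1)) => Q t.
pose err w := ((w + t).+1%:R `^ (a - 1) * (fgn_conv w.+1 - beta) +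
    w.+1%:R `^ (a - 1) * (fgn_conv (w + t).+1 - beta - (w + t).+1%:R `^ (a - 1))).
have pwle w : (w + t).+1%:R `^ (a - 1) <= w.+1%:R `^ (a - 1) :> R.
  by apply: powR_le_npow; rewrite ?ltr0n ?ler_nat ?ltnS ?leq_addr//; lra.
have errle w : `|err w| <= w.+1%:R `^ (a - 1) * (del w + del (w + t)%N + w.+1%:R `^ (a - 1)).
  rewrite /err; apply: (le_trans (ler_normD _ _)).
  rewrite !normrM !(ger0_norm (powR_ge0 _ _)) -[del w + _ + _]addrA mulrDr; apply: lerD.
    by rewrite ler_wpM2r.
  apply: ler_wpM2l; first exact: powR_ge0.
  apply: (le_trans (ler_normB _ _)); rewrite lerD2l ger0_norm ?powR_ge0//.
have errsum : `|\sum_(w < Q) err w| <= e * Q%:R `^ a + (D + D + 1) * N%:R.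
  apply: (le_trans (ler_norm_sum _ _ _)).
  apply: (@le_trans _ _ (\sum_(w < Q) (e * a * w.+1%:R `^ (a - 1) +
     (if (w < N)%N then D + D + 1 else 0)))).
    apply: ler_sum => w _; apply: (le_trans (errle w)).
    have /andP[w0 w1] := pw1 w.
    have dw0 v : 0 <= del v by rewrite normr_ge0.
    have dD v : del v <= D by have := hD v; rewrite ger0_norm.
    case: ltnP => wN.
      apply: (@le_trans _ _ (1 * (D + D + 1))); last first.
        by rewrite mul1r lerDr mulr_ge0// mulr_ge0 ?ltW.
      apply: ler_pM => //; first by rewrite !addr_ge0.
      by rewrite !lerD.
    rewrite addr0 mulrC ler_wpM2r//.
    have N1w : (N1 <= w)%N by apply: leq_trans wN; exact: leq_maxl.
    have N2w : (N2 <= w)%N by apply: leq_trans wN; exact: leq_maxr.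
    have h1 := hN1 w N1w; have h2 := hN1 (w + t)%N (leq_trans N1w (leq_addr _ _)).
    have h3 := hN2 w N2w.
    rewrite !subr0 !ger0_norm ?powR_ge0// in h1 h2 h3.
    by lra.
  rewrite big_split/= -mulr_sumr; apply: lerD.
    rewrite -mulrA ler_pM2l// mulrC -ler_pdivlMr//.
    by apply: sum_powR_le; lra.
  have step (n : nat) : \sum_(w < n) (if (w < N)%N then D + D + 1 else 0) <=
      (D + D + 1) * (minn n N)%:R.
    elim: n => [|n IHn]; first by rewrite big_ord0 min0n mulr0.
    rewrite big_ord_recr/=; apply: (le_trans (lerD IHn (lexx _))).
    case: ltnP => nN; last by rewrite addr0 !(minn_idPr _)// leqW.
    by rewrite !(minn_idPl _)// ?(ltnW nN)// -natr1 mulrDr mulr1.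
  apply: (le_trans (step Q)); rewrite ler_wpM2l ?ler_nat ?geq_minr//.
  by rewrite !addr_ge0 ?ltW.
have sE : fsum_cov (Q + t) Q = beta * (\sum_(w < Q) (w + t).+1%:R `^ (a - 1) +
    \sum_(w < Q) w.+1%:R `^ (a - 1)) + \sum_(w < Q) err w.
  rewrite fsum_covE -big_split/= mulr_sumr -big_split/=; apply: eq_bigr => w _.
  by rewrite /err; ring.
have /andP[A1 A2] := sum_powR_shift_bounds Q t.
have /andP[B1 B2] := sum_powR_shift_bounds Q 0.
have B0 : \sum_(w < Q) (w + 0).+1%:R `^ (a - 1) = \sum_(w < Q) w.+1%:R `^ (a - 1) :> R.
  by apply: eq_bigr => w _; rewrite addn0.
rewrite B0 addn0 powR0 ?gt_eqF// subr0 in B1 B2.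
rewrite sE; set S1 := \sum_(w < Q) _ in A1 A2 *; set S2 := \sum_(w < Q) _ in B1 B2 *.
set E := \sum_(w < Q) err w in errsum *.
set U := (Q + t)%:R `^ a - t%:R `^ a in A1 A2 *; set V := Q%:R `^ a in B1 B2 errsum *.
have -> : beta * (S1 + S2) + E - beta / a * (U + V) =
   E + beta * ((S1 - U / a) + (S2 - V / a)) by ring.
apply: (le_trans (ler_normD _ _)); rewrite [leRHS]addrA; apply: lerD => //.
rewrite normrM ler_wpM2l//; apply: (le_trans (ler_normD _ _)); apply: lerD.
  by rewrite ler_norml; rewrite mulrBl mul1r in A1; apply/andP; split; lra.
by rewrite ler_norml; rewrite mulrBl mul1r in B1; apply/andP; split; lra.
Qed.

Lemma fsum_cov_cvg (beta : R) (q t : nat) : fgn_conv @ \oo --> beta ->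
  (fun M : nat => M.+1%:R `^ (- a) * fsum_cov ((q + t) * M.+1) (q * M.+1)) @ \oo -->
    beta / a * ((q + t)%:R `^ a - t%:R `^ a + q%:R `^ a).
Proof.
move: (a01) => /andP[a0 a1] cb.
apply/cvgn_distP => e e0.
have e2 : 0 < e / 2 / (1 + q%:R `^ a) by rewrite divr_gt0 ?divr_gt0// ltr_wpDr ?powR_ge0.
have [K hK] := fsum_cov_asymp cb e2.
have cvK : (fun M : nat => K * M.+1%:R `^ (- a)) @ \oo --> (0 : R).
  rewrite -(mulr0 K); apply: cvgM; first exact: cvg_cst.
  by rewrite (cvg_shiftS (fun w : nat => w%:R `^ (- a) : R)); exact: powRN_natr_cvg0.
have e22 : 0 < e / 2 by rewrite divr_gt0.
have [N hN] := (cvgn_distP _ _).1 cvK _ e22.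
exists N => M NM; have M0 : 0 < M.+1%:R :> R by rewrite ltr0n.
have := hK (q * M.+1)%N (t * M.+1)%N.
rewrite -mulnDl !natrM !powRM ?ler0n//.
set m := M.+1%:R `^ a; have m0 : 0 < m by rewrite powR_gt0.
have mN : M.+1%:R `^ (- a) = m^-1 by rewrite powRN.
rewrite mN => h.
have {h} := ler_wpM2l (ltW (_ : 0 < m^-1)) h; rewrite ?invr_gt0// => /(_ m0).
rewrite -{1}(gtr0_norm (_ : 0 < m^-1)) ?invr_gt0// -normrM.
rewrite (_ : m^-1 * (_ - _) = m^-1 * fsum_cov ((q + t) * M.+1) (q * M.+1) -
  beta / a * ((q + t)%:R `^ a - t%:R `^ a + q%:R `^ a)); last first.
  by field; rewrite !gt_eqF.
move=> /le_trans; apply.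
have := hN M NM; rewrite subr0 mN => /(le_trans (ler_norm _)) h1.
rewrite mulrDr (mulrC _ K).
have -> : m^-1 * (e / 2 / (1 + q%:R `^ a) * (q%:R `^ a * m)) =
   e / 2 * (q%:R `^ a / (1 + q%:R `^ a)).
  by field; rewrite gt_eqF//= gt_eqF// ltr_wpDr ?powR_ge0.
have : q%:R `^ a / (1 + q%:R `^ a) <= 1.
  by rewrite ler_pdivrMr ?ltr_wpDr ?powR_ge0// mul1r lerDr.
move=> h2; have := ler_wpM2l (ltW e22) h2; lra.
Qed.

End FractionalNoiseCovariance.

Section SquareIntegrable.
Context {dT : measure_display} {Omega : measurableType dT} {R : realType}.
Variable P : probability Omega R.
Implicit Types (f g : Omega -> R) (c : R).

Definition L2 f := measurable_fun setT f /\ P.-integrable setT (fun w => (f w ^+ 2)%:E).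

Definition ip f g : R := Rintegral P setT (fun w => f w * g w).

Definition nrm f : R := Num.sqrt (ip f f).

Lemma L2P f : measurable_fun setT f -> (\int[P]_w (f w ^+ 2)%:E < +oo)%E -> L2 f.
Proof.
move=> mf fi; split=> //; apply/integrableP; split.
  by apply/measurable_EFinP; exact: measurable_funX.
under eq_integral do rewrite gee0_abs ?lee_fin ?sqr_ge0//.
by [].
Qed.

Lemma L2_mul f g : L2 f -> L2 g -> P.-integrable setT (fun w => (f w * g w)%:E).
Proof.
move=> [mf f2] [mg g2].
apply: (le_integrable measurableT _ _ (integrableD measurableT f2 g2)).
  by apply/measurable_EFinP; exact: measurable_funM.
move=> w _; rewrite -EFinD !abse_EFin lee_fin normrM.
rewrite (ger0_norm (addr_ge0 (sqr_ge0 _) (sqr_ge0 _))).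
have := sqr_ge0 (`|f w| - `|g w|).
rewrite -(real_normK (num_real (f w))) -(real_normK (num_real (g w))).
have := normr_ge0 (f w); have := normr_ge0 (g w).
by move: `|f w| `|g w| => x y ? ? ?; nra.
Qed.

Lemma L20 : L2 (fun=> 0).
Proof.
apply: L2P; first exact: measurable_cst.
by under eq_integral do rewrite expr0n/=; rewrite integral0.
Qed.

Lemma L2D f g : L2 f -> L2 g -> L2 (fun w => f w + g w).
Proof.
move=> f2 g2; have fg := L2_mul f2 g2; case: (f2) (g2) => [mf fi] [mg gi].
split; first exact: measurable_funD.
have := integrableD measurableT (integrableD measurableT fi gi)
  (integrableD measurableT fg fg).
apply: eq_integrable => // w _ /=; rewrite -!EFinD; congr EFin; ring.
Qed.

Lemma L2Z c f : L2 f -> L2 (fun w => c * f w).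
Proof.
move=> [mf fi]; split; first exact: measurable_funM.
have := integrableZl measurableT (c ^+ 2) fi.
by apply: eq_integrable => // w _; rewrite -EFinM exprMn.
Qed.

Lemma L2N f : L2 f -> L2 (fun w => - f w).
Proof.
move=> /(L2Z (-1)); congr L2; apply/funext => w; exact: mulN1r.
Qed.

Lemma L2B f g : L2 f -> L2 g -> L2 (fun w => f w - g w).
Proof. by move=> f2 g2; apply: L2D => //; exact: L2N. Qed.

Lemma L2_sum (I : Type) (r : seq I) (F : I -> Omega -> R) : (forall i, L2 (F i)) ->
  L2 (fun w => \sum_(i <- r) F i w).
Proof.
move=> hF; elim: r => [|i r IH].
  by have := L20; congr L2; apply/funext => w; rewrite big_nil.
by have := L2D (hF i) IH; congr L2; apply/funext => w; rewrite big_cons.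
Qed.

Lemma ipC f g : ip f g = ip g f.
Proof. by apply: eq_Rintegral => w _; rewrite mulrC. Qed.

Lemma ipDl f g h : L2 f -> L2 g -> L2 h -> ip (fun w => f w + g w) h = ip f h + ip g h.
Proof.
move=> f2 g2 h2; rewrite /ip -RintegralD//; [|exact: L2_mul|exact: L2_mul].
by apply: eq_Rintegral => w _; rewrite mulrDl.
Qed.

Lemma ipZl c f h : L2 f -> L2 h -> ip (fun w => c * f w) h = c * ip f h.
Proof.
move=> f2 h2; rewrite /ip -RintegralZl//; last exact: L2_mul.
by apply: eq_Rintegral => w _; rewrite mulrA.
Qed.

Lemma ipBl f g h : L2 f -> L2 g -> L2 h -> ip (fun w => f w - g w) h = ip f h - ip g h.
Proof.
move=> f2 g2 h2; rewrite /ip -RintegralB//; [|exact: L2_mul|exact: L2_mul].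
by apply: eq_Rintegral => w _; rewrite mulrBl.
Qed.

Lemma ipDr f g h : L2 f -> L2 g -> L2 h -> ip h (fun w => f w + g w) = ip h f + ip h g.
Proof. by move=> *; rewrite ipC ipDl// !(ipC h). Qed.

Lemma ipZr c f h : L2 f -> L2 h -> ip h (fun w => c * f w) = c * ip h f.
Proof. by move=> *; rewrite ipC ipZl// (ipC h). Qed.

Lemma ipBr f g h : L2 f -> L2 g -> L2 h -> ip h (fun w => f w - g w) = ip h f - ip h g.
Proof. by move=> *; rewrite ipC ipBl// !(ipC h). Qed.

Lemma ip_suml (I : Type) (r : seq I) (F : I -> Omega -> R) h : (forall i, L2 (F i)) ->
  L2 h -> ip (fun w => \sum_(i <- r) F i w) h = \sum_(i <- r) ip (F i) h.
Proof.
move=> hF h2; elim: r => [|i r IH].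
  rewrite big_nil (_ : (fun w => _) = fun w => 0 * h w); first by rewrite ipZl// mul0r.
  by apply/funext => w; rewrite big_nil mul0r.
rewrite big_cons -IH -ipDl//; last exact: L2_sum.
by congr ip; apply/funext => w; rewrite big_cons.
Qed.

Lemma ip_sumr (I : Type) (r : seq I) (F : I -> Omega -> R) h : (forall i, L2 (F i)) ->
  L2 h -> ip h (fun w => \sum_(i <- r) F i w) = \sum_(i <- r) ip h (F i).
Proof.
move=> hF h2; rewrite ipC ip_suml//.
by apply: eq_bigr => i _; rewrite ipC.
Qed.

Lemma ip_ge0 f : 0 <= ip f f.
Proof. by apply: Rintegral_ge0 => w _; rewrite -expr2 sqr_ge0. Qed.

Lemma nrm_ge0 f : 0 <= nrm f. Proof. exact: sqrtr_ge0. Qed.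

Lemma nrm_sqr f : nrm f ^+ 2 = ip f f.
Proof. by rewrite sqr_sqrtr// ip_ge0. Qed.

Lemma integral_sqrE f : L2 f -> (\int[P]_w (f w ^+ 2)%:E = (nrm f ^+ 2)%:E)%E.
Proof.
move=> f2; rewrite nrm_sqr /ip /Rintegral fineK.
  by apply: eq_integral => w _; rewrite expr2.
by apply: integrable_fin_num => //; exact: L2_mul.
Qed.

Lemma ip_le f g : L2 f -> L2 g -> `|ip f g| <= nrm f * nrm g.
Proof.
move=> f2 g2.
have quad (t : R) : 0 <= ip f f + 2 * t * ip f g + t ^+ 2 * ip g g.
  have tg : L2 (fun w => t * g w) by exact: L2Z.
  have := ip_ge0 (fun w => f w + t * g w).
  rewrite ipDl ?ipDr// ?ipZl ?ipZr//; [|exact: L2D..].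
  by rewrite (ipC g f) => h; lra.
have -> : nrm f * nrm g = Num.sqrt (ip f f * ip g g) by rewrite sqrtrM// ip_ge0.
rewrite -sqrtr_sqr ler_wsqrtr//.
have [g0|g0] := eqVneq (ip g g) 0.
  rewrite g0 mulr0.
  have [->|n0] := eqVneq (ip f g) 0; first by rewrite expr0n.
  have := quad (- (ip f f + 1) / (2 * ip f g)).
  rewrite g0 mulr0 addr0.
  rewrite (_ : 2 * _ * _ = - (ip f f + 1)); last by field.
  by move=> ?; lra.
have gg0 : 0 < ip g g by rewrite lt_neqAle eq_sym g0 ip_ge0.
have := quad (- ip f g / ip g g).
rewrite (_ : _ + _ + _ = ip f f - ip f g ^+ 2 / ip g g); last by field.
by rewrite subr_ge0 ler_pdivrMr.
Qed.

Lemma nrmD f g : L2 f -> L2 g -> nrm (fun w => f w + g w) <= nrm f + nrm g.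
Proof.
move=> f2 g2; rewrite -(@ler_sqr _ (nrm _)) ?nnegrE ?addr_ge0 ?nrm_ge0//.
rewrite nrm_sqr ipDl ?ipDr//; [|exact: L2D].
rewrite sqrrD !nrm_sqr (ipC g f).
have := le_trans (ler_norm _) (ip_le f2 g2) => ?; lra.
Qed.

Lemma nrmZ c f : L2 f -> nrm (fun w => c * f w) = `|c| * nrm f.
Proof.
move=> f2; rewrite /nrm ipZl ?ipZr//; last exact: L2Z.
by rewrite mulrA sqrtrM ?sqr_ge0// -?expr2 ?sqrtr_sqr ?sqr_ge0.
Qed.

Lemma nrmN f : L2 f -> nrm (fun w => - f w) = nrm f.
Proof.
move=> f2; rewrite -[RHS]mul1r -(normr1 R) -normrN -nrmZ//.
by congr nrm; apply/funext => w; rewrite mulN1r.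
Qed.

Lemma nrm0 : nrm (fun=> 0) = 0.
Proof.
by have := nrmZ 0 L20; rewrite normr0 !mul0r.
Qed.

Lemma nrm_sum (I : Type) (r : seq I) (F : I -> Omega -> R) : (forall i, L2 (F i)) ->
  nrm (fun w => \sum_(i <- r) F i w) <= \sum_(i <- r) nrm (F i).
Proof.
move=> hF; elim: r => [|i r IH].
  rewrite big_nil (_ : (fun w => _) = fun=> 0) ?nrm0//.
  by apply/funext => w; rewrite big_nil.
rewrite big_cons; apply: le_trans (lerD (lexx _) IH).
rewrite (_ : (fun w => _) = fun w => F i w + \sum_(j <- r) F j w).
  by apply: nrmD => //; exact: L2_sum.
by apply/funext => w; rewrite big_cons.
Qed.

Lemma nrm_sum_negcorr (n : nat) (F : nat -> Omega -> R) : (forall j, (j < n)%N -> L2 (F j)) ->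
  (forall j l, (j < l < n)%N -> ip (F j) (F l) <= 0) ->
  nrm (fun w => \sum_(j < n) F j w) ^+ 2 <= \sum_(j < n) nrm (F j) ^+ 2.
Proof.
elim: n => [|n IH] F2 neg.
  rewrite big_ord0 (_ : (fun w => _) = fun=> 0) ?nrm0 ?expr0n//.
  by apply/funext => w; rewrite big_ord0.
have F2' (j : 'I_n) : L2 (F j) by apply: F2; exact: (leqW (ltn_ord j)).
rewrite big_ord_recr/= (_ : (fun w => _) = fun w => \sum_(j < n) F j w + F n w); last first.
  by apply/funext => w; rewrite big_ord_recr.
have S2 : L2 (fun w => \sum_(j < n) F j w) by exact: (L2_sum (index_enum 'I_n) F2').
have Fn := F2 n (ltnSn n).
rewrite nrm_sqr ipDl ?ipDr//; [|exact: L2D].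
rewrite (ipC (F n) (fun w => _)) -(nrm_sqr (F n)) -(nrm_sqr (fun w => _)).
have ipn : ip (fun w => \sum_(j < n) F j w) (F n) <= 0.
  rewrite (ip_suml (index_enum 'I_n) F2' Fn).
  by apply: sumr_le0 => j _; apply: neg; rewrite ltn_ord ltnSn.
have IHn : nrm (fun w => \sum_(j < n) F j w) ^+ 2 <= \sum_(j < n) nrm (F j) ^+ 2.
  apply: IH => [j jn|j l /andP[jl ln]]; first by apply: F2; exact: ltnW.
  by apply: neg; rewrite jl ltnW.
by lra.
Qed.

Lemma ip_cvg (F G : nat -> Omega -> R) f g : L2 f -> L2 g ->
  (forall n, L2 (F n)) -> (forall n, L2 (G n)) ->
  (fun n => nrm (fun w => F n w - f w)) @ \oo --> (0 : R) ->
  (fun n => nrm (fun w => G n w - g w)) @ \oo --> (0 : R) ->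
  (fun n => ip (F n) (G n)) @ \oo --> ip f g.
Proof.
move=> f2 g2 F2 G2 Ff Gg.
have Ff2 n := L2B (F2 n) f2; have Gg2 n := L2B (G2 n) g2.
have bnd n : `|ip (F n) (G n) - ip f g| <= nrm (fun w => F n w - f w) *
   nrm (fun w => G n w - g w) + nrm (fun w => F n w - f w) * nrm g +
   nrm f * nrm (fun w => G n w - g w).
  have -> : ip (F n) (G n) - ip f g = ip (fun w => F n w - f w) (fun w => G n w - g w) +
     ip (fun w => F n w - f w) g + ip f (fun w => G n w - g w).
    by rewrite !ipBl// !ipBr//; ring.
  apply: (le_trans (ler_normD _ _)); apply: lerD; last exact: ip_le.
  by apply: (le_trans (ler_normD _ _)); apply: lerD; exact: ip_le.
have lim0 : (fun n => nrm (fun w => F n w - f w) *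
   nrm (fun w => G n w - g w) + nrm (fun w => F n w - f w) * nrm g +
   nrm f * nrm (fun w => G n w - g w)) @ \oo --> (0 * 0 + 0 * nrm g + nrm f * 0 : R).
  apply: cvgD; [apply: cvgD; apply: cvgM => //; exact: cvg_cst|].
  by apply: cvgM => //; exact: cvg_cst.
rewrite !(mul0r, mulr0, addr0) in lim0.
apply/cvgn_distP => e e0; have [N hN] := (cvgn_distP _ _).1 lim0 e e0.
exists N => n Nn; apply: (le_trans (bnd n)); have := hN n Nn.
by rewrite subr0 => /(le_trans (ler_norm _)).
Qed.

Lemma fatou_bound (F : nat -> Omega -> R) f (c : \bar R) :
  (forall n, measurable_fun setT (F n)) -> measurable_fun setT f ->
  (forall n w, 0 <= F n w) -> (forall w, 0 <= f w) ->
  {ae P, forall w, (fun n => F n w) @ \oo --> f w} ->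
  (forall n, (\int[P]_w (F n w)%:E <= c)%E) ->
  (\int[P]_w (f w)%:E <= c)%E.
Proof.
move=> mF mf F0 f0 Ff Fc.
pose E n w := (F n w)%:E.
have mE n : measurable_fun setT (E n) by apply/measurable_EFinP.
have mlim : measurable_fun setT (fun w => limn_einf (E ^~ w)).
  rewrite /limn_einf; apply: measurableT_comp => //.
  apply: measurable_fun_limn_esup => n; exact: measurableT_comp.
have lim0 w : (0 <= limn_einf (E ^~ w))%E.
  rewrite limn_einf_lim; apply: lime_ge; first exact: is_cvg_einfs.
  apply: nearW => n; apply: le_ereal_inf_tmp => _ [k _ <-].
  by rewrite lee_fin.
rewrite (@ge0_ae_eq_integral _ _ _ P setT (EFin \o f) (fun w => limn_einf (E ^~ w)))//.
- apply: (le_trans (fatou P measurableT mE _)).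
    by move=> n w _; rewrite lee_fin.
  rewrite limn_einf_lim; apply: lime_le; first exact: is_cvg_einfs.
  apply: nearW => n; apply: (le_trans _ (Fc n)).
  by apply: ereal_inf_lbound; exists n => //=.
- exact/measurable_EFinP.
- by move=> w _; rewrite lee_fin.
- move: Ff; apply: filterS => w Fw _ /=.
  have : (E ^~ w) @ \oo --> (f w)%:E by apply/cvg_EFin => //; exact: nearW.
  by move/cvg_limn_einf_sup => -[->].
Qed.

Lemma one_sub_cos_bounds (x : R) : x ^+ 2 / 2 - x ^+ 4 / 8 <= 1 - cos x <= x ^+ 2 / 2.
Proof.
have cosE (y : R) : 1 - cos y = 2 * sin (y / 2) ^+ 2.
  rewrite {1}(splitr y) cosD -!expr2 cos2sin2; ring.
have sinle (y : R) : 0 <= y -> exists2 c : R, 0 <= c <= y & sin y = cos c * y.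
  move=> y0; have [|c] := @MVT_segment R sin cos 0 y y0.
    by apply: continuous_subspaceT => z; exact: continuous_sin.
  by rewrite in_itv/= sin0 !subr0 => cy ->; exists c.
have sin2 (y : R) : exists2 c : R, c ^+ 2 <= y ^+ 2 & sin y ^+ 2 = cos c ^+ 2 * y ^+ 2.
  have [y0|y0] := leP 0 y.
    have [c /andP[c0 cy] ->] := sinle y y0; exists c; last by rewrite exprMn.
    by rewrite ler_sqr ?nnegrE.
  have [c /andP[c0 cy] sE] := sinle (- y) ltac:(lra).
  exists c; first by rewrite -(sqrrN y) ler_sqr ?nnegrE//; lra.
  by rewrite -(sqrrN (sin y)) -sinN sE exprMn sqrrN.
have up (y : R) : 1 - cos y <= y ^+ 2 / 2.
  rewrite cosE; have [c _ ->] := sin2 (y / 2).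
  have c1 : cos c ^+ 2 <= 1 by rewrite cos2sin2 gerBl sqr_ge0.
  by rewrite expr_div_n; have := sqr_ge0 y; nra.
rewrite up andbT cosE; have [c cx ->] := sin2 (x / 2).
have := up c; have := cos_le1 c; have := cos_geN1 c.
rewrite expr_div_n in cx *.
have -> : x ^+ 4 = (x ^+ 2) ^+ 2 by rewrite -exprM.
have := sqr_ge0 x; have := sqr_ge0 c.
move: (x ^+ 2) (c ^+ 2) cx (cos c) => X C cx k C0 X0 k1 k2 k3.
have k4 : 1 - C <= k ^+ 2 by nra.
nra.
Qed.

Lemma gaussian_moment2 (Y : Omega -> R) (v : R) : centered_gaussian P Y v ->
  L2 Y /\ (\int[P]_w (Y w ^+ 2)%:E = v%:E)%E.
Proof.
move=> [mY chY].
pose u (n : nat) : R := n.+1%:R^-1.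
have u0 n : 0 < u n by rewrite invr_gt0 ltr0n.
pose F n w := 2 / u n ^+ 2 * (1 - cos (u n * Y w)).
have mcos n : measurable_fun setT (fun w => cos (u n * Y w)).
  apply: (measurableT_comp (continuous_measurable_fun (@continuous_cos R))).
  exact: measurable_funM.
have mF n : measurable_fun setT (F n).
  by apply: measurable_funM => //; exact: measurable_funB.
have FB n w : Y w ^+ 2 - u n ^+ 2 * Y w ^+ 4 / 4 <= F n w <= Y w ^+ 2.
  have /andP[l1 l2] := one_sub_cos_bounds (u n * Y w).
  have k0 : 0 < 2 / u n ^+ 2 by rewrite divr_gt0// exprn_gt0.
  have un : u n != 0 by rewrite gt_eqF.
  apply/andP; split.
    apply: le_trans (ler_wpM2l (ltW k0) l1).
    by rewrite le_eqVlt; apply/orP; left; apply/eqP; field.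
  apply: (le_trans (ler_wpM2l (ltW k0) l2)).
  by rewrite le_eqVlt; apply/orP; left; apply/eqP; field.
have F0 n w : 0 <= F n w.
  apply: mulr_ge0; first by rewrite divr_ge0 ?sqr_ge0.
  by rewrite subr_ge0 cos_le1.
have IF n : (\int[P]_w (F n w)%:E = (2 / u n ^+ 2 * (1 - expR (- (u n ^+ 2 * v) / 2)))%:E)%E.
  have bcos : P.-integrable setT (EFin \o (fun w => cos (u n * Y w))).
    apply: measurable_bounded_integrable => //.
      exact: le_lt_trans (probability_le1 P measurableT) (ltry 1).
    exists 1; split; first by rewrite num_real.
    move=> M M1 w _ /=; apply: le_trans (ltW M1).
    by rewrite ler_norml cos_geN1 cos_le1.
  have b1 : P.-integrable setT (EFin \o (fun w : Omega => (1 : R))).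
    exact: finite_measure_integrable_cst.
  under eq_integral do rewrite /F EFinM.
  have bB : P.-integrable setT (fun w => (1 - cos (u n * Y w))%:E).
    have := integrableB measurableT b1 bcos.
    by apply: eq_integrable => // w _ /=; rewrite EFinB.
  rewrite integralZl//.
  rewrite [RHS]EFinM; congr (_ * _)%E.
  under eq_integral do rewrite EFinB.
  rewrite integralB_EFin// EFinB; congr (_ - _)%E.
    by rewrite integral_cst// mul1e; exact: probability_setT.
  by have [-> _] := chY (u n).
have uc : u @ \oo --> (0 : R) by exact: cvg_harmonic.
have Fle : (\int[P]_w (Y w ^+ 2)%:E <= v%:E)%E.
  apply: (@fatou_bound F) => //.
  - exact: measurable_funX.
  - by move=> w; rewrite sqr_ge0.
  - apply: aeW => w.
    apply: (@squeeze_cvgr _ _ _ _ (fun n => Y w ^+ 2 - u n ^+ 2 * Y w ^+ 4 / 4) (fun=> Y w ^+ 2)).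
    + by apply: nearW => n; exact: FB.
    + have lc : (fun n => Y w ^+ 2 - u n ^+ 2 * Y w ^+ 4 / 4) @ \oo -->
          Y w ^+ 2 - (0 : R) ^+ 2 * Y w ^+ 4 / 4.
        apply: cvgB; first exact: cvg_cst.
        apply: cvgM; last exact: cvg_cst.
        apply: cvgM; last exact: cvg_cst.
        by under eq_fun do rewrite expr2; rewrite expr2; exact: cvgM.
      by rewrite expr0n/= !mul0r subr0 in lc.
    + exact: cvg_cst.
  - move=> n; rewrite IF lee_fin.
    have := expR_ge1Dx (- (u n ^+ 2 * v) / 2) => h.
    have k0 : 0 < 2 / u n ^+ 2 by rewrite divr_gt0// exprn_gt0.
    apply: (@le_trans _ _ (2 / u n ^+ 2 * (u n ^+ 2 * v / 2))).
      by rewrite ler_pM2l//; lra.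
    by rewrite le_eqVlt; apply/orP; left; apply/eqP; field; rewrite gt_eqF.
have Y2 : L2 Y by apply: L2P => //; apply: le_lt_trans Fle _; exact: ltry.
split => //; apply/eqP; rewrite eq_le Fle/=.
rewrite integral_sqrE// lee_fin.
have low n : v * expR (- (u n ^+ 2 * v) / 2) <= nrm Y ^+ 2.
  have : (\int[P]_w (F n w)%:E <= \int[P]_w (Y w ^+ 2)%:E)%E.
    apply: ge0_le_integral => //.
    - by move=> w _; rewrite lee_fin.
    - exact/measurable_EFinP.
    - by apply/measurable_EFinP; exact: measurable_funX.
    - by move=> w _; rewrite lee_fin; case/andP: (FB n w).
  rewrite IF integral_sqrE// lee_fin => /(le_trans _); apply.
  set x := - (u n ^+ 2 * v) / 2.
  have k0 : 0 < 2 / u n ^+ 2 by rewrite divr_gt0// exprn_gt0.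
  have vE : v = 2 / u n ^+ 2 * (- x) by rewrite /x; field; rewrite gt_eqF.
  apply: (@le_trans _ _ (2 / u n ^+ 2 * (- x * expR x))); first by rewrite mulrA -vE.
  rewrite ler_pM2l//.
  have h := expR_ge1Dx (- x).
  have := ler_wpM2l (expR_ge0 x) h; rewrite -expRD subrr expR0 mulrDr mulr1 => ?; lra.
have lowc : (fun n => v * expR (- (u n ^+ 2 * v) / 2)) @ \oo --> v * expR (- (0 ^+ 2 * v) / 2).
  apply: cvgM; first exact: cvg_cst.
  apply: (@cvg_comp _ _ _ (fun n => - (u n ^+ 2 * v) / 2) expR); last exact: continuous_expR.
  apply: cvgM; last exact: cvg_cst.
  apply: cvgN; apply: cvgM; last exact: cvg_cst.
  by under eq_fun do rewrite expr2; rewrite expr2; exact: cvgM.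
rewrite expr0n/= mul0r oppr0 mul0r expR0 mulr1 in lowc.
have := @limr_le _ _ _ _ (nrm Y ^+ 2) _ (cvgP _ lowc).
by rewrite (cvg_lim _ lowc)//; apply; exact: nearW.
Qed.

End SquareIntegrable.

Section FractionalNoise.
Context {dT : measure_display} {Omega : measurableType dT} {R : realType}.
Variable P : probability Omega R.
Context {d : nat} (H : R) (BH : 'I_d -> R -> Omega -> R).
Hypothesis hB : is_fBm P H BH.
Local Notation L2 := (L2 P).
Local Notation ip := (ip P).
Local Notation nrm := (nrm P).

Lemma fbm_covC (s t : R) : fbm_cov H s t = fbm_cov H t s.
Proof. by rewrite /fbm_cov distrC (addrC (s `^ _)). Qed.

Lemma fBm_comb i (s t x y : R) : 0 <= s -> 0 <= t ->
  L2 (fun w => x * BH i s w + y * BH i t w) /\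
  nrm (fun w => x * BH i s w + y * BH i t w) ^+ 2 =
    x ^+ 2 * fbm_cov H s s + 2 * x * y * fbm_cov H s t + y ^+ 2 * fbm_cov H t t.
Proof.
move=> s0 t0.
have := hB (fun=> i) (tm := fun j : 'I_2 => if (j : nat) == 0%N then s else t)
  (fun j : 'I_2 => if (j : nat) == 0%N then x else y).
have tm0 : forall j : 'I_2, 0 <= (if (j : nat) == 0%N then s else t).
  by move=> j; case: ifP.
move=> /(_ tm0)/gaussian_moment2[Z2 ZI]; rewrite (integral_sqrE Z2) in ZI.
move: Z2 ZI; rewrite (_ : (fun w => _) = fun w => x * BH i s w + y * BH i t w); last first.
  by apply/funext => w; rewrite !big_ord_recl big_ord0 /= addr0.
move=> Z2 [ZE]; split => //; move: ZE => ->.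
rewrite !big_ord_recl !big_ord0 /= !eqxx (fbm_covC t s); ring.
Qed.

Lemma fBm_L2 i t : 0 <= t -> L2 (BH i t).
Proof.
move=> t0; have [+ _] := fBm_comb i 1 0 t0 t0; congr (L2 _).
by apply/funext => w; rewrite mul1r mul0r addr0.
Qed.

Lemma fBm_ip i s t : 0 <= s -> 0 <= t -> ip (BH i s) (BH i t) = fbm_cov H s t.
Proof.
move=> s0 t0; have Ls := fBm_L2 i s0; have Lt := fBm_L2 i t0.
have [_] := fBm_comb i 1 1 s0 t0.
have [_] := fBm_comb i 1 0 s0 s0.
have [_] := fBm_comb i 1 0 t0 t0.
rewrite !nrm_sqr.
have E u : (fun w => 1 * BH i u w + 0 * BH i u w) = BH i u.
  by apply/funext => w; rewrite mul1r mul0r addr0.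
have E2 : (fun w => 1 * BH i s w + 1 * BH i t w) = fun w => BH i s w + BH i t w.
  by apply/funext => w; rewrite !mul1r.
rewrite !E E2 ipDl ?ipDr//; last exact: L2D.
by rewrite (ipC P (BH i t)) => ? ? ?; lra.
Qed.

Lemma frac_sum_L2 a t m i : 0 <= t -> L2 (frac_sum BH a t m i).
Proof.
move=> t0; rewrite /frac_sum.
apply: (L2_sum (index_enum 'I_m) (F := fun (j : 'I_m) w => (t - j%:R * t / m%:R) `^ (a - 1) *
     (BH i (j.+1%:R * t / m%:R) w - BH i (j%:R * t / m%:R) w))) => j.
by apply: L2Z; apply: L2B; apply: fBm_L2; rewrite divr_ge0 ?mulr_ge0.
Qed.

Variable a : R.
Hypothesis a01 : 0 < a < 1.
Hypothesis aH : a = 2 - 2 * H.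

Lemma fBm_incr_ip i (dl : R) (j l : nat) : 0 < dl ->
  ip (fun w => BH i (j.+1%:R * dl) w - BH i (j%:R * dl) w)
     (fun w => BH i (l.+1%:R * dl) w - BH i (l%:R * dl) w) =
  dl `^ (2 - a) * fgn_cov a ((j - l) + (l - j)).
Proof.
move=> dl0; have L n : L2 (BH i (n%:R * dl)).
  by apply: fBm_L2; rewrite mulr_ge0// ltW.
rewrite ipBl ?ipBr//; [|exact: L2B..].
have nn n : 0 <= n%:R * dl by rewrite mulr_ge0// ltW.
rewrite !fBm_ip// /fbm_cov.
have H2 : 2 * H = 2 - a by rewrite aH; ring.
rewrite H2.
have dist (m n : nat) : `|m%:R * dl - n%:R * dl| `^ (2 - a) =
    dl `^ (2 - a) * `|m%:R - n%:R| `^ (2 - a).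
  by rewrite -mulrBl normrM (gtr0_norm dl0) powRM// ?(ltW dl0)// mulrC.
rewrite !dist /fgn_cov.
wlog jl : j l / (l <= j)%N => [wl|].
  have [lj|jl] := leP l j; first exact: wl.
  rewrite addnC -(wl _ _ (ltnW jl)) (distrC l.+1%:R) (distrC l.+1%:R j%:R).
  by rewrite (distrC l%:R) (distrC l%:R j%:R); ring.
have -> : ((j - l) + (l - j) = j - l)%N by lia.
have e1 : `|j.+1%:R - l.+1%:R| = (j - l)%:R :> R.
  by rewrite -(natrB R (_ : (l.+1 <= j.+1)%N))// subSS ger0_norm.
have e2 : `|j%:R - l%:R| = (j - l)%:R :> R.
  by rewrite -(natrB R jl) ger0_norm.
have e3 : `|j.+1%:R - l%:R| = (j - l).+1%:R :> R.
  by rewrite -(natrB R (_ : (l <= j.+1)%N)) ?leqW// subSn// ger0_norm.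
have e4 : `|j%:R - l.+1%:R| = `|(j - l)%:R - 1| :> R.
  by rewrite (natrB R jl) -natr1; congr `|_|; ring.
by rewrite e1 e2 e3 e4; field.
Qed.

Lemma frac_sum_mesh (dl : R) (Q : nat) i w :
  frac_sum BH a (Q%:R * dl) Q i w = \sum_(j < Q) ((Q - j)%:R * dl) `^ (a - 1) *
    (BH i (j.+1%:R * dl) w - BH i (j%:R * dl) w).
Proof.
rewrite /frac_sum; apply: eq_bigr => j _.
have Q0 : Q%:R != 0 :> R by rewrite pnatr_eq0; have := ltn_ord j; lia.
have E (x : R) : x * (Q%:R * dl) / Q%:R = x * dl by field.
by rewrite !E -mulrBl natrB// ltnW.
Qed.

Lemma frac_sum_ip i (dl : R) (p q : nat) : 0 < dl ->
  ip (frac_sum BH a (p%:R * dl) p i) (frac_sum BH a (q%:R * dl) q i) =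
  dl `^ a * fsum_cov a p q.
Proof.
move=> dl0.
pose I j w := BH i (j.+1%:R * dl) w - BH i (j%:R * dl) w.
have LI j : L2 (I j) by apply: L2B; apply: fBm_L2; rewrite mulr_ge0// ltW.
pose S n w := \sum_(j < n) ((n - j)%:R * dl) `^ (a - 1) * I j w.
have E n : frac_sum BH a (n%:R * dl) n i = S n.
  by apply/funext => w; exact: frac_sum_mesh.
have LT n (j : 'I_n) : L2 (fun w => ((n - j)%:R * dl) `^ (a - 1) * I j w) by exact: L2Z.
have LS n : L2 (S n) by exact: (L2_sum (index_enum 'I_n) (LT n)).
rewrite !E {1}/S (ip_suml (index_enum 'I_p) (LT p) (LS q)).
rewrite /fsum_cov mulr_sumr; apply: eq_bigr => j _.
rewrite ipZl// /S (ip_sumr (index_enum 'I_q) (LT q) (LI j)).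
rewrite !mulr_sumr; apply: eq_bigr => l _.
rewrite ipZr// fBm_incr_ip// !powRM ?ler0n ?(ltW dl0)//.
have -> : dl `^ a = dl `^ (a - 1) * dl `^ (a - 1) * dl `^ (2 - a).
  by rewrite -!powRD_gt0//; congr (_ `^ _); ring.
by ring.
Qed.

Variables (kap T : R) (i : 'I_d) (g : R -> Omega -> R).
Hypothesis mg : forall t, 0 <= t <= T -> measurable_fun setT (g t).
Hypothesis cg : forall t, 0 <= t <= T -> (fun m : nat => (\int[P]_w
  ((g t w - kap * frac_sum BH a t m i w) ^+ 2)%:E)%E) @ \oo --> 0%E.

Lemma frac_noise_L2 t : 0 <= t <= T -> L2 (g t).
Proof.
move=> tT; have /fine_cvgP[[N _ hN] _] := cg tT.
have t0 : 0 <= t by case/andP: tT.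
have LS := frac_sum_L2 a N i t0.
have fin := hN N (leqnn N).
have LD : L2 (fun w => g t w - kap * frac_sum BH a t N i w).
  apply: L2P.
    apply: measurable_funB; first exact: mg.
    by case: (L2Z kap LS).
  by rewrite ltey_eq fin.
have := L2D LD (L2Z kap LS); congr (L2 _).
by apply/funext => w; rewrite subrK.
Qed.

Lemma frac_noise_nrm t : 0 <= t <= T ->
  (fun m : nat => nrm (fun w => kap * frac_sum BH a t m i w - g t w)) @ \oo --> (0 : R).
Proof.
move=> tT; have /fine_cvgP[_ hc] := cg tT.
have t0 : 0 <= t by case/andP: tT.
have Lg := frac_noise_L2 tT.
apply/cvgn_distP => e e0.
have e2 : 0 < e ^+ 2 by rewrite exprn_gt0.
have [N hN] := (cvgn_distP _ _).1 hc _ e2; exists N => n Nn.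
have LS := L2Z kap (frac_sum_L2 a n i t0).
have := hN n Nn; rewrite /= !subr0 integral_sqrE/=; last exact: L2B.
rewrite ger0_norm ?sqr_ge0// ler_sqr ?nnegrE ?nrm_ge0 ?(ltW e0)//.
rewrite ger0_norm ?nrm_ge0// -nrmN; last exact: L2B.
by congr (_ <= _); congr (nrm _); apply/funext => w; rewrite opprB.
Qed.

Lemma frac_noise_ip (beta h : R) (p q : nat) : fgn_conv a @ \oo --> beta ->
  0 < h -> p%:R * h <= T -> (q <= p)%N ->
  ip (g (p%:R * h)) (g (q%:R * h)) = kap ^+ 2 * (beta / a) *
    ((p%:R * h) `^ a + (q%:R * h) `^ a - ((p - q)%:R * h) `^ a).
Proof.
move=> cb h0 pT qp; have a0 : 0 < a by case/andP: a01.
have tT (n : nat) : (n <= p)%N -> 0 <= n%:R * h <= T.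
  move=> np; rewrite mulr_ge0 ?(ltW h0)//=.
  by apply: le_trans pT; rewrite ler_pM2r// ler_nat.
have Lg n (np : (n <= p)%N) := frac_noise_L2 (tT n np).
have [q0|q0] := posnP q.
  rewrite q0 mul0r subn0 (powR0 (lt0r_neq0 a0)) addr0 subrr mulr0.
  have z0 : nrm (g 0) = 0.
    have := frac_noise_nrm (tT 0%N (leq0n p)); rewrite mul0r.
    rewrite (_ : (fun m => _) = fun=> nrm (g 0)).
      by move=> /(cvg_lim (@Rhausdorff R)); rewrite lim_cst.
    apply/funext => m; rewrite -[RHS]nrmN; last by have := Lg 0%N (leq0n p); rewrite mul0r.
    congr (nrm _); apply/funext => w.
    rewrite /frac_sum big1 ?mulr0 ?sub0r// => j _.
    have E (x : R) : x * 0 / m%:R = 0 by rewrite mulr0 mul0r.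
    by rewrite !E [X in _ * X]subrr mulr0.
  apply/eqP; rewrite -normr_le0; apply: le_trans (ip_le (Lg p (leqnn _)) _) _.
    by have := Lg 0%N (leq0n p); rewrite mul0r.
  by rewrite z0 mulr0.
have p0 : (0 < p)%N by exact: leq_trans qp.
pose S (n M : nat) w := kap * frac_sum BH a (n%:R * h) (n * M.+1) i w.
have LF n M : L2 (frac_sum BH a (n%:R * h) (n * M.+1) i).
  by apply: frac_sum_L2; rewrite mulr_ge0// ltW.
have LS n M : L2 (S n M) by exact: L2Z.
have Sc n : (0 < n)%N -> (n <= p)%N ->
    (fun M => nrm (fun w => S n M w - g (n%:R * h) w)) @ \oo --> (0 : R).
  move=> n0 np; have := frac_noise_nrm (tT n np) => /cvgn_distP hc.
  apply/cvgn_distP => e e0; have [N hN] := hc e e0; exists N => M NM.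
  by apply: hN; apply: (leq_trans NM); apply: leq_trans (leq_pmull _ n0); exact: leqW.
have lim1 := ip_cvg (Lg p (leqnn _)) (Lg q qp) (LS p) (LS q) (Sc p p0 (leqnn _)) (Sc q q0 qp).
have lim2 := fsum_cov_cvg (q := q) (t := p - q) a01 cb.
rewrite subnKC// in lim2.
have E M : ip (S p M) (S q M) = kap ^+ 2 * h `^ a *
    (M.+1%:R `^ (- a) * fsum_cov a (p * M.+1) (q * M.+1)).
  have M0 : 0 < M.+1%:R :> R by rewrite ltr0n.
  have hM : 0 < h / M.+1%:R by rewrite divr_gt0.
  have mesh (n : nat) : n%:R * h = (n * M.+1)%:R * (h / M.+1%:R).
    by rewrite natrM; field; rewrite gt_eqF.
  rewrite /S (ipZl kap (LF p M) (LS q M)) (ipZr kap (LF q M) (LF p M)).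
  rewrite (mesh p) (mesh q) frac_sum_ip// powRM ?invr_ge0 ?ler0n ?(ltW h0)//.
  rewrite -(powR_inv1 (ltW M0)) -powRrM mulN1r.
  by ring.
have lim3 : (fun M => ip (S p M) (S q M)) @ \oo --> kap ^+ 2 * h `^ a *
    (beta / a * (p%:R `^ a - (p - q)%:R `^ a + q%:R `^ a)).
  under eq_fun do rewrite E.
  by apply: cvgM => //; exact: cvg_cst.
have -> : ip (g (p%:R * h)) (g (q%:R * h)) = kap ^+ 2 * h `^ a *
    (beta / a * (p%:R `^ a - (p - q)%:R `^ a + q%:R `^ a)).
  by rewrite -(cvg_lim (@Rhausdorff R) lim1) (cvg_lim (@Rhausdorff R) lim3).
rewrite !powRM ?ler0n ?(ltW h0)//; ring.
Qed.

End FractionalNoise.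

Section SingularIntegrals.
Context {R : realType}.
Local Notation mu := (@lebesgue_measure R).
Implicit Types (a t u v h T : R) (f : R -> R).

Lemma uniform_continuity_itv T f : {within `[0, T], continuous f} ->
  forall e : R, 0 < e -> \forall dl \near (0 : R)^'+, forall x y,
    0 <= x <= T -> 0 <= y <= T -> `|x - y| <= dl -> `|f x - f y| <= e.
Proof.
move=> cf e e0.
have : compact (`[0, T]%classic : set R) by exact: segment_compact.
move=> /compact_near_coveringP cov.
have := cov _ (0 : R)^'+ (fun dl x => 0 <= x <= T -> forall y, 0 <= y <= T ->
  `|x - y| <= dl -> `|f x - f y| <= e) _.
move=> /(_ _) H.
suff /H : forall x, `[0, T]%classic x -> \forall x' \near x & dl \near (0 : R)^'+,
    0 <= x' <= T -> forall y, 0 <= y <= T -> `|x' - y| <= dl -> `|f x' - f y| <= e.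
  apply: filterS => dl h x y xT yT xy.
  have hx : `[0, T]%classic x by rewrite /= in_itv.
  exact: (h x hx xT y yT xy).
move=> x xT.
have /subspace_continuousP/(_ x xT) cx := cf.
have e2 : 0 < e / 2 by rewrite divr_gt0.
have /cvgrPdist_le/(_ _ e2) := cx.
move=> /nbhs_ballP[r /= r0 hr].
have r2 : 0 < r / 2 by rewrite divr_gt0.
exists (ball x (r / 2), [set dl | dl < r / 2]) => /=.
  split; first exact: nbhsx_ballx.
  exact: nbhs_right_lt.
move=> [z dl]/= [xz dlr] zT y yT zy.
have bz : ball x r z by apply: le_ball xz; lra.
have by_ : ball x r y.
  move: xz; rewrite /ball/= => xz.
  rewrite -(subrK z x) -addrA; apply: le_lt_trans (ler_normD _ _) _.
  by lra.
have hz := hr z bz; have hy := hr y by_.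
have {}hz : `|f x - f z| <= e / 2 by apply: hz; rewrite /= in_itv.
have {}hy : `|f x - f y| <= e / 2 by apply: hy; rewrite /= in_itv.
rewrite -(subrK (f x) (f z)) -addrA [leRHS]splitr.
by apply: le_trans (ler_normD _ _) _; apply: lerD => //; rewrite distrC.
Qed.

Lemma measurable_kernel a t (D : set R) : measurable_fun D (fun s => (t - s) `^ (a - 1)).
Proof.
apply: measurable_funTS.
apply: (@measurableT_comp _ _ _ _ _ _ (fun x : R => x `^ (a - 1)) _ (fun s : R => t - s)).
  exact: measurable_powR.
exact: measurable_funB.
Qed.

Lemma integral_kernel a t u v : 0 < a <= 1 -> u < v -> v <= t ->
  (\int[mu]_(s in `[u, v]) ((t - s) `^ (a - 1))%:E =
    (((t - u) `^ a - (t - v) `^ a) / a)%:E)%E.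
Proof.
move=> /andP[a0 a1] uv vt.
pose b (i : nat) : R := v - (v - u) / i.+2%:R.
have vu0 : 0 < v - u by rewrite subr_gt0.
have ub i : u < b i.
  rewrite /b ltrBrDr -ltrBrDl ltr_pdivrMr ?ltr0n// ltr_pMr// ltr1n//.
have bv i : b i < v by rewrite /b ltrBlDr ltrDl divr_gt0// ltr0n.
have bnd i j : (i <= j)%N -> b i <= b j.
  by move=> ij; rewrite /b lerD2l lerN2 ler_pM2l// lef_pV2 ?posrE ?ltr0n// ler_nat.
pose F (s : R) := - ((t - s) `^ a / a).
have dF (s : R) : s < t -> is_derive s (1 : R) F ((t - s) `^ (a - 1)).
  move=> st; have ts : 0 < t - s by rewrite subr_gt0.
  have h1 : is_derive s (1 : R) (fun s : R => t - s) (0 - 1) by apply: is_deriveB.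
  have h2 := @is_derive1_comp R (fun y => y `^ a) (fun s => t - s) s _ _ (is_derive1_powR a ts) h1.
  have h3 := is_deriveN (is_deriveM h2 (is_derive_cst (a^-1) s (1 : R))).
  apply: is_derive_eq h3 _.
  rewrite /= scaler0 add0r sub0r /GRing.scale/=; field.
  by rewrite gt_eqF.
have FTC i : (\int[mu]_(s in `[u, b i]) ((t - s) `^ (a - 1))%:E =
    (((t - u) `^ a - (t - b i) `^ a) / a)%:E)%E.
  rewrite (@continuous_FTC2 R (fun s => (t - s) `^ (a - 1)) F u (b i))//.
  - by rewrite -EFinB /F; congr EFin; field; rewrite gt_eqF.
  - apply: derivable_within_continuous => s; rewrite in_itv/= => /andP[_ sb].
    have st : 0 < t - s by rewrite subr_gt0; apply: le_lt_trans sb (lt_le_trans (bv i) vt).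
    have h1 : is_derive s (1 : R) (fun s : R => t - s) (0 - 1) by apply: is_deriveB.
    have h2 := @is_derive1_comp R (fun y => y `^ (a - 1)) (fun s => t - s) s _ _
      (is_derive1_powR (a - 1) st) h1.
    exact: ex_derive.
  - have cF : {within `[u, b i], continuous F}.
      apply: derivable_within_continuous => s; rewrite in_itv/= => /andP[_ sb].
      apply: ex_derive; apply: dF.
      exact: le_lt_trans sb (lt_le_trans (bv i) vt).
    have [c1 c2 c3] := (continuous_within_itvP F (ub i)).1 cF.
    split => // s; rewrite in_itv/= => /andP[_ sb]; apply: ex_derive; apply: dF.
    exact: lt_trans sb (lt_le_trans (bv i) vt).
  - move=> s; rewrite in_itv/= => /andP[_ sb]; rewrite derive1E; apply: derive_val.
    by apply: dF; exact: lt_trans sb (lt_le_trans (bv i) vt).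
have mk D := measurable_kernel a t D.
have U : \bigcup_i `[u, b i]%classic = `[u, v[%classic :> set R.
  apply/seteqP; split => s /=.
    move=> [i _]; rewrite /= !in_itv/= => /andP[-> sb] /=; exact: le_lt_trans sb (bv i).
  rewrite in_itv/= => /andP[us sv].
  pose x := (v - u) / (v - s).
  have vs : 0 < v - s by rewrite subr_gt0.
  have x0 : 0 <= x by rewrite divr_ge0 ?ltW.
  exists (Num.truncn x) => //=; rewrite in_itv/= us /=.
  have /andP[_ xn] := truncn_itv x0.
  rewrite /b lerBrDr -lerBrDl ler_pdivrMr ?ltr0n// mulrC -ler_pdivrMr//.
  by apply: le_trans (ltW xn) _; rewrite ler_nat.
have lim1 : (fun i => \int[mu]_(s in `[u, b i]) ((t - s) `^ (a - 1))%:E)%E @ \oo -->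
    (\int[mu]_(s in `[u, v[) ((t - s) `^ (a - 1))%:E)%E.
  rewrite -U; apply: ge0_nondecreasing_set_cvg_integral => //.
  - apply/nondecreasing_seqP => i; rewrite subsetEset => s /=; rewrite !in_itv/=.
    by move=> /andP[-> sb]/=; apply: le_trans sb (bnd _ _ _).
  - by move=> i; apply/measurable_EFinP; exact: mk.
  - by move=> i s _; rewrite lee_fin powR_ge0.
have lim2 : (fun i => \int[mu]_(s in `[u, b i]) ((t - s) `^ (a - 1))%:E)%E @ \oo -->
    (((t - u) `^ a - (t - v) `^ a) / a)%:E.
  under eq_fun do rewrite FTC.
  apply: cvg_EFin; first exact: nearW.
  apply: cvgM; last exact: cvg_cst.
  apply: cvgB; first exact: cvg_cst.
  apply/cvgn_distP => e e0.
  have c0 : (fun n : nat => (v - u) `^ a * n.+2%:R `^ (- a)) @ \oo --> ((v - u) `^ a * 0 : R).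
    apply: cvgM; first exact: cvg_cst.
    have := @powRN_natr_cvg0 R a a0.
    by rewrite -(cvg_shiftn 2); under eq_fun do rewrite addn2.
  rewrite mulr0 in c0; have [N hN] := (cvgn_distP _ _).1 c0 e e0.
  exists N => n Nn; apply: le_trans (hN n Nn); rewrite subr0.
  rewrite [leRHS]ger0_norm ?mulr_ge0 ?powR_ge0//.
  rewrite ger0_norm; last first.
    rewrite subr_ge0; apply: powR_le_mono; rewrite ?(ltW a0) ?subr_ge0//.
    by rewrite lerD2l lerN2 ltW.
  apply: le_trans (@powR_diff_le_powR R (t - b n) (t - v) a _ _ _) _.
  - by rewrite subr_ge0.
  - by rewrite lerD2l lerN2 ltW.
  - by rewrite a0.
  rewrite (_ : t - b n - (t - v) = (v - u) * n.+2%:R^-1); last by rewrite /b; ring.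
  rewrite powRM ?(ltW vu0) ?invr_ge0//.
  by rewrite -(powR_inv1 (ler0n R n.+2)) -powRrM mulN1r.
rewrite -integral_itv_bndo_bndc; last by apply/measurable_EFinP; exact: mk.
by rewrite -(cvg_lim (@ereal_hausdorff R) lim1) (cvg_lim (@ereal_hausdorff R) lim2).
Qed.

Lemma integrable_kernel a t u v : 0 < a <= 1 -> u < v -> v <= t ->
  mu.-integrable `[u, v] (fun s => ((t - s) `^ (a - 1))%:E).
Proof.
move=> a01 uv vt; apply/integrableP; split.
  by apply/measurable_EFinP; exact: measurable_kernel.
under eq_integral do rewrite gee0_abs ?lee_fin ?powR_ge0//.
by rewrite integral_kernel// ltry.
Qed.

Lemma integrable_kernelM a t u v f : 0 < a <= 1 -> u < v -> v <= t ->
  {within `[u, v], continuous f} ->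
  mu.-integrable `[u, v] (EFin \o (fun s => (t - s) `^ (a - 1) * f s)).
Proof.
move=> a01 uv vt cf.
have [M fM] : exists M : R, forall s, u <= s <= v -> `|f s| <= M.
  have : compact (f @` `[u, v]%classic) by apply: continuous_compact => //; exact: segment_compact.
  move=> /compact_bounded/pinfty_ex_gt0[M M0 hM]; exists M => s sv.
  by apply: hM; exists s => //=; rewrite in_itv.
apply: (le_integrable _ _ _ (integrableZl _ M (integrable_kernel a01 uv vt))) => //.
  apply/measurable_EFinP; apply: measurable_funM; first exact: measurable_kernel.
  exact: subspace_continuous_measurable_fun.
move=> s /=; rewrite in_itv/= => sv; rewrite lee_fin normrM mulrC normrM.
rewrite ler_wpM2r//; apply: le_trans (fM s sv) _; exact: ler_norm.
Qed.

Lemma kernel_cell_bound a t u v f (c e : R) : 0 < a <= 1 -> u < v -> v <= t ->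
  {within `[u, v], continuous f} -> (forall s, u <= s <= v -> `|f s - c| <= e) ->
  `|a * Rintegral mu `[u, v] (fun s => (t - s) `^ (a - 1) * f s) -
    ((t - u) `^ a - (t - v) `^ a) * c| <= e * ((t - u) `^ a - (t - v) `^ a).
Proof.
move=> a01 uv vt cf hf; have a0 : 0 < a by case/andP: a01.
have ik := integrable_kernel a01 uv vt.
have ikf := integrable_kernelM a01 uv vt cf.
have mI : measurable (`[u, v]%classic : set (measurableTypeR R)) by [].
have IK : Rintegral mu `[u, v] (fun s => (t - s) `^ (a - 1)) = ((t - u) `^ a - (t - v) `^ a) / a.
  by rewrite /Rintegral integral_kernel.
have ikc : mu.-integrable `[u, v] (EFin \o (fun s => c * (t - s) `^ (a - 1))).
  have := integrableZl mI c ik.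
  by apply: eq_integrable => // s _ /=; rewrite EFinM.
have ike : mu.-integrable `[u, v] (EFin \o (fun s => e * (t - s) `^ (a - 1))).
  have := integrableZl mI e ik.
  by apply: eq_integrable => // s _ /=; rewrite EFinM.
set W := (t - u) `^ a - (t - v) `^ a in IK *.
have -> : W * c = a * Rintegral mu `[u, v] (fun s => c * (t - s) `^ (a - 1)).
  by rewrite RintegralZl// IK; field; rewrite gt_eqF.
have -> : e * W = a * Rintegral mu `[u, v] (fun s => e * (t - s) `^ (a - 1)).
  by rewrite RintegralZl// IK; field; rewrite gt_eqF.
rewrite -mulrBr normrM (gtr0_norm a0) ler_pM2l// -RintegralB//.
have idf : mu.-integrable `[u, v] (EFin \o (fun s => (t - s) `^ (a - 1) * f s - c * (t - s) `^ (a - 1))).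
  have := integrableB mI ikf ikc.
  by apply: eq_integrable => // s _ /=; rewrite EFinB.
apply: le_trans (le_normr_Rintegral _ idf) _ => //.
apply: le_Rintegral => //.
  have := integrable_norm idf.
  by apply: eq_integrable => // s _ /=.
move=> s /=; rewrite in_itv/= => sv.
rewrite (mulrC c) -mulrBr normrM (ger0_norm (powR_ge0 _ _)) mulrC.
by rewrite ler_wpM2r ?powR_ge0// hf.
Qed.

Lemma kernel_riemann_bound a h T f (e : R) (n : nat) : 0 < a <= 1 -> 0 < h ->
  n%:R * h <= T -> {within `[0, T], continuous f} ->
  (forall x y, 0 <= x <= T -> 0 <= y <= T -> `|x - y| <= h -> `|f x - f y| <= e) ->
  `|a * Rintegral mu `[0, n%:R * h] (fun s => (n%:R * h - s) `^ (a - 1) * f s) -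
    \sum_(l < n) fweight h a (n - l.+1) * f (l%:R * h)| <= e * (n%:R * h) `^ a.
Proof.
move=> a01 h0 nT cf uf; have a0 : 0 < a by case/andP: a01.
have [->|n0] := posnP n.
  rewrite big_ord0 mul0r set_itv1 Rintegral_set1 mulr0 subr0 normr0.
  by rewrite powR0 ?gt_eqF// mulr0.
set t := n%:R * h.
have t0 : 0 < t by rewrite mulr_gt0// ltr0n.
have sub u v : 0 <= u -> v <= T -> {within `[u, v], continuous f}.
  move=> u0 vT; apply: continuous_subspaceW cf => s /=; rewrite !in_itv/= => /andP[us sv].
  by rewrite (le_trans u0 us) (le_trans sv vT).
have wE (l : nat) : (l < n)%N ->
    fweight h a (n - l.+1) = (t - l%:R * h) `^ a - (t - l.+1%:R * h) `^ a.
  move=> ln; rewrite /fweight -subSn// subSS /t -!mulrBl.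
  by rewrite !natrB// ltnW.
have main (l : nat) : (l <= n)%N ->
    `|a * Rintegral mu `[0, l%:R * h] (fun s => (t - s) `^ (a - 1) * f s) -
    \sum_(j < l) fweight h a (n - j.+1) * f (j%:R * h)| <= e * \sum_(j < l) fweight h a (n - j.+1).
  elim: l => [|l IH] ln.
    rewrite !big_ord0 mul0r set_itv1 Rintegral_set1 mulr0 subr0 normr0 mulr0//.
  rewrite !big_ord_recr/= mulrDr.
  set u := l%:R * h in IH *; set v := l.+1%:R * h.
  have u0 : 0 <= u by rewrite mulr_ge0// ltW.
  have uv : u < v by rewrite ltr_pM2r// ltr_nat.
  have vt : v <= t by rewrite ler_pM2r// ler_nat.
  have vT : v <= T := le_trans vt nT.
  have v0 : 0 < v := le_lt_trans u0 uv.
  have iv : mu.-integrable `[0, v] (EFin \o (fun s => (t - s) `^ (a - 1) * f s)).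
    by apply: integrable_kernelM => //; exact: sub.
  have iuv : mu.-integrable `[u, v] (EFin \o (fun s => (t - s) `^ (a - 1) * f s)).
    by apply: integrable_kernelM => //; exact: sub.
  have split : Rintegral mu `[0, v] (fun s => (t - s) `^ (a - 1) * f s) =
     Rintegral mu `[0, u] (fun s => (t - s) `^ (a - 1) * f s) +
     Rintegral mu `[u, v] (fun s => (t - s) `^ (a - 1) * f s).
    rewrite -(Rintegral_itv_obnd_cbnd (r := u)); last first.
      apply: integrableS iuv => //.
      by apply: subset_itvr; rewrite bnd_simp.
    rewrite -(@Rintegral_itvB R _ (BLeft 0) (BRight v) u)//.
      by rewrite [RHS]addrC subrK.
    by rewrite bnd_simp ltW.
  rewrite split mulrDr opprD addrACA.
  apply: le_trans (ler_normD _ _) _; apply: lerD; first exact: IH (ltnW ln).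
  rewrite (wE l ln); apply: kernel_cell_bound => //; first exact: sub.
  move=> s /andP[us sv]; apply: uf.
  - by rewrite (le_trans u0 us) (le_trans sv vT).
  - by rewrite u0 (le_trans (ltW uv) vT).
  - rewrite ger0_norm ?subr_ge0// lerBlDr; apply: le_trans sv _.
    by rewrite /v /u -natr1; lra.
have := main n (leqnn n); rewrite -/t.
by rewrite (sum_rev (fweight h a)) sum_fweight// gt_eqF.
Qed.

Lemma GammaS a : 0 < a <= 1 -> Gamma (1 + a) = a * Gamma a.
Proof.
move=> /andP[a0 a1].
pose f1 (s : R) := s `^ a * expR (- s).
pose f2 (s : R) := s `^ (a - 1) * expR (- s).
have G1 : Gamma (1 + a) = fine (\int[mu]_(s in `[0%R, +oo[) (f1 s)%:E)%E.
  by rewrite /Gamma /Rintegral (_ : 1 + a - 1 = a)//; ring.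
have G2 : Gamma a = fine (\int[mu]_(s in `[0%R, +oo[) (f2 s)%:E)%E by [].
have mf p D : measurable_fun D (fun s : R => s `^ p * expR (- s)).
  apply: measurable_funTS; apply: measurable_funM; first exact: measurable_powR.
  by apply: measurableT_comp => //; exact: measurable_expR.
pose l (i : nat) : R := i.+2%:R^-1; pose r (i : nat) : R := i.+2%:R.
have l0 i : 0 < l i by rewrite invr_gt0 ltr0n.
have lr i : l i < r i.
  apply: (@lt_trans _ _ 1); first by rewrite invf_lt1 ?ltr0n// ltr1n.
  by rewrite ltr1n.
have U : \bigcup_i `[l i, r i]%classic = `]0%R, +oo[%classic :> set R.
  apply/seteqP; split => s /=.
    by move=> [i _] /=; rewrite !in_itv/= andbT => /andP[ls _]; exact: lt_le_trans ls.
  rewrite in_itv/= andbT => s0.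
  exists (maxn (Num.truncn s) (Num.truncn s^-1)) => //=; rewrite in_itv/=; apply/andP; split.
    rewrite /l -[leRHS]invrK lef_pV2 ?posrE ?invr_gt0 ?ltr0n//.
    have si0 : 0 <= s^-1 by rewrite invr_ge0 ltW.
    have /andP[_ /ltW/le_trans] := truncn_itv si0.
    by apply; rewrite ler_nat; apply: leqW; rewrite ltnS leq_maxr.
  have /andP[_ /ltW/le_trans] := truncn_itv (ltW s0).
  by apply; rewrite ler_nat; apply: leqW; rewrite ltnS leq_maxl.
have lim p : (fun i => \int[mu]_(s in `[l i, r i]) (s `^ p * expR (- s))%:E)%E @ \oo -->
    (\int[mu]_(s in `[0%R, +oo[) (s `^ p * expR (- s))%:E)%E.
  rewrite -integral_itv_obnd_cbnd; last by apply/measurable_EFinP; exact: mf.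
  rewrite -U; apply: ge0_nondecreasing_set_cvg_integral => //.
  - apply/nondecreasing_seqP => i; rewrite subsetEset => s /=; rewrite !in_itv/=.
    move=> /andP[ls sr]; apply/andP; split.
      by apply: le_trans ls; rewrite /l lef_pV2 ?posrE ?ltr0n// ler_nat.
    by apply: le_trans sr _; rewrite /r ler_nat.
  - by move=> i; apply/measurable_EFinP; exact: mf.
  - by move=> i s _; rewrite lee_fin mulr_ge0 ?powR_ge0 ?expR_ge0.
have dexp (s : R) : is_derive s (1 : R) (fun s : R => expR (- s)) (- expR (- s)).
  have h1 : is_derive s (1 : R) (fun s : R => - s) (- 1) by apply: is_deriveN.
  have := @is_derive1_comp R expR (fun s => - s) s _ _ (is_derive_expR (- s)) h1.
  by rewrite mulrN1.
have dp p (s : R) : 0 < s -> is_derive s (1 : R) (fun s : R => s `^ p * expR (- s))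
    (p * s `^ (p - 1) * expR (- s) - s `^ p * expR (- s)).
  move=> s0; apply: is_derive_eq (is_deriveM (is_derive1_powR p s0) (dexp s)) _.
  by rewrite /GRing.scale/=; ring.
have cp p i : {within `[l i, r i], continuous (fun s : R => s `^ p * expR (- s))}.
  apply: derivable_within_continuous => s; rewrite in_itv/= => /andP[ls _].
  by apply: ex_derive; apply: dp; exact: lt_le_trans ls.
have ip p i : mu.-integrable `[l i, r i] (fun s => (s `^ p * expR (- s))%:E).
  by apply: continuous_compact_integrable => //; exact: segment_compact.
have mI i : measurable (`[l i, r i]%classic : set (measurableTypeR R)) by [].
pose dd i := f1 (r i) - f1 (l i).
have FTC i : (a%:E * \int[mu]_(s in `[l i, r i]) (f2 s)%:E =
    \int[mu]_(s in `[l i, r i]) (f1 s)%:E + (dd i)%:E)%E.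
  have : (\int[mu]_(s in `[l i, r i]) (a * f2 s - f1 s)%:E = (f1 (r i))%:E - (f1 (l i))%:E)%E.
    apply: continuous_FTC2 => //.
    - have -> : (fun s => a * f2 s - f1 s) = (fun s => a *: f2 s - f1 s) by [].
      move=> s; apply: cvgB; last exact: cp.
      by apply: cvgZr; exact: cp.
    - have [c1 c2 c3] := (continuous_within_itvP f1 (lr i)).1 (cp a i).
      split => // s; rewrite in_itv/= => /andP[ls _]; apply: ex_derive; apply: dp.
      exact: lt_trans ls.
    - move=> s; rewrite in_itv/= => /andP[ls _]; rewrite derive1E.
      have := dp a s (lt_trans (l0 i) ls) => /(@derive_val _ _ _ _ _ _ _).
      by rewrite /f1 /f2 => ->; rewrite mulrA.
  under eq_integral do rewrite EFinB EFinM.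
  rewrite integralB//=; [|exact: (integrableZl (mI i) a (ip (a - 1) i))|exact: (ip a i)].
  rewrite integralZl//; last exact: (ip (a - 1) i).
  have /fineK <- := integrable_fin_num (mI i) (ip a i).
  have /fineK <- := integrable_fin_num (mI i) (ip (a - 1) i).
  rewrite -!EFinM -!EFinB -!EFinD => -[E]; congr EFin; rewrite /dd -E; ring.
have dd0 : dd @ \oo --> (0 : R).
  have c4 : (fun i : nat => (4 : R) * i.+2%:R `^ (-1) + i.+2%:R `^ (- a)) @ \oo --> (4 * 0 + 0 : R).
    apply: cvgD.
      apply: cvgM; first exact: cvg_cst.
      have := @powRN_natr_cvg0 R 1 ltr01.
      by rewrite -(cvg_shiftn 2); under eq_fun do rewrite addn2.
    have := @powRN_natr_cvg0 R a a0.
    by rewrite -(cvg_shiftn 2); under eq_fun do rewrite addn2.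
  rewrite mulr0 addr0 in c4.
  apply/cvgn_distP => e e0; have [N hN] := (cvgn_distP _ _).1 c4 e e0.
  exists N => i Ni; apply: le_trans (hN i Ni); rewrite !subr0.
  rewrite [leRHS]ger0_norm ?addr_ge0 ?mulr_ge0 ?powR_ge0//.
  apply: le_trans (ler_normB _ _) _; apply: lerD.
    rewrite /f1 ger0_norm ?mulr_ge0 ?powR_ge0 ?expR_ge0// -/(r i).
    have r0 : 0 < r i := lt_trans (l0 i) (lr i).
    rewrite powR_inv1 ?(ltW r0)// expRN ler_pdivrMr ?expR_gt0//.
    apply: (@le_trans _ _ (r i)).
      by apply: ler1_powR => //; rewrite ler1n.
    have h2 : (r i / 2) ^+ 2 <= expR (r i).
      rewrite {2}(splitr (r i)) expRD -expr2 ler_sqr ?nnegrE ?expR_ge0 ?divr_ge0 ?(ltW r0)//.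
      by apply: le_trans (expR_ge1Dx _); rewrite lerDr.
    have h3 : r i = 4 / r i * (r i / 2) ^+ 2 by field; rewrite gt_eqF.
    by rewrite {1}h3 ler_pM2l// divr_gt0.
  rewrite /f1 ger0_norm ?mulr_ge0 ?powR_ge0 ?expR_ge0//.
  rewrite /l -(powR_inv1 (ler0n R i.+2)) -powRrM mulN1r ler_piMr ?powR_ge0//.
have L1 := lim a; have L2 := lim (a - 1).
have L1' : (fun i => \int[mu]_(s in `[l i, r i]) (f1 s)%:E + (dd i)%:E)%E @ \oo -->
    (\int[mu]_(s in `[0%R, +oo[) (f1 s)%:E + 0%:E)%E.
  apply: cvgeD => //; first by rewrite fin_num_adde_defl.
  by apply: cvg_EFin; [exact: nearW | exact: dd0].
have L2' : (fun i => a%:E * \int[mu]_(s in `[l i, r i]) (f2 s)%:E)%E @ \oo -->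
    (a%:E * \int[mu]_(s in `[0%R, +oo[) (f2 s)%:E)%E.
  by apply: cvgeZl.
have E : (a%:E * \int[mu]_(s in `[0%R, +oo[) (f2 s)%:E =
    \int[mu]_(s in `[0%R, +oo[) (f1 s)%:E)%E.
  rewrite -[RHS]adde0 -(cvg_lim (@ereal_hausdorff R) L1') -(cvg_lim (@ereal_hausdorff R) L2').
  have -> : (fun i => a%:E * \int[mu]_(s in `[l i, r i]) (f2 s)%:E)%E =
      (fun i => \int[mu]_(s in `[l i, r i]) (f1 s)%:E + (dd i)%:E)%E.
    by apply/funext => i; exact: FTC.
  by [].
rewrite G1 G2 -E.
have : (0 <= \int[mu]_(s in `[0%R, +oo[) (f2 s)%:E)%E.
  by apply: integral_ge0 => s _; rewrite lee_fin mulr_ge0 ?powR_ge0 ?expR_ge0.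
case: (\int[mu]_(s in _) _)%E => [x _|_|] //=.
by rewrite gt0_muley ?lte_fin// mulr0.
Qed.

End SingularIntegrals.

Section VectorNorm.
Context {dT : measure_display} {Omega : measurableType dT} {R : realType}.
Variable P : probability Omega R.
Context {d : nat}.
Implicit Types (V W : Omega -> 'cV[R]_d) (B : 'M[R]_d).

Definition L2v V := forall i, L2 P (fun w => V w i 0).

Definition vnrm V : R := \sum_(i < d) nrm P (fun w => V w i 0).

Definition mx_norm1 B : R := \sum_(i < d) \sum_(j < d) `|B i j|.

Lemma vnrm_ge0 V : 0 <= vnrm V.
Proof. by apply: sumr_ge0 => i _; exact: nrm_ge0. Qed.

Lemma mx_norm1_ge0 B : 0 <= mx_norm1 B.
Proof. by do 2 apply: sumr_ge0 => ? _. Qed.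

Lemma L2vD V W : L2v V -> L2v W -> L2v (fun w => V w + W w).
Proof.
move=> V2 W2 i; have := L2D (V2 i) (W2 i); congr L2.
by apply/funext => w; rewrite mxE.
Qed.

Lemma L2vZ c V : L2v V -> L2v (fun w => c *: V w).
Proof.
move=> V2 i; have := L2Z c (V2 i); congr L2.
by apply/funext => w; rewrite mxE.
Qed.

Lemma L2vB V W : L2v V -> L2v W -> L2v (fun w => V w - W w).
Proof.
move=> V2 W2 i; have := L2B (V2 i) (W2 i); congr L2.
by apply/funext => w; rewrite !mxE.
Qed.

Lemma L2v_sum (I : Type) (r : seq I) (F : I -> Omega -> 'cV[R]_d) : (forall i, L2v (F i)) ->
  L2v (fun w => \sum_(i <- r) F i w).
Proof.
move=> F2 i; have := L2_sum r (fun j => F2 j i); congr L2.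
by apply/funext => w; rewrite summxE.
Qed.

Lemma L2v_mul B V : L2v V -> L2v (fun w => B *m V w).
Proof.
move=> V2 i.
have := L2_sum (index_enum 'I_d) (fun j => L2Z (B i j) (V2 j)); congr L2.
by apply/funext => w; rewrite mxE.
Qed.

Lemma vnrmD V W : L2v V -> L2v W -> vnrm (fun w => V w + W w) <= vnrm V + vnrm W.
Proof.
move=> V2 W2; rewrite /vnrm -big_split/=; apply: ler_sum => i _.
apply: le_trans (nrmD (V2 i) (W2 i)); rewrite le_eqVlt; apply/orP; left; apply/eqP.
by congr nrm; apply/funext => w; rewrite mxE.
Qed.

Lemma vnrmZ c V : L2v V -> vnrm (fun w => c *: V w) = `|c| * vnrm V.
Proof.
move=> V2; rewrite /vnrm mulr_sumr; apply: eq_bigr => i _; rewrite -nrmZ//.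
by congr nrm; apply/funext => w; rewrite mxE.
Qed.

Lemma vnrmN V : L2v V -> vnrm (fun w => - V w) = vnrm V.
Proof.
move=> V2; rewrite -[RHS]mul1r -(normr1 R) -normrN -vnrmZ//.
by congr vnrm; apply/funext => w; rewrite scaleN1r.
Qed.

Lemma vnrmB V W : L2v V -> L2v W -> vnrm (fun w => V w - W w) <= vnrm V + vnrm W.
Proof.
move=> V2 W2; rewrite -(vnrmN W2); apply: vnrmD => //.
have := L2vZ (-1) W2; congr L2v; apply/funext => w; exact: scaleN1r.
Qed.

Lemma vnrm_sum (I : Type) (r : seq I) (F : I -> Omega -> 'cV[R]_d) : (forall i, L2v (F i)) ->
  vnrm (fun w => \sum_(i <- r) F i w) <= \sum_(i <- r) vnrm (F i).
Proof.
move=> F2; rewrite /vnrm exchange_big/=; apply: ler_sum => i _.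
apply: le_trans (nrm_sum r (fun j => F2 j i)); rewrite le_eqVlt; apply/orP; left; apply/eqP.
by congr nrm; apply/funext => w; rewrite summxE.
Qed.

Lemma vnrm_mul B V : L2v V -> vnrm (fun w => B *m V w) <= mx_norm1 B * vnrm V.
Proof.
move=> V2; rewrite /mx_norm1 mulr_suml; apply: ler_sum => i _.
rewrite (_ : (fun w => _) = fun w => \sum_(j < d) B i j * V w j 0); last first.
  by apply/funext => w; rewrite mxE.
apply: le_trans (nrm_sum _ (fun j => L2Z (B i j) (V2 j))) _.
rewrite mulr_suml; apply: ler_sum => j _; rewrite nrmZ// ler_wpM2l//.
by rewrite /vnrm (bigD1 j)//= lerDl; apply: sumr_ge0 => k _; exact: nrm_ge0.
Qed.

Lemma vnrm_eq V W : V =1 W -> vnrm V = vnrm W.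
Proof. by move=> /funext ->. Qed.

Lemma L2v_eq V W : V =1 W -> L2v V -> L2v W.
Proof. by move=> /funext ->. Qed.

Lemma vnrm0 : vnrm (fun=> 0) = 0.
Proof.
rewrite /vnrm big1// => i _; rewrite -[RHS](nrm0 P); congr nrm.
by apply/funext => w; rewrite mxE.
Qed.

Lemma msq_le V : L2v V -> (msq P V <= (vnrm V ^+ 2)%:E)%E.
Proof.
move=> V2; rewrite /msq.
have -> : (\int[P]_w (\sum_(i < d) V w i 0 ^+ 2)%:E =
    (\sum_(i < d) nrm P (fun w => V w i 0) ^+ 2)%:E)%E.
  under eq_integral do rewrite -sumEFin.
  rewrite ge0_integral_sum//; last 2 first.
  - by move=> i; case: (V2 i) => mV _; apply/measurable_EFinP; exact: measurable_funX.
  - by move=> i w _; rewrite lee_fin sqr_ge0.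
  by rewrite -sumEFin; apply: eq_bigr => i _; rewrite integral_sqrE.
rewrite lee_fin /vnrm.
elim: (index_enum _) => [|i r IH]; first by rewrite !big_nil expr0n.
rewrite !big_cons sqrrD; apply: le_trans (lerD (lexx _) IH) _.
rewrite addrAC lerDl mulrn_wge0// mulr_ge0 ?nrm_ge0//.
by apply: sumr_ge0 => j _; exact: nrm_ge0.
Qed.

End VectorNorm.

Section FractionalHolder.
Context {dT : measure_display} {Omega : measurableType dT} {R : realType}.
Variable P : probability Omega R.
Context {d : nat}.
Variables (a h : R).
Hypotheses (a0 : 0 < a) (h0 : 0 < h).
Local Notation fw := (fweight h a).

Definition frac_conv (Z : nat -> Omega -> 'cV[R]_d) (n : nat) (w : Omega) : 'cV[R]_d :=
  \sum_(l < n) fw (n - l.+1) *: Z l w.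

Lemma frac_conv_L2v (Z : nat -> Omega -> 'cV[R]_d) n : (forall l, (l < n)%N -> L2v P (Z l)) ->
  L2v P (frac_conv Z n).
Proof.
move=> Z2; have LT (l : 'I_n) : L2v P (fun w => fw (n - l.+1) *: Z l w).
  by apply: L2vZ; exact: Z2.
exact: (L2v_sum (index_enum 'I_n) LT).
Qed.

Lemma frac_conv_cst (V : Omega -> 'cV[R]_d) n w :
  frac_conv (fun=> V) n w = (n%:R * h) `^ a *: V w.
Proof.
rewrite -(sum_fweight h n (lt0r_neq0 a0)) -(sum_rev fw n) /frac_conv.
by rewrite scaler_suml.
Qed.

Lemma frac_convDn (Z : nat -> Omega -> 'cV[R]_d) (p q : nat) w :
  frac_conv Z (p + q) w = \sum_(l < p) fw ((p - l.+1) + q) *: Z l w +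
    \sum_(l < q) fw (q - l.+1) *: Z (p + l)%N w.
Proof.
rewrite /frac_conv big_split_ord/=; congr (_ + _); apply: eq_bigr => l _.
  by congr (fw _ *: _); have := ltn_ord l; lia.
by congr (fw _ *: _); lia.
Qed.

Lemma frac_convB_eq (Z : nat -> Omega -> 'cV[R]_d) (p q : nat) w :
  frac_conv Z (p + q) w - frac_conv Z p w =
  (((p + q)%:R * h) `^ a - (p%:R * h) `^ a) *: Z p w +
  (\sum_(l < q) fw (q - l.+1) *: (Z (p + l)%N w - Z p w) -
   \sum_(l < p) (fw (p - l.+1) - fw ((p - l.+1) + q)) *: (Z l w - Z p w)).
Proof.
rewrite scalerBl -!frac_conv_cst !frac_convDn /frac_conv.
have -> : \sum_(l < q) fw (q - l.+1) *: (Z (p + l)%N w - Z p w) =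
   \sum_(l < q) fw (q - l.+1) *: Z (p + l)%N w - \sum_(l < q) fw (q - l.+1) *: Z p w.
  by rewrite -sumrB; apply: eq_bigr => l _; rewrite scalerBr.
have -> : \sum_(l < p) (fw (p - l.+1) - fw ((p - l.+1) + q)) *: (Z l w - Z p w) =
   \sum_(l < p) fw (p - l.+1) *: Z l w - \sum_(l < p) fw (p - l.+1) *: Z p w
   - (\sum_(l < p) fw ((p - l.+1) + q) *: Z l w - \sum_(l < p) fw ((p - l.+1) + q) *: Z p w).
  by rewrite -!sumrB; apply: eq_bigr => l _; rewrite scalerBl !scalerBr.
set S1 := \sum_(l < p) _; set S2 := \sum_(l < q) _; set S3 := \sum_(l < p) _.
set S4 := \sum_(l < p) _; set S5 := \sum_(l < q) _; set S6 := \sum_(l < p) _.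
by apply/matrixP => i j; rewrite !mxE; ring.
Qed.

Lemma frac_conv_holder (Z : nat -> Omega -> 'cV[R]_d) (eta K : R) (L : nat) :
  0 <= eta -> a + eta < 1 -> 0 <= K ->
  (forall l, (l <= L)%N -> L2v P (Z l)) ->
  (forall l, (l <= L)%N -> vnrm P (Z l) <= K * (l%:R * h) `^ eta) ->
  (forall l m, (l <= m <= L)%N ->
     vnrm P (fun w => Z m w - Z l w) <= K * ((m - l)%:R * h) `^ eta) ->
  forall p n, (p <= n <= L)%N ->
    vnrm P (fun w => frac_conv Z n w - frac_conv Z p w) <=
    (3 + (1 - (a + eta))^-1) * K * ((n - p)%:R * h) `^ (a + eta).
Proof.
move=> eta0 ae K0 Z2 Zb Zh p n /andP[pn nL].
have ae0 : 0 < (1 - (a + eta))^-1 by rewrite invr_gt0 subr_gt0.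
have C0 : 0 <= 3 + (1 - (a + eta))^-1 by rewrite addr_ge0 ?ltW.
have [q0|q0] := posnP (n - p).
  have -> : n = p by apply/eqP; rewrite eqn_leq pn andbT -subn_eq0 q0.
  rewrite (vnrm_eq P (W := fun=> 0)) ?vnrm0; last by move=> w; rewrite subrr.
  by rewrite !mulr_ge0 ?powR_ge0.
have nE := subnKC pn.
set q := (n - p)%N in q0 nE *.
set th := (q%:R * h) `^ (a + eta).
have qh : 0 < q%:R * h by rewrite mulr_gt0// ltr0n.
have fw0 m : 0 <= fw m by rewrite fweight_ge0 ?ltW.
have pL := leq_trans pn nL.
have plL (l : 'I_q) : (p + l <= L)%N.
  by apply: leq_trans nL; rewrite -nE leq_add2l ltnW.
have lL (l : 'I_p) : (l <= L)%N by exact: ltnW (leq_trans (ltn_ord l) pL).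
have ZB (l m : nat) : (l <= L)%N -> (m <= L)%N -> L2v P (fun w => Z l w - Z m w).
  by move=> hl hm; apply: L2vB; exact: Z2.
pose A w := (((p + q)%:R * h) `^ a - (p%:R * h) `^ a) *: Z p w.
pose U w := \sum_(l < q) fw (q - l.+1) *: (Z (p + l)%N w - Z p w).
pose V w := \sum_(l < p) (fw (p - l.+1) - fw ((p - l.+1) + q)) *: (Z l w - Z p w).
have A2 : L2v P A by apply: L2vZ; exact: Z2.
have LU (l : 'I_q) : L2v P (fun w => fw (q - l.+1) *: (Z (p + l)%N w - Z p w)).
  by apply: L2vZ; exact: ZB.
have LV (l : 'I_p) : L2v P (fun w => (fw (p - l.+1) - fw ((p - l.+1) + q)) *: (Z l w - Z p w)).
  by apply: L2vZ; exact: ZB.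
have U2 : L2v P U by exact: (L2v_sum (index_enum _) LU).
have V2 : L2v P V by exact: (L2v_sum (index_enum _) LV).
have bA : vnrm P A <= K * th.
  rewrite /A vnrmZ; last exact: Z2.
  rewrite ger0_norm; last first.
    rewrite subr_ge0; apply: powR_le_mono; rewrite ?(ltW a0) ?mulr_ge0 ?(ltW h0)//.
    by rewrite ler_pM2r// ler_nat leq_addr.
  have := @powR_incr_le_powR R (p%:R * h) (q%:R * h) a eta.
  rewrite -mulrDl -natrD mulr_ge0 ?(ltW h0)// => /(_ isT (ltW qh) a0 eta0 (ltW ae)) key.
  apply: le_trans (ler_wpM2l K0 key).
  apply: le_trans (ler_wpM2l _ (Zb p pL)) _.
    rewrite subr_ge0; apply: powR_le_mono; rewrite ?(ltW a0) ?mulr_ge0 ?(ltW h0)//.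
    by rewrite ler_pM2r// ler_nat leq_addr.
  by rewrite le_eqVlt; apply/orP; left; apply/eqP; ring.
have bU : vnrm P U <= K * th.
  apply: le_trans (vnrm_sum (index_enum _) LU) _.
  apply: (@le_trans _ _ (\sum_(l < q) fw (q - l.+1) * (K * (q%:R * h) `^ eta))).
    apply: ler_sum => l _; have lq := ltn_ord l.
    rewrite vnrmZ ?ger0_norm//; last exact: ZB.
    apply: ler_wpM2l => //.
    apply: le_trans (Zh p (p + l)%N _) _; first by rewrite leq_addr plL.
    apply: ler_wpM2l => //; apply: powR_le_mono => //; first by rewrite mulr_ge0 ?(ltW h0).
    by rewrite ler_pM2r// ler_nat addKn ltnW.
  rewrite -mulr_suml (sum_rev fw) sum_fweight ?gt_eqF// /th powRD_gt0//.
  by rewrite le_eqVlt; apply/orP; left; apply/eqP; ring.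
have bV : vnrm P V <= K * ((1 + (1 - (a + eta))^-1) * th).
  apply: le_trans (vnrm_sum (index_enum _) LV) _.
  have ae1 : 0 <= a <= 1 by rewrite (ltW a0)/=; lra.
  apply: (@le_trans _ _ (\sum_(l < p) (fw (p - l.+1) - fw ((p - l.+1) + q)) *
      (K * ((p - l.+1).+1%:R * h) `^ eta))).
    apply: ler_sum => l _; have lp := ltn_ord l.
    rewrite vnrmZ; last exact: ZB.
    rewrite ger0_norm; last by rewrite subr_ge0 fweight_anti// ltW.
    apply: ler_wpM2l; first by rewrite subr_ge0 fweight_anti// ltW.
    rewrite subnSK//.
    have -> : vnrm P (fun w => Z l w - Z p w) = vnrm P (fun w => Z p w - Z l w).
      rewrite -[RHS]vnrmN; last exact: ZB.
      by apply: vnrm_eq => w; rewrite opprB.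
    by apply: Zh; rewrite (ltnW lp) pL.
  rewrite (sum_rev (fun m => (fw m - fw (m + q)) * (K * (m.+1%:R * h) `^ eta)) p).
  rewrite (eq_bigr (fun m : 'I_p => K * ((fw m - fw (m + q)) * (m.+1%:R * h) `^ eta))); last first.
    by move=> m _; ring.
  by rewrite -mulr_sumr ler_wpM2l// sum_fweight_diff_le.
rewrite (vnrm_eq P (W := fun w => A w + (U w - V w))); last first.
  by move=> w; rewrite -nE frac_convB_eq.
apply: le_trans (vnrmD A2 (L2vB U2 V2)) _.
apply: le_trans (lerD (lexx _) (vnrmB U2 V2)) _.
apply: le_trans (lerD bA (lerD bU bV)) _.
by rewrite le_eqVlt; apply/orP; left; apply/eqP; ring.
Qed.

End FractionalHolder.

Section SchemeError.
Context {dT : measure_display} {Omega : measurableType dT} {R : realType}.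
Variable P : probability Omega R.
Context {d : nat}.
Variables (a T c c1 K : R) (B : 'M[R]_d) (x0 : Omega -> 'cV[R]_d).
Hypotheses (a01 : 0 < a < 1) (T0 : 0 < T) (c10 : 0 <= c1) (K0 : 0 < K).
Hypothesis x02 : L2v P x0.
Hypothesis gronwall : forall h (L : nat) (u : nat -> R) (A : R),
    0 < h -> L%:R * h <= T -> 0 <= A ->
    (forall n, (n <= L)%N ->
       u n <= A + `|c| * mx_norm1 B * \sum_(l < n) fweight h a (n - l.+1) * u l) ->
    forall n, (n <= L)%N -> u n <= K * A.

Let a0 : 0 < a. Proof. by case/andP: a01. Qed.
Let a1 : a < 1. Proof. by case/andP: a01. Qed.
Local Notation b := (mx_norm1 B).

(* Second-moment structure, on the grid of step [h], of a process whose
   components are multiples of fractional Brownian motion of Hurst index [a / 2]. *)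
Definition noise_grid (h : R) (L : nat) (g : nat -> Omega -> 'cV[R]_d) :=
  (forall n, (n <= L)%N -> L2v P (g n)) /\
  (forall i p q, (q <= p <= L)%N -> ip P (fun w => g p w i 0) (fun w => g q w i 0) =
     c1 * ((p%:R * h) `^ a + (q%:R * h) `^ a - ((p - q)%:R * h) `^ a)).

Definition is_scheme (h : R) (L : nat) (g Y : nat -> Omega -> 'cV[R]_d) :=
  forall n w, (n <= L)%N ->
    Y n w = x0 w + c *: frac_conv a h (fun l w => B *m Y l w) n w + g n w.

Definition noise_cst : R := d%:R * Num.sqrt (2 * c1).
Definition moment_cst : R := K * (vnrm P x0 + noise_cst * T `^ (a / 2)).
Definition drift_cst : R := `|c| * ((3 + (1 - a)^-1) * (2 * (b * moment_cst))).
Definition holder_gap : R := Num.min (a / 2) ((1 - a) / 2).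
Definition resid_cst : R := b * (drift_cst * T `^ (a - holder_gap) +
  noise_cst * T `^ (a / 2 - holder_gap)).
Definition resid_drift_cst : R := (3 + (1 - (a + holder_gap))^-1) * resid_cst.

Lemma noise_cst_ge0 : 0 <= noise_cst.
Proof. by rewrite mulr_ge0 ?sqrtr_ge0. Qed.

Lemma moment_cst_ge0 : 0 <= moment_cst.
Proof.
by rewrite mulr_ge0 ?(ltW K0)// addr_ge0 ?vnrm_ge0// mulr_ge0 ?noise_cst_ge0 ?powR_ge0.
Qed.

Lemma drift_cst_ge0 : 0 <= drift_cst.
Proof.
have h1 : 0 <= 1 - a by rewrite subr_ge0 ltW.
apply: mulr_ge0 => //; apply: mulr_ge0; first by rewrite addr_ge0 ?invr_ge0.
by apply: mulr_ge0 => //; exact: mulr_ge0 (mx_norm1_ge0 _) moment_cst_ge0.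
Qed.

Lemma holder_gap_bounds : [/\ 0 <= holder_gap, holder_gap <= a / 2 & a + holder_gap < 1].
Proof.
have h1 := a0; have h2 := a1; split.
- by rewrite le_min; apply/andP; split; lra.
- by rewrite ge_min lexx.
- have : holder_gap <= (1 - a) / 2 by rewrite ge_min lexx orbT.
  by move=> ?; lra.
Qed.

Lemma resid_cst_ge0 : 0 <= resid_cst.
Proof.
by rewrite mulr_ge0 ?mx_norm1_ge0// addr_ge0// mulr_ge0 ?powR_ge0 ?drift_cst_ge0 ?noise_cst_ge0.
Qed.

Lemma resid_drift_cst_ge0 : 0 <= resid_drift_cst.
Proof.
have [_ _ h] := holder_gap_bounds.
by rewrite mulr_ge0 ?resid_cst_ge0// addr_ge0// invr_ge0 subr_ge0 ltW.
Qed.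

Lemma powR_trade (x r s : R) : 0 <= x <= T -> s <= r -> 0 < r ->
  x `^ r <= T `^ (r - s) * x `^ s.
Proof.
move=> /andP[]; rewrite le_eqVlt => /orP[/eqP <- _ _ r0|x0' xT sr r0].
  by rewrite powR0 ?gt_eqF// mulr_ge0 ?powR_ge0.
have -> : x `^ r = x `^ (r - s) * x `^ s by rewrite -powRD_gt0// subrK.
rewrite ler_wpM2r ?powR_ge0//.
by apply: powR_le_mono; rewrite ?subr_ge0// ltW.
Qed.

Lemma frac_convD h (Z1 Z2 : nat -> Omega -> 'cV[R]_d) n w :
  frac_conv a h (fun l w => Z1 l w + Z2 l w) n w = frac_conv a h Z1 n w + frac_conv a h Z2 n w.
Proof.
by rewrite /frac_conv -big_split/=; apply: eq_bigr => l _; rewrite scalerDr.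
Qed.

Lemma frac_conv0 h (Z : nat -> Omega -> 'cV[R]_d) w : frac_conv a h Z 0 w = 0.
Proof. by rewrite /frac_conv big_ord0. Qed.

Section FineGrid.
Variables (h : R) (L : nat) (g Y : nat -> Omega -> 'cV[R]_d).
Hypotheses (h0 : 0 < h) (LT : L%:R * h <= T).
Hypotheses (hg : noise_grid h L g) (hY : is_scheme h L g Y).
Local Notation fw := (fweight h a).

Let nT n : (n <= L)%N -> 0 <= n%:R * h <= T.
Proof.
move=> nL; rewrite mulr_ge0 ?(ltW h0)//=.
by apply: le_trans LT; rewrite ler_pM2r// ler_nat.
Qed.

Let gi2 i n : (n <= L)%N -> L2 P (fun w => g n w i 0).
Proof. by move=> nL; have [g2 _] := hg; exact: g2. Qed.

Lemma noise_incr_nrm i l m : (l <= m <= L)%N ->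
  nrm P (fun w => g m w i 0 - g l w i 0) ^+ 2 = 2 * c1 * ((m - l)%:R * h) `^ a.
Proof.
move=> /andP[lm mL]; have lL := leq_trans lm mL; have [_ gc] := hg.
have gl := gi2 i lL; have gm := gi2 i mL.
rewrite nrm_sqr ipBl ?ipBr//; [|exact: L2B].
rewrite (ipC P (fun w => g l w i 0) (fun w => g m w i 0)).
rewrite !gc ?lm ?mL ?leqnn ?lL//= !subnn mul0r powR0 ?gt_eqF//.
by ring.
Qed.

Lemma noise_incr_vnrm l m : (l <= m <= L)%N ->
  vnrm P (fun w => g m w - g l w) = noise_cst * ((m - l)%:R * h) `^ (a / 2).
Proof.
move=> lmL; rewrite /vnrm /noise_cst.
have x0' : 0 <= (m - l)%:R * h by rewrite mulr_ge0// ltW.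
have E i : nrm P (fun w => (g m w - g l w) i 0) = Num.sqrt (2 * c1) * ((m - l)%:R * h) `^ (a / 2).
  have -> : (fun w => (g m w - g l w) i 0) = fun w => g m w i 0 - g l w i 0.
    by apply/funext => w; rewrite !mxE.
  rewrite -[LHS](ger0_norm (nrm_ge0 _ _)) -sqrtr_sqr noise_incr_nrm//.
  rewrite sqrtrM ?mulr_ge0//; congr (_ * _).
  by rewrite powRrM powR12_sqrt// powR_ge0.
rewrite (eq_bigr _ (fun i _ => E i)) sumr_const card_ord -[LHS]mulr_natl.
by rewrite mulrA.
Qed.

Lemma noise_vnrm n : (n <= L)%N -> vnrm P (g n) = noise_cst * (n%:R * h) `^ (a / 2).
Proof.
move=> nL; have := @noise_incr_vnrm 0 n nL; rewrite subn0 => <-.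
have g00 i : nrm P (fun w => g 0 w i 0) = 0.
  have [_ gc] := hg; apply/eqP; rewrite -sqrf_eq0 nrm_sqr gc//.
  have z : (0%:R * h) `^ a = 0 by rewrite mul0r powR0// gt_eqF.
  by rewrite subnn z; apply/eqP; ring.
apply: eq_bigr => i _; apply/eqP; rewrite eq_le; apply/andP; split.
  have -> : (fun w => g n w i 0) = fun w => (g n w i 0 - g 0 w i 0) + g 0 w i 0.
    by apply/funext => w; rewrite subrK.
  apply: le_trans (nrmD _ _) _; [by apply: L2B; exact: gi2|exact: gi2|].
  rewrite g00 addr0 le_eqVlt; apply/orP; left; apply/eqP; congr (nrm P _).
  by apply/funext => w; rewrite !mxE.
have -> : (fun w => (g n w - g 0 w) i 0) = fun w => g n w i 0 + (- g 0 w i 0).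
  by apply/funext => w; rewrite !mxE.
apply: le_trans (nrmD _ _) _; [exact: gi2|by apply: L2N; exact: gi2|].
by rewrite nrmN ?g00 ?addr0//; exact: gi2.
Qed.

(* Concavity of [x ^ a]: increments over disjoint intervals are negatively correlated. *)
Lemma noise_incr_negcorr i (p q r s : nat) : (p <= q)%N -> (q <= r)%N -> (r <= s)%N ->
  (s <= L)%N ->
  ip P (fun w => g q w i 0 - g p w i 0) (fun w => g s w i 0 - g r w i 0) <= 0.
Proof.
move=> pq qr rs sL; have rL := leq_trans rs sL; have qL := leq_trans qr rL.
have pL := leq_trans pq qL; have [_ gc] := hg.
rewrite ipBl ?ipBr//; try exact: gi2; try by apply: L2B; exact: gi2.
rewrite !(ipC P (fun w => g q w i 0)) !(ipC P (fun w => g p w i 0)).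
have ps := leq_trans pq (leq_trans qr rs).
rewrite !gc ?sL ?rL ?andbT//; try exact: leq_trans qr rs; try exact: leq_trans pq qr.
set xq := (q%:R * h) `^ a; set xp := (p%:R * h) `^ a.
set xs := (s%:R * h) `^ a; set xr := (r%:R * h) `^ a.
have h' := ltW h0.
have := @powR_concave4 R ((r - q)%:R * h) ((q - p)%:R * h) ((s - r)%:R * h) a.
rewrite -!mulrDl -!natrD !mulr_ge0// => /(_ isT isT isT).
have -> : (r - q + (q - p) + (s - r) = s - p)%N by lia.
have -> : (r - q + (q - p) = r - p)%N by lia.
have -> : (r - q + (s - r) = s - q)%N by lia.
rewrite (ltW a0) (ltW a1) => /(_ isT).
set y1 := ((s - p)%:R * h) `^ a; set y2 := ((r - q)%:R * h) `^ a.
set y3 := ((r - p)%:R * h) `^ a; set y4 := ((s - q)%:R * h) `^ a.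
move=> y; rewrite [leLHS](_ : _ = - (c1 * (y3 + y4 - (y1 + y2)))); last by ring.
by rewrite oppr_le0 mulr_ge0// subr_ge0.
Qed.

Lemma scheme_L2v n : (n <= L)%N -> L2v P (Y n).
Proof.
elim/ltn_ind: n => n IH nL.
have hc : L2v P (frac_conv a h (fun l w => B *m Y l w) n).
  apply: frac_conv_L2v => l ln; apply: L2v_mul; apply: IH => //.
  exact: ltnW (leq_trans ln nL).
have [g2 _] := hg.
apply: (@L2v_eq _ _ _ P _ (fun w => x0 w + c *: frac_conv a h (fun l w => B *m Y l w) n w + g n w)).
  by move=> w; rewrite hY.
apply: L2vD; last exact: g2.
by apply: L2vD => //; exact: L2vZ.
Qed.

Lemma vnrm_frac_conv_le (Z : nat -> Omega -> 'cV[R]_d) n : (forall l, (l < n)%N -> L2v P (Z l)) ->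
  vnrm P (frac_conv a h (fun l w => B *m Z l w) n) <=
    b * \sum_(l < n) fw (n - l.+1) * vnrm P (Z l).
Proof.
move=> Z2.
have LZ (l : 'I_n) : L2v P (fun w => fw (n - l.+1) *: (B *m Z l w)).
  by apply: L2vZ; apply: L2v_mul; exact: Z2.
apply: le_trans (vnrm_sum (index_enum 'I_n) LZ) _.
rewrite mulr_sumr; apply: ler_sum => l _.
rewrite vnrmZ; last by apply: L2v_mul; exact: Z2.
rewrite ger0_norm; last by rewrite fweight_ge0 ?(ltW h0) ?(ltW a0).
rewrite mulrCA ler_wpM2l ?fweight_ge0 ?(ltW h0) ?(ltW a0)//.
by apply: vnrm_mul; exact: Z2.
Qed.

Lemma scheme_vnrm n : (n <= L)%N -> vnrm P (Y n) <= moment_cst.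
Proof.
have [g2 _] := hg.
have A0 : 0 <= vnrm P x0 + noise_cst * T `^ (a / 2).
  by rewrite addr_ge0 ?vnrm_ge0// mulr_ge0 ?noise_cst_ge0 ?powR_ge0.
move: n; apply: (gronwall h0 LT A0) => n nL.
have Y2 l : (l < n)%N -> L2v P (Y l).
  by move=> ln; apply: scheme_L2v; exact: ltnW (leq_trans ln nL).
have hc : L2v P (frac_conv a h (fun l w => B *m Y l w) n).
  by apply: frac_conv_L2v => l ln; apply: L2v_mul; exact: Y2.
rewrite (vnrm_eq P (W := fun w => x0 w + c *: frac_conv a h (fun l w => B *m Y l w) n w + g n w)); last first.
  by move=> w; rewrite hY.
apply: le_trans (vnrmD (L2vD x02 (L2vZ c hc)) (g2 n nL)) _.
apply: le_trans (lerD (vnrmD x02 (L2vZ c hc)) (lexx _)) _.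
rewrite noise_vnrm// vnrmZ// addrAC; apply: lerD.
  rewrite lerD2l ler_wpM2l ?noise_cst_ge0//.
  have /andP[n0 nT'] := nT nL.
  by apply: powR_le_mono => //; rewrite divr_ge0// ltW.
by rewrite -mulrA ler_wpM2l// vnrm_frac_conv_le.
Qed.

Let Z l w := B *m Y l w.

Lemma scheme_mul_vnrm l : (l <= L)%N -> vnrm P (Z l) <= b * moment_cst.
Proof.
move=> lL; apply: le_trans (vnrm_mul B (scheme_L2v lL)) _.
by rewrite ler_wpM2l ?mx_norm1_ge0// scheme_vnrm.
Qed.

Lemma drift_holder p n : (p <= n <= L)%N ->
  vnrm P (fun w => c *: frac_conv a h Z n w - c *: frac_conv a h Z p w) <=
    drift_cst * ((n - p)%:R * h) `^ a.
Proof.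
move=> /andP[pn nL]; have pL := leq_trans pn nL.
have Z2 l : (l <= L)%N -> L2v P (Z l) by move=> lL; apply: L2v_mul; exact: scheme_L2v.
have I2 m : (m <= L)%N -> L2v P (frac_conv a h Z m).
  by move=> mL; apply: frac_conv_L2v => l lm; apply: Z2; exact: ltnW (leq_trans lm mL).
have bm0 : 0 <= b * moment_cst by rewrite mulr_ge0 ?mx_norm1_ge0 ?moment_cst_ge0.
have := @frac_conv_holder _ _ _ P d a h a0 h0 Z 0 (2 * (b * moment_cst)) L.
rewrite addr0 => H.
have {}H : vnrm P (fun w => frac_conv a h Z n w - frac_conv a h Z p w) <=
    (3 + (1 - a)^-1) * (2 * (b * moment_cst)) * ((n - p)%:R * h) `^ a.
  apply: H => //.
  - by rewrite mulr_ge0.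
  - move=> l lL; rewrite powRr0 mulr1.
    by apply: le_trans (scheme_mul_vnrm lL) _; lra.
  - move=> l m /andP[lm mL]; rewrite powRr0 mulr1.
    have lL := leq_trans lm mL.
    apply: le_trans (vnrmB (Z2 _ mL) (Z2 _ lL)) _.
    by have := scheme_mul_vnrm lL; have := scheme_mul_vnrm mL; lra.
  - by rewrite pn.
rewrite (vnrm_eq P (W := fun w => c *: (frac_conv a h Z n w - frac_conv a h Z p w))); last first.
  by move=> w; rewrite scalerBr.
rewrite vnrmZ; last by apply: L2vB; exact: I2.
by rewrite /drift_cst -mulrA ler_wpM2l.
Qed.

Let V l w := B *m (Y l w - x0 w).

Lemma resid_holder p n : (p <= n <= L)%N ->
  vnrm P (fun w => frac_conv a h V n w - frac_conv a h V p w) <=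
    resid_drift_cst * ((n - p)%:R * h) `^ (a + holder_gap).
Proof.
have [e0 ea ae] := holder_gap_bounds.
have a20 : 0 < a / 2 by rewrite divr_gt0// a0.
have ha : holder_gap <= a by have := a0; lra.
have Z2 l : (l <= L)%N -> L2v P (Z l) by move=> lL; apply: L2v_mul; exact: scheme_L2v.
have I2 m : (m <= L)%N -> L2v P (frac_conv a h Z m).
  by move=> mL; apply: frac_conv_L2v => l lm; apply: Z2; exact: ltnW (leq_trans lm mL).
have cI2 m : (m <= L)%N -> L2v P (fun w => c *: frac_conv a h Z m w).
  by move=> mL; apply: L2vZ; exact: I2.
have [g2 _] := hg.
have DT x : 0 <= x <= T -> drift_cst * x `^ a + noise_cst * x `^ (a / 2) <=
   (drift_cst * T `^ (a - holder_gap) + noise_cst * T `^ (a / 2 - holder_gap)) * x `^ holder_gap.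
  move: drift_cst drift_cst_ge0 noise_cst noise_cst_ge0 => D D0 C C0 xT.
  rewrite mulrDl -!mulrA; apply: lerD; apply: ler_wpM2l => //; apply: powR_trade => //.
have mT l m : (l <= m <= L)%N -> 0 <= (m - l)%:R * h <= T.
  by move=> /andP[lm mL]; apply: nT; apply: leq_trans mL; exact: leq_subr.
have Y02 l : (l <= L)%N -> L2v P (fun w => Y l w - x0 w).
  by move=> lL; apply: L2vB => //; exact: scheme_L2v.
have bnd l m : (l <= m <= L)%N -> vnrm P (fun w => Y m w - Y l w) <=
    drift_cst * ((m - l)%:R * h) `^ a + noise_cst * ((m - l)%:R * h) `^ (a / 2).
  move=> lmL; have /andP[lm mL] := lmL; have lL := leq_trans lm mL.
  rewrite (vnrm_eq P (W := fun w => (c *: frac_conv a h Z m w - c *: frac_conv a h Z l w) +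
     (g m w - g l w))); last first.
    move=> w; rewrite (hY _ mL) (hY _ lL).
    by apply/matrixP => i j; rewrite !mxE; ring.
  apply: le_trans (vnrmD (L2vB (cI2 _ mL) (cI2 _ lL)) (L2vB (g2 _ mL) (g2 _ lL))) _.
  apply: lerD; first exact: drift_holder.
  by rewrite noise_incr_vnrm.
move=> pnL.
apply: (@frac_conv_holder _ _ _ P d a h a0 h0 V holder_gap resid_cst L) => //.
- exact: resid_cst_ge0.
- by move=> l lL; apply: L2v_mul; exact: Y02.
- move=> l lL.
  apply: le_trans (vnrm_mul B (Y02 l lL)) _.
  rewrite /resid_cst -mulrA ler_wpM2l ?mx_norm1_ge0//.
  apply: le_trans (DT _ (nT lL)).
  rewrite (vnrm_eq P (W := fun w => c *: frac_conv a h Z l w + g l w)); last first.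
    move=> w; rewrite (hY _ lL).
    by apply/matrixP => i j; rewrite !mxE; ring.
  apply: le_trans (vnrmD (cI2 _ lL) (g2 _ lL)) _.
  rewrite noise_vnrm// lerD2r.
  have := @drift_holder 0 l lL; rewrite subn0; apply: le_trans.
  rewrite le_eqVlt; apply/orP; left; apply/eqP; apply: vnrm_eq => w.
  by rewrite frac_conv0 scaler0 subr0.
- move=> l m lmL; have /andP[lm mL] := lmL; have lL := leq_trans lm mL.
  rewrite (vnrm_eq P (W := fun w => B *m (Y m w - Y l w))); last first.
    by move=> w; rewrite /V -mulmxBr; congr (_ *m _); rewrite opprB addrA subrK.
  apply: le_trans (vnrm_mul B (L2vB (scheme_L2v mL) (scheme_L2v lL))) _.
  rewrite /resid_cst -mulrA ler_wpM2l ?mx_norm1_ge0//.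
  by apply: le_trans (DT _ (mT _ _ lmL)); exact: bnd.
Qed.

Lemma scheme_incrE p n w : (p <= n <= L)%N ->
  Y n w - Y p w = (g n w - g p w) +
    (((n%:R * h) `^ a - (p%:R * h) `^ a) *: (c *: (B *m x0 w)) +
     c *: (frac_conv a h V n w - frac_conv a h V p w)).
Proof.
move=> /andP[pn nL]; have pL := leq_trans pn nL.
have E m : frac_conv a h Z m w = (m%:R * h) `^ a *: (B *m x0 w) + frac_conv a h V m w.
  rewrite -(frac_conv_cst h a0 (fun w => B *m x0 w)) -frac_convD; congr (frac_conv a h _ m w).
  apply/funext => l; apply/funext => v.
  by rewrite /Z /V -mulmxDr addrC subrK.
rewrite (hY _ nL) (hY _ pL) -/Z !E.
by apply/matrixP => i j; rewrite !mxE; ring.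
Qed.

End FineGrid.

Lemma sum_blocks (U : nmodType) (F : nat -> U) (n M : nat) :
  \sum_(l < n * M) F l = \sum_(j < n) \sum_(i < M) F (j * M + i)%N.
Proof.
elim: n => [|n IH]; first by rewrite !big_ord0.
by rewrite big_ord_recr/= -IH mulSnr big_split_ord.
Qed.

Section CoarseGrid.
Variables (h : R) (N M : nat) (g Y X : nat -> Omega -> 'cV[R]_d).
Hypotheses (h0 : 0 < h) (M0 : (0 < M)%N) (LT : (N * M)%:R * h <= T).
Hypotheses (hg : noise_grid h (N * M) g) (hY : is_scheme h (N * M) g Y).
Let k := M%:R * h.
Hypothesis hX : is_scheme k N (fun n => g (n * M)%N) X.
Local Notation om n j i := (fweight h a ((n - j.+1) * M + (M - i.+1))).

Let k0 : 0 < k. Proof. by rewrite mulr_gt0// ltr0n. Qed.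
Let NT : N%:R * k <= T. Proof. by rewrite /k mulrA -natrM. Qed.
Let om0 n j i : 0 <= om n j i.
Proof. by rewrite fweight_ge0 ?(ltW h0) ?(ltW a0). Qed.

Definition sum_fweight2 (n : nat) : R := \sum_(m < n) fweight k a m ^+ 2.

Lemma sum_block_weights n j : \sum_(i < M) om n j i = fweight k a (n - j.+1).
Proof.
by rewrite (sum_rev (fun i => fweight h a ((n - j.+1) * M + i))) sum_fweight_coarse.
Qed.

Lemma frac_conv_blocks (Z : nat -> Omega -> 'cV[R]_d) n w :
  frac_conv a h Z (n * M) w = \sum_(j < n) \sum_(i < M) om n j i *: Z (j * M + i)%N w.
Proof.
rewrite /frac_conv.
rewrite (sum_blocks (fun l => fweight h a (n * M - l.+1) *: Z l w)).
apply: eq_bigr => j _; apply: eq_bigr => i _; congr (fweight _ _ _ *: _).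
move: (nat_of_ord j) (ltn_ord j) => {}j jn.
by rewrite -{1}(subnKC jn) mulnDl mulSnr -addnA -addnS subnDl [(M + _)%N]addnC addnBA.
Qed.

Let blockL n j i : (n <= N)%N -> (j < n)%N -> (i < M)%N ->
  (j * M <= j * M + i <= N * M)%N.
Proof.
move=> nN jn iM; rewrite leq_addr/=.
apply: (@leq_trans (j.+1 * M)); first by rewrite mulSnr leq_add2l ltnW.
by rewrite leq_mul2r (leq_trans jn nN) orbT.
Qed.

Lemma noise_block_nrm n i0 : (n <= N)%N ->
  nrm P (fun w => \sum_(j < n) \sum_(i < M) om n j i *
     (g (j * M + i)%N w i0 0 - g (j * M)%N w i0 0)) <=
  Num.sqrt (2 * c1) * Num.sqrt (k `^ a * sum_fweight2 n).
Proof.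
move=> nN; have [g2 _] := hg.
pose F j w := \sum_(i < M) om n j i * (g (j * M + i)%N w i0 0 - g (j * M)%N w i0 0).
have G2 j i : (j < n)%N -> (i < M)%N ->
    L2 P (fun w => g (j * M + i)%N w i0 0 - g (j * M)%N w i0 0).
  move=> jn iM; have /andP[l1 l2] := blockL nN jn iM.
  by apply: L2B; apply: g2 => //; exact: leq_trans l1 l2.
have OF j (jn : (j < n)%N) (i : 'I_M) :
    L2 P (fun w => om n j i * (g (j * M + i)%N w i0 0 - g (j * M)%N w i0 0)).
  by apply: L2Z; exact: G2.
have F2 j : (j < n)%N -> L2 P (F j).
  by move=> jn; exact: (L2_sum (index_enum 'I_M) (OF j jn)).
have neg j l : (j < l < n)%N -> ip P (F j) (F l) <= 0.
  move=> /andP[jl ln]; have jn := ltn_trans jl ln.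
  rewrite {1}/F (ip_suml (index_enum 'I_M) (OF j jn) (F2 l ln)).
  apply: sumr_le0 => i _.
  rewrite {1}/F (ip_sumr (index_enum 'I_M) (OF l ln) (OF j jn i)).
  apply: sumr_le0 => i' _.
  have Gj := G2 j i jn (ltn_ord i); have Gl := G2 l i' ln (ltn_ord i').
  rewrite ipZl ?ipZr//; last exact: L2Z.
  rewrite mulrA mulr_ge0_le0 ?mulr_ge0//.
  have /andP[_ l2] := blockL nN ln (ltn_ord i').
  have jil : (j * M + i <= l * M)%N.
    apply: (@leq_trans (j.+1 * M)); last by rewrite leq_mul2r jl orbT.
    by rewrite mulSnr leq_add2l ltnW.
  exact: (noise_incr_negcorr h0 LT hg i0 (leq_addr i (j * M)) jil (leq_addr i' (l * M)) l2).
have key := nrm_sum_negcorr F2 neg.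
have Fn j : (j < n)%N -> nrm P (F j) <= fweight k a (n - j.+1) * Num.sqrt (2 * c1 * k `^ a).
  move=> jn; apply: le_trans (nrm_sum (index_enum 'I_M) (OF j jn)) _.
  rewrite -sum_block_weights mulr_suml; apply: ler_sum => i _.
  rewrite nrmZ; last exact: G2.
  rewrite ger0_norm// ler_wpM2l//.
  rewrite -[leLHS](ger0_norm (nrm_ge0 _ _)) -sqrtr_sqr ler_wsqrtr//.
  rewrite (noise_incr_nrm hg); last exact: (blockL nN jn (ltn_ord i)).
  rewrite ler_wpM2l ?mulr_ge0//; apply: powR_le_mono; rewrite ?(ltW a0)//.
    by rewrite mulr_ge0// ltW.
  by rewrite /k ler_pM2r// ler_nat addKn ltnW.
rewrite -sqrtrM ?mulr_ge0// -[leLHS](ger0_norm (nrm_ge0 _ _)) -sqrtr_sqr ler_wsqrtr//.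
apply: le_trans key _.
apply: (@le_trans _ _ (\sum_(j < n) (fweight k a (n - j.+1) * Num.sqrt (2 * c1 * k `^ a)) ^+ 2)).
  apply: ler_sum => j _; rewrite ler_sqr ?nnegrE ?nrm_ge0 ?Fn//.
  by rewrite mulr_ge0 ?sqrtr_ge0// fweight_ge0 ?(ltW k0) ?(ltW a0).
rewrite /sum_fweight2 -(sum_rev (fun m => fweight k a m ^+ 2)) !mulr_sumr.
apply: ler_sum => j _; rewrite exprMn sqr_sqrtr; last by rewrite !mulr_ge0 ?powR_ge0.
by rewrite le_eqVlt; apply/orP; left; apply/eqP; ring.
Qed.

Lemma init_block_le n : (n <= N)%N ->
  0 <= \sum_(j < n) \sum_(i < M) om n j i *
    (((j * M + i)%:R * h) `^ a - ((j * M)%:R * h) `^ a) <= sum_fweight2 n.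
Proof.
move=> nN.
have inc (j i : nat) : 0 <= ((j * M + i)%:R * h) `^ a - ((j * M)%:R * h) `^ a.
  rewrite subr_ge0; apply: powR_le_mono; rewrite ?(ltW a0) ?mulr_ge0 ?(ltW h0)//.
  by rewrite ler_pM2r// ler_nat leq_addr.
apply/andP; split.
  by do 2 apply: sumr_ge0 => ? _; rewrite mulr_ge0.
apply: (@le_trans _ _ (\sum_(j < n) fweight k a (n - j.+1) * fweight k a j)).
  apply: ler_sum => j _; rewrite -sum_block_weights mulr_suml.
  apply: ler_sum => i _; rewrite ler_wpM2l// /fweight /k !mulrA -!natrM lerD2r.
  apply: powR_le_mono; rewrite ?(ltW a0) ?mulr_ge0 ?(ltW h0)//.
  by rewrite ler_pM2r// ler_nat mulSnr leq_add2l ltnW.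
rewrite /sum_fweight2.
have -> : \sum_(m < n) fweight k a m ^+ 2 =
    \sum_(m < n) (fweight k a (n - m.+1) ^+ 2 / 2 + fweight k a m ^+ 2 / 2).
  rewrite big_split/= -!mulr_suml (sum_rev (fun m => fweight k a m ^+ 2)).
  by field.
apply: ler_sum => j _; have := sqr_ge0 (fweight k a (n - j.+1) - fweight k a j).
by rewrite sqrrB => ?; lra.
Qed.

Let S n w := \sum_(j < n) \sum_(i < M) om n j i *: (Y (j * M + i)%N w - Y (j * M)%N w).

Lemma scheme_block_vnrm n : (n <= N)%N ->
  L2v P (S n) /\
  vnrm P (S n) <= d%:R * (Num.sqrt (2 * c1) * Num.sqrt (k `^ a * sum_fweight2 n)) +
    sum_fweight2 n * (`|c| * vnrm P (fun w => B *m x0 w)) +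
    `|c| * (resid_drift_cst * k `^ (a + holder_gap) * T `^ a).
Proof.
move=> nN; have [g2 _] := hg.
pose V l w := B *m (Y l w - x0 w).
have Y2 l : (l <= N * M)%N -> L2v P (Y l) by exact: (scheme_L2v hg hY).
have V2 l : (l <= N * M)%N -> L2v P (V l).
  by move=> lL; apply: L2v_mul; apply: L2vB => //; exact: Y2.
have I2 l : (l <= N * M)%N -> L2v P (frac_conv a h V l).
  by move=> lL; apply: frac_conv_L2v => m ml; apply: V2; exact: ltnW (leq_trans ml lL).
have bx2 : L2v P (fun w => c *: (B *m x0 w)) by apply: L2vZ; exact: L2v_mul.
pose Sg w := \sum_(j < n) \sum_(i < M) om n j i *: (g (j * M + i)%N w - g (j * M)%N w).
pose kp := \sum_(j < n) \sum_(i < M) om n j i *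
    (((j * M + i)%:R * h) `^ a - ((j * M)%:R * h) `^ a).
pose SV w := \sum_(j < n) \sum_(i < M) om n j i *:
    (frac_conv a h V (j * M + i) w - frac_conv a h V (j * M) w).
have bl (j : 'I_n) (i : 'I_M) := blockL nN (ltn_ord j) (ltn_ord i).
have bl1 (j : 'I_n) (i : 'I_M) : (j * M <= N * M)%N.
  by have /andP[l1 l2] := bl j i; exact: leq_trans l1 l2.
have bl2 (j : 'I_n) (i : 'I_M) : (j * M + i <= N * M)%N.
  by have /andP[l1 l2] := bl j i.
have Lg (j : 'I_n) (i : 'I_M) : L2v P (fun w => om n j i *: (g (j * M + i)%N w - g (j * M)%N w)).
  by apply: L2vZ; apply: L2vB; apply: g2; [exact: bl2|exact: (bl1 j i)].
have LV (j : 'I_n) (i : 'I_M) : L2v P (fun w => om n j i *: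
    (frac_conv a h V (j * M + i) w - frac_conv a h V (j * M) w)).
  by apply: L2vZ; apply: L2vB; apply: I2; [exact: bl2|exact: (bl1 j i)].
have LVj (j : 'I_n) := L2v_sum (index_enum 'I_M) (LV j).
have Sg2 : L2v P Sg.
  exact: (L2v_sum (index_enum 'I_n) (fun j => L2v_sum (index_enum 'I_M) (Lg j))).
have SV2 : L2v P SV by exact: (L2v_sum (index_enum 'I_n) LVj).
have SE w : S n w = Sg w + (kp *: (c *: (B *m x0 w)) + c *: SV w).
  rewrite /S /Sg /kp /SV scaler_suml scaler_sumr -!big_split/=; apply: eq_bigr => j _.
  rewrite scaler_suml scaler_sumr -!big_split/=; apply: eq_bigr => i _.
  rewrite (scheme_incrE hY w (bl j i)) !scalerDr; congr (_ + (_ + _)).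
    by rewrite !scalerA.
  by rewrite !scalerA mulrC.
have L1 := L2vZ kp bx2; have L2' := L2vZ c SV2.
split.
  by apply: (@L2v_eq _ _ _ P _ _ _ (fun w => esym (SE w))); apply: L2vD => //; exact: L2vD.
rewrite (vnrm_eq P SE).
apply: le_trans (vnrmD Sg2 (L2vD L1 L2')) _.
rewrite -addrA; apply: lerD.
  rewrite /vnrm mulr_natl -[in leRHS](card_ord d) -sumr_const; apply: ler_sum => i0 _.
  apply: le_trans (noise_block_nrm i0 nN).
  rewrite le_eqVlt; apply/orP; left; apply/eqP; congr (nrm P _); apply/funext => w.
  rewrite /Sg summxE; apply: eq_bigr => j _; rewrite summxE; apply: eq_bigr => i _.
  by rewrite !mxE.
apply: le_trans (vnrmD L1 L2') _; apply: lerD.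
  rewrite vnrmZ// vnrmZ; last exact: L2v_mul.
  have /andP[kp0 kp1] := init_block_le nN.
  by rewrite ger0_norm// ler_wpM2r// mulr_ge0// vnrm_ge0.
rewrite vnrmZ// ler_wpM2l//.
have k1 := fun m => fweight_ge0 m (ltW k0) (ltW a0).
apply: (@le_trans _ _ (\sum_(j < n) fweight k a (n - j.+1) *
   (resid_drift_cst * k `^ (a + holder_gap)))).
  apply: le_trans (vnrm_sum (index_enum 'I_n) LVj) _; apply: ler_sum => j _.
  apply: le_trans (vnrm_sum (index_enum 'I_M) (LV j)) _.
  rewrite -sum_block_weights mulr_suml; apply: ler_sum => i _.
  rewrite vnrmZ; last by apply: L2vB; apply: I2; [exact: bl2|exact: (bl1 j i)].
  rewrite ger0_norm// ler_wpM2l//.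
  apply: le_trans (resid_holder h0 LT hg hY (bl j i)) _.
  rewrite ler_wpM2l ?resid_drift_cst_ge0//.
  have [e0 _ _] := holder_gap_bounds.
  apply: powR_le_mono; rewrite ?addr_ge0 ?(ltW a0)//.
    by rewrite mulr_ge0// ltW.
  by rewrite /k ler_pM2r// ler_nat addKn ltnW.
rewrite -mulr_suml (sum_rev (fweight k a)) sum_fweight ?gt_eqF//.
rewrite mulrC; apply: ler_wpM2l.
  by apply: mulr_ge0; [exact: resid_drift_cst_ge0|exact: powR_ge0].
apply: powR_le_mono; [exact: ltW|by apply: mulr_ge0; [|exact: ltW]|].
by apply: le_trans NT; rewrite ler_pM2r// ler_nat.
Qed.

Definition error_cst : R := K * (`|c| * b * (noise_cst +
  Num.sqrt (T `^ a) * (`|c| * vnrm P (fun w => B *m x0 w)) +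
  `|c| * (resid_drift_cst * T `^ a))).

Lemma scheme_error n : (n <= N)%N ->
  L2v P (fun w => X n w - Y (n * M)%N w) /\
  vnrm P (fun w => X n w - Y (n * M)%N w) <=
    error_cst * (Num.sqrt (k `^ a * sum_fweight2 N) + k `^ (a + holder_gap)).
Proof.
have [g2 gc] := hg.
have hgk : noise_grid k N (fun n => g (n * M)%N).
  split=> [m mN|i p q /andP[qp pN]]; first by apply: g2; rewrite leq_mul2r mN orbT.
  rewrite gc; last by rewrite !leq_mul2r qp pN !orbT.
  by rewrite -mulnBl /k !mulrA -!natrM.
have X2 m : (m <= N)%N -> L2v P (X m) by exact: (scheme_L2v hgk hX).
have Y2 l : (l <= N)%N -> L2v P (Y (l * M)%N).
  by move=> lN; apply: (scheme_L2v hg hY); rewrite leq_mul2r lN orbT.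
have E2 l : (l <= N)%N -> L2v P (fun w => X l w - Y (l * M)%N w).
  by move=> lN; apply: L2vB; [exact: X2|exact: Y2].
set Th := sum_fweight2 N; set sq := Num.sqrt (k `^ a * Th).
have fk m := fweight_ge0 m (ltW k0) (ltW a0).
have Th0 : 0 <= Th by apply: sumr_ge0 => m _; rewrite sqr_ge0.
have ThT : Th <= Num.sqrt (T `^ a) * sq.
  rewrite /sq -sqrtrM ?powR_ge0// -[leLHS](ger0_norm Th0) -sqrtr_sqr ler_wsqrtr//.
  rewrite expr2 mulrA ler_wpM2r//.
  apply: (@le_trans _ _ (k `^ a * \sum_(m < N) fweight k a m)).
    rewrite /Th /sum_fweight2 mulr_sumr; apply: ler_sum => m _.
    by rewrite expr2 ler_wpM2r// fweight_le_powR// a0 ltW// a1.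
  rewrite sum_fweight ?gt_eqF// mulrC ler_wpM2r ?powR_ge0//.
  by apply: powR_le_mono; [exact: ltW|apply: mulr_ge0; [|exact: ltW]|exact: NT].
pose A := `|c| * b * ((noise_cst + Num.sqrt (T `^ a) * (`|c| * vnrm P (fun w => B *m x0 w))) * sq +
  `|c| * (resid_drift_cst * T `^ a) * k `^ (a + holder_gap)).
have s0 : 0 <= sq by exact: sqrtr_ge0.
have A0 : 0 <= A.
  have cb0 : 0 <= `|c| * b := mulr_ge0 (normr_ge0 c) (mx_norm1_ge0 B).
  apply: (mulr_ge0 cb0); apply: addr_ge0.
    apply: mulr_ge0 s0; apply: (addr_ge0 noise_cst_ge0).
    exact: mulr_ge0 (sqrtr_ge0 _) (mulr_ge0 (normr_ge0 c) (vnrm_ge0 _ _)).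
  apply: mulr_ge0 (powR_ge0 _ _).
  exact: mulr_ge0 (normr_ge0 c) (mulr_ge0 resid_drift_cst_ge0 (powR_ge0 _ _)).
have main m : (m <= N)%N -> vnrm P (fun w => X m w - Y (m * M)%N w) <= K * A.
  move: m; apply: (gronwall k0 NT A0) => n' nN.
  have [S2 SB] := scheme_block_vnrm nN.
  pose E l w := X l w - Y (l * M)%N w.
  have EE w : E n' w = c *: frac_conv a k (fun l w => B *m E l w) n' w + (- c) *: (B *m S n' w).
    rewrite /E (hX _ nN) (hY w (_ : (n' * M <= N * M)%N)); last by rewrite leq_mul2r nN orbT.
    have -> : frac_conv a h (fun l w => B *m Y l w) (n' * M) w =
        frac_conv a k (fun l w => B *m Y (l * M)%N w) n' w + B *m S n' w.
      rewrite frac_conv_blocks /frac_conv /S mulmx_sumr -big_split/=; apply: eq_bigr => j _.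
      rewrite -sum_block_weights scaler_suml mulmx_sumr -big_split/=; apply: eq_bigr => i _.
      by rewrite -scalemxAr mulmxBr -scalerDr addrC subrK.
    have -> : frac_conv a k (fun l w => B *m (X l w - Y (l * M)%N w)) n' w =
        frac_conv a k (fun l w => B *m X l w) n' w -
        frac_conv a k (fun l w => B *m Y (l * M)%N w) n' w.
      rewrite /frac_conv -sumrB; apply: eq_bigr => j _.
      by rewrite mulmxBr scalerBr.
    by apply/matrixP => i j; rewrite !mxE; ring.
  have lN l : (l < n')%N -> (l <= N)%N by move=> ln; exact: ltnW (leq_trans ln nN).
  have C2 : L2v P (frac_conv a k (fun l w => B *m E l w) n').
    by apply: frac_conv_L2v => l ln; apply: L2v_mul; apply: E2; exact: lN.
  rewrite (vnrm_eq P EE).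
  apply: le_trans (vnrmD (L2vZ c C2) (L2vZ (- c) (L2v_mul B S2))) _.
  rewrite addrC; apply: lerD; last first.
    rewrite vnrmZ// -mulrA ler_wpM2l//.
    by apply: (vnrm_frac_conv_le k0 (Z := E)) => l ln; apply: E2; exact: lN.
  rewrite vnrmZ; last exact: L2v_mul.
  rewrite normrN /A -mulrA ler_wpM2l//.
  apply: le_trans (vnrm_mul B S2) _; rewrite ler_wpM2l ?mx_norm1_ge0//.
  apply: le_trans SB _.
  have Thn : sum_fweight2 n' <= Th.
    rewrite /Th /sum_fweight2 -(subnKC nN) big_split_ord/= lerDl.
    by apply: sumr_ge0 => m _; rewrite sqr_ge0.
  have sqn : Num.sqrt (k `^ a * sum_fweight2 n') <= sq.
    by rewrite /sq ler_wsqrtr// ler_wpM2l ?powR_ge0.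
  rewrite [leRHS]addrC; rewrite [leLHS]addrC; apply: lerD.
    by rewrite le_eqVlt; apply/orP; left; apply/eqP; ring.
  rewrite [leRHS]mulrDl; apply: lerD.
    by rewrite mulrA ler_wpM2l ?noise_cst_ge0.
  rewrite [leRHS]mulrAC ler_wpM2r ?mulr_ge0 ?vnrm_ge0//.
  exact: le_trans ThT.
move=> nN; split; first exact: E2.
apply: le_trans (main n nN) _.
rewrite /A /error_cst -[leRHS]mulrA; apply: ler_wpM2l; first exact: ltW.
rewrite -[leRHS]mulrA; apply: ler_wpM2l; first exact: mulr_ge0 (normr_ge0 c) (mx_norm1_ge0 B).
set q1 := noise_cst + _; set q2 := `|c| * (resid_drift_cst * _); set ke := k `^ _.
have q10 : 0 <= q1.
  apply: (addr_ge0 noise_cst_ge0).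
  exact: mulr_ge0 (sqrtr_ge0 _) (mulr_ge0 (normr_ge0 c) (vnrm_ge0 _ _)).
have q20 : 0 <= q2.
  exact: mulr_ge0 (normr_ge0 c) (mulr_ge0 resid_drift_cst_ge0 (powR_ge0 _ _)).
have ke0 : 0 <= ke by exact: powR_ge0.
rewrite -subr_ge0 (_ : _ - _ = q1 * ke + q2 * sq); last by ring.
exact: addr_ge0 (mulr_ge0 q10 ke0) (mulr_ge0 q20 s0).
Qed.

End CoarseGrid.
End SchemeError.

Lemma course_of_values (A : Type) (F : nat -> (nat -> A) -> A) (x : A) :
  (forall n u v, (forall l, (l < n)%N -> u l = v l) -> F n u = F n v) ->
  exists u : nat -> A, forall n, u n = F n u.
Proof.
move=> hF.
pose v := fix v n : nat -> A := if n is m.+1 then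
  fun l => if l == m then F m (v m) else v m l else fun=> x.
pose u n := v n.+1 n; exists u => n.
have vu m l : (l < m)%N -> v m l = u l.
  elim: m => // m IH; rewrite ltnS leq_eqVlt => /predU1P[->|lm] //.
  by rewrite [LHS]/= ifF ?IH// ltn_eqF.
by rewrite /u /= eqxx; apply: hF => l ln; exact: vu.
Qed.

Section Pathwise.
Context {R : realType} {d : nat}.
Implicit Types (v : 'cV[R]_d) (B : 'M[R]_d).

Definition vec_norm1 v : R := \sum_(i < d) `|v i 0|.

Lemma vec_norm1_coord v i : `|v i 0| <= vec_norm1 v.
Proof. by rewrite /vec_norm1 (bigD1 i)//= lerDl sumr_ge0. Qed.

Lemma vec_norm1D v w : vec_norm1 (v + w) <= vec_norm1 v + vec_norm1 w.
Proof.
by rewrite /vec_norm1 -big_split/=; apply: ler_sum => i _; rewrite mxE ler_normD.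
Qed.

Lemma vec_norm1Z (c : R) v : vec_norm1 (c *: v) = `|c| * vec_norm1 v.
Proof. by rewrite /vec_norm1 mulr_sumr; apply: eq_bigr => i _; rewrite mxE normrM. Qed.

Lemma vec_norm1_sum n (F : 'I_n -> 'cV[R]_d) :
  vec_norm1 (\sum_(l < n) F l) <= \sum_(l < n) vec_norm1 (F l).
Proof.
rewrite /vec_norm1 exchange_big/=; apply: ler_sum => i _.
by rewrite summxE ler_norm_sum.
Qed.

Lemma vec_norm1_mul B v : vec_norm1 (B *m v) <= mx_norm1 B * vec_norm1 v.
Proof.
rewrite /mx_norm1 mulr_suml; apply: ler_sum => i _; rewrite mxE.
apply: le_trans (ler_norm_sum _ _ _) _; rewrite mulr_suml; apply: ler_sum => j _.
by rewrite normrM ler_wpM2l// vec_norm1_coord.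
Qed.

Lemma continuous_mul_coord (T : R) B (y : R -> 'cV[R]_d) i :
  {within `[0, T], continuous y} ->
  {within `[0, T], continuous (fun s => (B *m y s) i 0)}.
Proof.
move=> cy t.
have -> : (fun s : subspace `[0, T] => (B *m y s) i 0) =
    (fun s => \sum_(j < d) B i j * y s j 0).
  by apply/funext => s; rewrite mxE.
rewrite /continuous_at /from_subspace; apply: cvg_big => [|j _].
  exact: add_continuous.
apply: cvgM; first exact: cvg_cst.
apply: (@cvg_comp _ _ _ (y : subspace `[0, T] -> 'cV[R]_d) (fun M : 'cV[R]_d => M j 0)).
  exact: cy.
exact: coord_continuous.
Qed.

Variables (a T c K : R) (B : 'M[R]_d) (x0 : 'cV[R]_d) (g y : R -> 'cV[R]_d).
Hypotheses (a01 : 0 < a <= 1) (K0 : 0 < K).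
Hypothesis gronwall : forall h (L : nat) (u : nat -> R) (A : R),
    0 < h -> L%:R * h <= T -> 0 <= A ->
    (forall n, (n <= L)%N ->
       u n <= A + `|c| * mx_norm1 B * \sum_(l < n) fweight h a (n - l.+1) * u l) ->
    forall n, (n <= L)%N -> u n <= K * A.
Hypothesis cy : {within `[0, T], continuous y}.
Hypothesis hy : forall t, 0 <= t <= T ->
  y t = x0 + (c * a) *: frac_int a t (fun s => B *m y s) + g t.

Lemma euler_path_error (h e : R) (L : nat) (Y : nat -> 'cV[R]_d) :
  0 < h -> L%:R * h <= T -> 0 <= e ->
  (forall i s t, 0 <= s <= T -> 0 <= t <= T -> `|s - t| <= h ->
     `|(B *m y s) i 0 - (B *m y t) i 0| <= e) ->
  (forall n, (n <= L)%N -> Y n = x0 + c *: \sum_(l < n) fweight h a (n - l.+1) *: (B *m Y l)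
     + g (n%:R * h)) ->
  forall n, (n <= L)%N -> vec_norm1 (Y n - y (n%:R * h)) <= K * (`|c| * (d%:R * (e * T `^ a))).
Proof.
move=> h0 LT e0 uy hY; have a0 : 0 < a by case/andP: a01.
have A0 : 0 <= `|c| * (d%:R * (e * T `^ a)).
  by apply: mulr_ge0 => //; apply: mulr_ge0 => //; apply: mulr_ge0 => //; exact: powR_ge0.
have fw0 m := fweight_ge0 m (ltW h0) (ltW a0).
move=> n nL.
apply: (gronwall (u := fun n => vec_norm1 (Y n - y (n%:R * h))) h0 LT A0 _ nL) => {nL}n nL.
have nh : n%:R * h <= T by apply: le_trans LT; rewrite ler_pM2r// ler_nat.
have nT : 0 <= n%:R * h <= T by rewrite nh andbT mulr_ge0// ltW.
pose q : 'cV[R]_d := \sum_(l < n) fweight h a (n - l.+1) *: (B *m y (l%:R * h)) -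
  a *: frac_int a (n%:R * h) (fun s => B *m y s).
have -> : Y n - y (n%:R * h) = c *: q +
    c *: \sum_(l < n) fweight h a (n - l.+1) *: (B *m (Y l - y (l%:R * h))).
  under [in RHS]eq_bigr do rewrite mulmxBr scalerBr.
  rewrite hY// hy// /q sumrB.
  by apply/matrixP => i j; rewrite !mxE; ring.
apply: le_trans (vec_norm1D _ _) _; rewrite !vec_norm1Z; apply: lerD.
  apply: ler_wpM2l => //.
  rewrite /vec_norm1 mulr_natl -[in leRHS](card_ord d) -sumr_const; apply: ler_sum => i _.
  have := kernel_riemann_bound a01 h0 nh (continuous_mul_coord (B := B) (i := i) cy) (uy i).
  rewrite distrC => /le_trans; rewrite /q !mxE summxE => H.
  under eq_bigr do rewrite mxE.
  apply: H; rewrite ler_wpM2l//.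
  by apply: powR_le_mono; rewrite ?(ltW a0)//; case/andP: nT.
rewrite -mulrA; apply: ler_wpM2l => //.
apply: le_trans (vec_norm1_sum _) _; rewrite mulr_sumr; apply: ler_sum => l _.
rewrite vec_norm1Z ger0_norm// mulrCA; apply: ler_wpM2l => //.
exact: vec_norm1_mul.
Qed.

Lemma euler_path_cvg (k : R) (n N : nat) (Y : nat -> nat -> 'cV[R]_d) : 0 < k ->
  N%:R * k <= T -> (n <= N)%N ->
  (forall M m, (m <= N * M.+1)%N -> Y M m = x0 +
     c *: \sum_(l < m) fweight (k / M.+1%:R) a (m - l.+1) *: (B *m Y M l)
     + g (m%:R * (k / M.+1%:R))) ->
  forall i, (fun M => Y M (n * M.+1)%N i 0) @ \oo --> y (n%:R * k) i 0.
Proof.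
move=> k0 NT nN hY i; apply/cvgn_distP => e e0.
pose D := K * (`|c| * (d%:R * T `^ a)).
have D0 : 0 <= D.
  apply: mulr_ge0; first exact: ltW.
  by apply: mulr_ge0 => //; apply: mulr_ge0 => //; exact: powR_ge0.
have e'0 : 0 < e / (1 + D) by rewrite divr_gt0// ltr_pwDl.
have : \forall dl \near (0 : R)^'+, forall j s t, 0 <= s <= T -> 0 <= t <= T -> `|s - t| <= dl ->
     `|(B *m y s) j 0 - (B *m y t) j 0| <= e / (1 + D).
  apply: filter_forall => j.
  exact: (uniform_continuity_itv (continuous_mul_coord (B := B) (i := j) cy) e'0).
move=> /filterI/(_ (nbhs_right_gt 0)) /filter_ex[dl [ul dl0]].
exists (Num.bound (k / dl)) => M bM.
have M0 : 0 < M.+1%:R :> R by rewrite ltr0n.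
have hM : k / M.+1%:R <= dl.
  rewrite ler_pdivrMr// mulrC -ler_pdivrMr//.
  apply: ltW; apply: lt_le_trans (archi_boundP _) _; first by rewrite divr_ge0// ltW.
  by rewrite ler_nat (leq_trans bM).
have h0 : 0 < k / M.+1%:R by rewrite divr_gt0.
have kE (m : nat) : (m * M.+1)%:R * (k / M.+1%:R) = m%:R * k.
  by rewrite natrM; field; rewrite gt_eqF.
have LT : (N * M.+1)%:R * (k / M.+1%:R) <= T by rewrite kE.
have nM : (n * M.+1 <= N * M.+1)%N by rewrite leq_mul2r nN orbT.
have uh j s t : 0 <= s <= T -> 0 <= t <= T -> `|s - t| <= k / M.+1%:R ->
    `|(B *m y s) j 0 - (B *m y t) j 0| <= e / (1 + D).
  by move=> sT tT st; apply: ul => //; exact: le_trans st hM.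
have := euler_path_error h0 LT (ltW e'0) uh (hY M) nM; rewrite kE => H.
have := vec_norm1_coord (Y M (n * M.+1)%N - y (n%:R * k)) i; rewrite !mxE => /le_trans; apply.
apply: le_trans H _.
rewrite (_ : K * _ = D / (1 + D) * e); last by rewrite /D; ring.
rewrite ler_piMl ?(ltW e0)// ler_pdivrMr ?ltr_pwDl// mul1r lerDr.
exact: ler01.
Qed.

End Pathwise.

Section SchemeConversion.
Context {dT : measure_display} {Omega : measurableType dT} {R : realType} {d : nat}.

Lemma frac_conv_schemeE (a k z : R) (B : 'M[R]_d) (X : nat -> Omega -> 'cV[R]_d) n w : 0 <= k ->
  (k `^ a / z) *: (\sum_(1 <= j < n.+1)
     (((n - j + 1)%:R `^ a - (n - j)%:R `^ a) *: (B *m X j.-1 w))) =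
  z^-1 *: frac_conv a k (fun l w => B *m X l w) n w.
Proof.
move=> k0; rewrite big_add1 big_mkord !scaler_sumr; apply: eq_bigr => l _.
rewrite !scalerA fweight_scale// addn1; congr (_ *: _).
by ring.
Qed.

Lemma L2v_msq (P : probability Omega R) (V : Omega -> 'cV[R]_d) :
  (forall i, measurable_fun setT (fun w => V w i 0)) -> (msq P V < +oo)%E -> L2v P V.
Proof.
move=> mV Vfin i; apply: L2P => //; apply: le_lt_trans Vfin.
apply: ge0_le_integral => //.
- by move=> w _; rewrite lee_fin sqr_ge0.
- by apply/measurable_EFinP; exact: measurable_funX.
- apply/measurable_EFinP; apply: measurable_sum => j.
  exact: measurable_funX.
- move=> w _; rewrite lee_fin (bigD1 i)//= lerDl sumr_ge0// => j _.
  by rewrite sqr_ge0.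
Qed.

End SchemeConversion.

Theorem mainTheorem4 (R : realType) (dT : measure_display)
    (Omega : measurableType dT) (P : probability Omega R)
    (d : nat) (T H sigma alpha : R) (B : 'M[R]_d)
    (x0 : Omega -> 'cV[R]_d) (BH : 'I_d -> R -> Omega -> R)
    (G : R -> Omega -> 'cV[R]_d) (x : R -> Omega -> 'cV[R]_d) :
  (0 < d)%N -> 0 < T ->
  1 / 2 < H < 1 -> alpha = 2 - 2 * H -> 0 < sigma ->
  (* initial condition: measurable with finite second moment *)
  (forall i, measurable_fun setT (fun w => x0 w i 0)) ->
  (msq P x0 < +oo)%E ->
  (* driving noise: d-dimensional fBm *)
  is_fBm P H BH ->
  (* G(t) = sigma/Gamma(alpha) int_0^t (t-s)^(alpha-1) dB_H(s), the Wiener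
     integral, i.e. the L^2-limit of the Riemann-Stieltjes sums *)
  (forall t i, 0 <= t <= T -> measurable_fun setT (fun w => G t w i 0)) ->
  (forall t i, 0 <= t <= T ->
     (fun m : nat => (\int[P]_w
        ((G t w i 0 - sigma / Gamma alpha * frac_sum BH alpha t m i w) ^+ 2)%:E)%E)
       @ \oo --> 0%E) ->
  (* x is a continuous strong solution of the equation on [0,T] *)
  (forall t i, 0 <= t <= T -> measurable_fun setT (fun w => x t w i 0)) ->
  (forall w, {within `[0, T], continuous (fun t => x t w)}) ->
  {ae P, forall w, forall t, 0 <= t <= T ->
     x t w = x0 w + (Gamma alpha)^-1 *: frac_int alpha t (fun s => B *m x s w)
             + G t w} ->
  exists C : R, 0 < C /\
  forall (N : nat) (X : nat -> Omega -> 'cV[R]_d),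
    (0 < N)%N -> T / N%:R < 1 ->
    (* the numerical scheme, with k = T/N and t_n = n k *)
    (forall n w, (n <= N)%N ->
       X n w = x0 w
         + ((T / N%:R) `^ alpha / Gamma (1 + alpha)) *:
             \sum_(1 <= j < n.+1)
                (((n - j + 1)%:R `^ alpha - (n - j)%:R `^ alpha)
                   *: (B *m X j.-1 w))
         + G (n%:R * (T / N%:R)) w)%R ->
    forall n, (n <= N)%N ->
      (msq P (fun w => (X n w - x (n%:R * (T / N%:R)) w)%R)
        <= ((C * conv_rate H (T / N%:R)) ^+ 2)%R%:E)%E.
Proof.
move=> d0 T0 H12 aH sigma0 mx0 x0fin hB mG cG mx cx hx.
have a01 : 0 < alpha < 1 by rewrite aH; lra.
have a01' : 0 < alpha <= 1 by lra.
have a0 : 0 < alpha by lra.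
have x02 : L2v P x0 by exact: L2v_msq.
pose c := (Gamma (1 + alpha))^-1.
have cE : (Gamma alpha)^-1 = c * alpha.
  by rewrite /c (GammaS a01') invfM mulrAC mulVf ?mul1r// gt_eqF.
have [beta cb] := fgn_conv_cvg a01.
pose c1 := (sigma / Gamma alpha) ^+ 2 * (beta / alpha).
have hG h (L : nat) : 0 < h -> L%:R * h <= T ->
    noise_grid P alpha c1 h L (fun n => G (n%:R * h)).
  move=> h0 LT; split=> [n nL i|i p q /andP[qp pL]].
    apply: (frac_noise_L2 hB (fun t tT => mG t i tT) (fun t tT => cG t i tT)).
    rewrite mulr_ge0 ?(ltW h0)//=; apply: le_trans LT.
    by rewrite ler_pM2r// ler_nat.
  apply: (frac_noise_ip hB a01 aH (fun t tT => mG t i tT) (fun t tT => cG t i tT) cb h0 _ qp).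
  by apply: le_trans LT; rewrite ler_pM2r// ler_nat.
have c10 : 0 <= c1.
  have LT : 1%:R * T <= T by rewrite mul1r.
  have [_ /(_ (Ordinal d0) 1%N 1%N isT) ipE] := hG T 1%N T0 LT.
  have := nrm_sqr P (fun w => G (1%:R * T) w (Ordinal d0) 0).
  rewrite ipE subnn mul0r powR0 ?gt_eqF// mul1r subr0 => nE.
  have Ta0 : 0 < T `^ alpha + T `^ alpha by rewrite addr_gt0// powR_gt0.
  by rewrite -(pmulr_lge0 _ Ta0) -nE sqr_ge0.
have cb0 : 0 <= `|c| * mx_norm1 B := mulr_ge0 (normr_ge0 c) (mx_norm1_ge0 B).
have [K K0 gronwall] := fractional_gronwall a01' cb0 (ltW T0).
have [Cr Cr0 rate] := rate_bound H12 T0.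
pose E := error_cst P alpha T c c1 K B x0.
exists (2 * (`|E| * Cr) + 1); split.
  by rewrite ltr_wpDl// mulr_ge0// mulr_ge0// ltW.
move=> N X N0 k1; have := rate N N0 k1; rewrite -aH; set k := T / N%:R => /= -[r1 r2] hX n nN.
have k0 : 0 < k by rewrite divr_gt0// ltr0n.
have NT : N%:R * k = T by rewrite /k mulrC divfK// pnatr_eq0 -lt0n.
have rate0 : 0 <= conv_rate H k.
  by rewrite -(pmulr_rge0 _ Cr0); apply: le_trans r1; exact: powR_ge0.
have exY M : exists Y : nat -> Omega -> 'cV[R]_d, forall m, Y m = fun w => x0 w +
    c *: frac_conv alpha (k / M.+1%:R) (fun l w => B *m Y l w) m w + G (m%:R * (k / M.+1%:R)) w.
  pose F m (Y : nat -> Omega -> 'cV[R]_d) w := x0 w +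
    c *: frac_conv alpha (k / M.+1%:R) (fun l w => B *m Y l w) m w + G (m%:R * (k / M.+1%:R)) w.
  apply: (@course_of_values _ F (fun=> 0)) => m u v uv; apply/funext => w.
  rewrite /F /frac_conv; congr (_ + _ *: _ + _); apply: eq_bigr => l _.
  by rewrite uv.
pose Y M := projT1 (cid (exY M)).
have hY M m w : Y M m w = x0 w +
    c *: frac_conv alpha (k / M.+1%:R) (fun l w => B *m Y M l w) m w + G (m%:R * (k / M.+1%:R)) w.
  by rewrite /Y; case: (cid (exY M)) => /= Z ZE; rewrite [in LHS]ZE.
have M0 (M : nat) : 0 < M.+1%:R :> R by rewrite ltr0n.
have h0 M : 0 < k / M.+1%:R by rewrite divr_gt0.
have kE M (m : nat) : (m * M.+1)%:R * (k / M.+1%:R) = m%:R * k.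
  by rewrite natrM; field; rewrite gt_eqF.
have LT M : (N * M.+1)%:R * (k / M.+1%:R) <= T by rewrite kE NT.
have kM M : M.+1%:R * (k / M.+1%:R) = k by rewrite mulrC divfK// gt_eqF.
have sXk : is_scheme alpha c B x0 k N (fun m => G (m%:R * k)) X.
  by move=> m w mN; rewrite hX// frac_conv_schemeE// ltW.
have sX M : is_scheme alpha c B x0 (M.+1%:R * (k / M.+1%:R)) N
    (fun m => G ((m * M.+1)%:R * (k / M.+1%:R))) X.
  by rewrite kM => m w mN; rewrite kE; exact: sXk.
have sY M : is_scheme alpha c B x0 (k / M.+1%:R) (N * M.+1)
    (fun m => G (m%:R * (k / M.+1%:R))) (Y M) by move=> m w _.
have err M := scheme_error a01 T0 c10 K0 x02 gronwall (h0 M) (ltn0Sn M) (LT M)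
  (hG _ _ (h0 M) (LT M)) (sY M) (sX M) nN.
have nT : 0 <= n%:R * k <= T.
  by rewrite mulr_ge0 ?(ltW k0)//= -NT ler_pM2r// ler_nat.
have NT' : N%:R * k <= T by rewrite NT.
have X2 : L2v P (X n) := scheme_L2v x02 (hG k N k0 NT') sXk nN.
apply: (@fatou_bound _ _ _ P (fun M w => \sum_(i < d) ((X n w - Y M (n * M.+1)%N w) i 0) ^+ 2)).
- move=> M; apply: measurable_sum => i; apply: measurable_funX.
  by have [D2 _] := err M; case: (D2 i).
- apply: measurable_sum => i; apply: measurable_funX.
  rewrite (_ : (fun w => _) = fun w => X n w i 0 - x (n%:R * k) w i 0); last first.
    by apply/funext => w; rewrite !mxE.
  by apply: measurable_funB; [case: (X2 i)|exact: mx].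
- by move=> M w; apply: sumr_ge0 => i _; exact: sqr_ge0.
- by move=> w; apply: sumr_ge0 => i _; exact: sqr_ge0.
- apply: filterS hx => w hw; apply: cvg_big => [|i _]; first exact: add_continuous.
  have hw' t : 0 <= t <= T ->
      x t w = x0 w + (c * alpha) *: frac_int alpha t (fun s => B *m x s w) + G t w.
    by move=> tT; rewrite -cE; exact: hw.
  have := @euler_path_cvg R d alpha T c K B (x0 w) (G ^~ w) (x ^~ w) a01' K0 gronwall (cx w) hw'
     k n N (fun M m => Y M m w) k0 NT' nN (fun M m _ => hY M m w) i.
  move=> Yc.
  rewrite (_ : (fun M => _) = fun M => (X n w i 0 - Y M (n * M.+1)%N w i 0) *
     (X n w i 0 - Y M (n * M.+1)%N w i 0)); last first.
    by apply/funext => M; rewrite !mxE expr2.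
  rewrite expr2 !mxE.
  by apply: cvgM; apply: cvgB => //; exact: cvg_cst.
- move=> M; have [D2 Dn] := err M.
  apply: le_trans (msq_le D2) _; rewrite lee_fin ler_sqr ?nnegrE; first last.
  + by apply: mulr_ge0 => //; rewrite addr_ge0// mulr_ge0// mulr_ge0// ltW.
  + exact: vnrm_ge0.
  apply: le_trans Dn _; rewrite /sum_fweight2 kM -/E.
  set s1 := Num.sqrt _; set s2 := k `^ _.
  have s1r : s1 <= Cr * conv_rate H k by exact: r2.
  have s2r : s2 <= Cr * conv_rate H k by exact: r1.
  have s10 : 0 <= s1 by exact: sqrtr_ge0.
  have s20 : 0 <= s2 by exact: powR_ge0.
  apply: (@le_trans _ _ (`|E| * (s1 + s2))).
    by rewrite ler_wpM2r ?addr_ge0// ler_norm.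
  apply: (@le_trans _ _ (`|E| * (Cr * conv_rate H k + Cr * conv_rate H k))).
    by rewrite ler_wpM2l// lerD.
  rewrite -subr_ge0 (_ : _ - _ = conv_rate H k)//.
  by ring.
Qed.
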